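(* Let the data, the estimators $\widehat m_{\boldsymbol\vartheta},\widehat\sigma_{\boldsymbol\vartheta}$, the residuals $\widehat\varepsilon_j$, the statistic $\Delta_{n,W}$ and the assumptions (A.1)--(A.6), (A.8), (A.9) be as specified in the context. Suppose that the estimator $\widehat{\boldsymbol\vartheta}$ converges in probability to some $\boldsymbol\vartheta^0\in\Theta$, and that $\boldsymbol\vartheta^0$ satisfies $$\int_{\mathbb R}\int_{\mathbb R^p}\big|\varphi_{\boldsymbol X,\varepsilon_{\boldsymbol\vartheta^0}}(\boldsymbol t_2,t_1)-\varphi_{\boldsymbol X}(\boldsymbol t_2)\,\varphi_{\varepsilon_{\boldsymbol\vartheta^0}}(t_1)\big|^2\,W(t_1,\boldsymbol t_2)\,d\boldsymbol t_2\,dt_1>0,$$ where $\varphi_{\boldsymbol X,\varepsilon_{\boldsymbol\vartheta}}$, $\varphi_{\boldsymbol X}$ and $\varphi_{\varepsilon_{\boldsymbol\vartheta}}$ denote the joint characteristic function of $(\boldsymbol X,\varepsilon_{\boldsymbol\vartheta})$ and the marginal characteristic functions of $\boldsymbol X$ and $\varepsilon_{\boldsymbol\vartheta}$. Suppose that (A.1)--(A.4), (A.8) and (A.9) are satisfied, and that (A.5) and (A.6), stated in the context with $\boldsymbol\vartheta^0$ as reference parameter, are also satisfied, with $s_1=s_2=1$. Then, as $n\to\infty$, $$\Delta_{n,W}\stackrel{P}{\to}\infty .$$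
   Context: Setting. $(Y_j,\boldsymbol X_j)$, $j=1,\dots,n$, are independent copies of $(Y,\boldsymbol X)\in\mathbb R\times\mathbb R^p$; $\{\mathcal T_{\boldsymbol\vartheta}:\boldsymbol\vartheta\in\Theta\}$, $\Theta\subseteq\mathbb R^q$, $q\ge1$, is a parametric family of transformations of the response. For $\boldsymbol\vartheta\in\Theta$ put $m_{\boldsymbol\vartheta}(\boldsymbol X)=E(\mathcal T_{\boldsymbol\vartheta}(Y)\mid\boldsymbol X)$, $\sigma^2_{\boldsymbol\vartheta}(\boldsymbol X)=\mathrm{Var}(\mathcal T_{\boldsymbol\vartheta}(Y)\mid\boldsymbol X)$ and $\varepsilon_{\boldsymbol\vartheta}=\{\mathcal T_{\boldsymbol\vartheta}(Y)-m_{\boldsymbol\vartheta}(\boldsymbol X)\}/\sigma_{\boldsymbol\vartheta}(\boldsymbol X)$. Estimators. With kernel $K$ and bandwidth $h=h_n$, $$\widehat f(\boldsymbol x)=\frac1{nh^p}\sum_{v=1}^nK\Big(\frac{\boldsymbol x-\boldsymbol X_v}{h}\Big),\qquad \widehat m_{\boldsymbol\vartheta}(\boldsymbol x)=\frac1{\widehat f(\boldsymbol x)}\frac1{nh^p}\sum_{v=1}^nK\Big(\frac{\boldsymbol x-\boldsymbol X_v}{h}\Big)\mathcal T_{\boldsymbol\vartheta}(Y_v),$$ $$\widehat\sigma^2_{\boldsymbol\vartheta}(\boldsymbol x)=\frac1{\widehat f(\boldsymbol x)}\frac1{nh^p}\sum_{v=1}^nK\Big(\frac{\boldsymbol x-\boldsymbol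 X_v}{h}\Big)\big(\mathcal T_{\boldsymbol\vartheta}(Y_v)-\widehat m_{\boldsymbol\vartheta}(\boldsymbol x)\big)^2.$$ $\widehat{\boldsymbol\vartheta}$ is the estimator of the transformation parameter based on $(Y_j,\boldsymbol X_j)$, $j=1,\dots,n$, and the residuals are $\widehat\varepsilon_j=\{\mathcal T_{\widehat{\boldsymbol\vartheta}}(Y_j)-\widehat m_{\widehat{\boldsymbol\vartheta}}(\boldsymbol X_j)\}/\widehat\sigma_{\widehat{\boldsymbol\vartheta}}(\boldsymbol X_j)$. Test statistic. For a weight function $W\ge0$, $$\Delta_{n,W}=n\int_{-\infty}^\infty\int_{\mathbb R^p}\big|\widehat\varphi(t_1,\boldsymbol t_2)-\widehat\varphi_{\boldsymbol X}(\boldsymbol t_2)\widehat\varphi_{\widehat\varepsilon}(t_1)\big|^2W(t_1,\boldsymbol t_2)\,dt_1\,d\boldsymbol t_2,$$ where $\widehat\varphi(t_1,\boldsymbol t_2)=\frac1n\sum_{j=1}^n\exp\{i\boldsymbol t_2^\top\boldsymbol X_j+it_1\widehat\varepsilon_j\}$, $\widehat\varphi_{\boldsymbol X}(\boldsymbol t_2)=\widehat\varphi(0,\boldsymbol t_2)$, $\widehat\varphi_{\widehat\varepsilon}(t_1)=\widehat\varphi(t_1,\boldsymbol 0)$. Assumptions. (A.1) $(Y_j,\boldsymbol X_j)$, $j=1,\dots,n$, are i.i.d. random vectors, and the $\boldsymbol X_j$ have compact support $\mathcal R_X\subset\mathbb R^p$. (A.2) $K(\boldsymbol y)=\prod_{s=1}^pk(y_s)$,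 $\boldsymbol y=(y_1,\dots,y_p)^\top$, with $k$ symmetric and continuous in $[-1,1]$ and $\int_{-1}^1u^rk(u)\,du=\delta_{r,0}$ for $r=0,\dots,p$ (Kronecker delta), $\int_{-1}^1u^{p+1}k(u)\,du\neq0$. (A.3) $(nh^p)^{-1}+nh^{p+\delta}\to0$ as $n\to\infty$ for some $\delta>0$. (A.4) $E\|\boldsymbol X_j\|^2<\infty$, and $\boldsymbol X_j$ has a density $f$ with $0<\inf_{\boldsymbol x\in\mathcal R_X}f(\boldsymbol x)\le\sup_{\boldsymbol x\in\mathcal R_X}f(\boldsymbol x)<\infty$ and $|f(\boldsymbol x)-L(f,\boldsymbol y,\boldsymbol x-\boldsymbol y,s_1)|\le\|\boldsymbol x-\boldsymbol y\|^{s_1+\delta_1}d_1(\boldsymbol y)$, where $L(f,\boldsymbol y,\boldsymbol x-\boldsymbol y,s_1)$ is the Taylor expansion of $f$ of order $s_1$ at $\boldsymbol y$, $\delta_1>0$ and $E|d_1(\boldsymbol X_j)|^2<\infty$, for some $s_1$ with $s_1+1\ge p/2$. (A.5), with reference parameter $\boldsymbol\vartheta^0$: for $\boldsymbol x\in\mathcal R_X$, $|m_{\boldsymbol\vartheta^0}(\boldsymbol x)-L_{\boldsymbol\vartheta^0}(m,\boldsymbol y_0,\boldsymbol x-\boldsymbol y_0,s_2)|\le\|\boldsymbol x-\boldsymbol y_0\|^{s_2+\delta_2}d_2(\boldsymbol y_0)$ and $|\sigma_{\boldsymbol\vartheta^0}(\boldsymbol x)-L_{\boldsymbol\vartheta^0}(\sigma,\boldsymbol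 y_0,\boldsymbol x-\boldsymbol y_0,s_3)|\le\|\boldsymbol x-\boldsymbol y_0\|^{s_3+\delta_2}d_3(\boldsymbol y_0)$, where $L_{\boldsymbol\vartheta^0}(m,\boldsymbol y_0,\cdot,s_2)$ and $L_{\boldsymbol\vartheta^0}(\sigma,\boldsymbol y_0,\cdot,s_3)$ are the Taylor expansions at $\boldsymbol y_0$ of $m_{\boldsymbol\vartheta^0}$ of order $s_2$ and of $\sigma_{\boldsymbol\vartheta^0}$ of order $s_3$, $\delta_2>0$, $E|d_2(\boldsymbol X_j)|^2<\infty$ for some $s_2\ge p/2$, $E|d_3(\boldsymbol X_j)|^2<\infty$ for some $s_3\ge p/2$, $E\,m^2_{\boldsymbol\vartheta^0}(\boldsymbol X_j)<\infty$ and $E\,\sigma^2_{\boldsymbol\vartheta^0}(\boldsymbol X_j)<\infty$. (A.6), with reference parameter $\boldsymbol\vartheta^0=(\vartheta^0_1,\dots,\vartheta^0_q)^\top$: $\{\mathcal T_{\boldsymbol\vartheta}:\boldsymbol\vartheta\in\Theta\}$ is a parametric class of strictly increasing transformations, $\Theta$ is an open measurable subset of $\mathbb R^q$, and for some $\xi>0$ and some $\delta_4>0$, $$\sup_{\|\boldsymbol\vartheta-\boldsymbol\vartheta^0\|\le\xi}\Big|\mathcal T_{\boldsymbol\vartheta}(Y_j)-\mathcal T_{\boldsymbol\vartheta^0}(Y_j)-\sum_{s=1}^q(\vartheta_s-\vartheta^0_s)\frac{\partial\mathcal T_{\boldsymbol\vartheta}(Y_j)}{\partial\vartheta_s}\Big|_{\boldsymbol\vartheta=\boldsymbol\vartheta^0}\Big|\Big/\|\boldsymbol\vartheta-\boldsymbol\vartheta^0\|^{1+\delta_4}\le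 d_4(Y_j),$$ where $E\,d_4^2(Y_j)<\infty$ and $E(|d_4(Y_j)|\mid\boldsymbol X_j)<\infty$ a.s.; moreover $E\big(\frac{\partial\mathcal T_{\boldsymbol\vartheta}(Y_j)}{\partial\vartheta_s}\big|_{\boldsymbol\vartheta=\boldsymbol\vartheta^0}\mid\boldsymbol X_j\big)=\frac{\partial E(\mathcal T_{\boldsymbol\vartheta}(Y_j)\mid\boldsymbol X_j)}{\partial\vartheta_s}\big|_{\boldsymbol\vartheta=\boldsymbol\vartheta^0}$ a.s., $E\big[\big(E\big(\frac{\partial\mathcal T_{\boldsymbol\vartheta}(Y_j)}{\partial\vartheta_s}\big|_{\boldsymbol\vartheta=\boldsymbol\vartheta^0}\mid\boldsymbol X_j\big)\big)^2\big]<\infty$, and $E\,\mathcal T^2_{\boldsymbol\vartheta}(Y_j)<\infty$. (A.8) $W(t_1,\boldsymbol t_2)=w_1(t_1)w_2(\boldsymbol t_2)$ with $w_1(t)=w_1(-t)$ for $t\in\mathbb R$, $\int_{-\infty}^\infty t^2w_1(t)\,dt<\infty$, and $w_2(\boldsymbol t)=w_2(-\boldsymbol t)$ for $\boldsymbol t\in\mathbb R^p$. (A.9) $\{\mathcal T_{\boldsymbol\vartheta}:\boldsymbol\vartheta\in\Theta\}$ is a parametric class of strictly increasing transformations, $\Theta$ is an open measurable subset of $\mathbb R^q$, and for all $\boldsymbol\vartheta\in\Theta$, $|\mathcal T_{\boldsymbol\vartheta}(Y_j)-\mathcal T_{\boldsymbol\vartheta^0}(Y_j)|\le d_5(Y_j)\|\boldsymbol\vartheta-\boldsymbol\vartheta^0\|$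 with $E|d_5(Y_j)|<\infty$. Here $s_1$ is the smoothness order appearing in (A.4), and $s_2$ the one appearing in (A.5). *)

(* Defs.v *)
From HB Require Import structures.
From mathcomp Require Import all_boot all_order all_algebra.
From mathcomp Require Import all_classical all_reals all_analysis.
From mathcomp.real_closed Require Import complex.
Import Order.TTheory GRing.Theory Num.Theory.
Import numFieldNormedType.Exports.

Set Implicit Arguments.
Unset Strict Implicit.
Unset Printing Implicit Defensive.

Local Open Scope classical_set_scope.
Local Open Scope ring_scope.

Definition rv_display : measure_display.
Proof. exact: default_measure_display. Qed.

(* The sigma-algebra of R^p is the one generated by the coordinates.          *)
Section rv_measurable.
Context (R : realType) (p : nat).

Definition rv_coord (i : 'I_p) (x : 'rV[R]_p) : measurableTypeR R := x ord0 i.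

Let rv_set0 : g_sigma_preimage rv_coord set0.
Proof. exact: sigma_algebra0. Qed.

Let rv_setC A : g_sigma_preimage rv_coord A -> g_sigma_preimage rv_coord (~` A).
Proof. exact: sigma_algebraC. Qed.

Let rv_bigcup (F : _^nat) : (forall i, g_sigma_preimage rv_coord (F i)) ->
  g_sigma_preimage rv_coord (\bigcup_i (F i)).
Proof. exact: sigma_algebra_bigcup. Qed.

HB.instance Definition _ := @isMeasurable.Build rv_display 'rV[R]_p
  (g_sigma_preimage rv_coord) rv_set0 rv_setC rv_bigcup.

End rv_measurable.

Lemma measurable_fun_rvP d (T : measurableType d) (R : realType) (p : nat)
    (f : T -> 'rV[R]_p) :
  measurable_fun [set: T] f <->
  forall i, measurable_fun [set: T] (@rv_coord R p i \o f).
Proof.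
apply: (@iff_trans _ (g_sigma_preimage
    (fun i => @rv_coord R p i \o f) `<=` measurable)).
  rewrite g_sigma_preimage_comp; split=> [mf A [/= C preC <-]|prefS].
    exact: mf.
  by move=> _ A mA; apply: prefS; exists A.
split=> [fS i|mf].
- move=> _ A mA; apply: fS; apply: sub_sigma_algebra.
  case: p i => [[] []//|n i] in f *.
  rewrite -bigcup_mkord_ord.
  exists i; first exact: ltn_ord.
  by exists A => //; rewrite inord_val.
- apply: smallest_sub; first exact: sigma_algebra_measurable.
  case: p => [|n] in f mf *; first by rewrite big_ord0.
  rewrite -bigcup_mkord_ord; apply: bigcup_sub => i Ii.
  by move=> A [B mB <-]; exact: mf.
Qed.

Lemma measurable_rv_coord (R : realType) (p : nat) (i : 'I_p) :
  measurable_fun [set: 'rV[R]_p] (@rv_coord R p i).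
Proof. by apply: (measurable_fun_rvP idfun).1 => //; exact: measurable_id. Qed.

Section rv_lebesgue.
Context (R : realType).

Definition rv_cons (p : nat) (z : measurableTypeR R * 'rV[R]_p) : 'rV[R]_p.+1 :=
  \row_i (if unlift ord0 i is Some j then z.2 ord0 j else z.1).

Definition rv_uncons (p : nat) (x : 'rV[R]_p.+1) :
    measurableTypeR R * 'rV[R]_p :=
  (x ord0 ord0, \row_j x ord0 (lift ord0 j)).

Lemma rv_consK (p : nat) : cancel (@rv_cons p) (@rv_uncons p).
Proof.
move=> [a x]; rewrite /rv_uncons /rv_cons !mxE unlift_none; congr pair.
by apply/rowP => j; rewrite !mxE liftK.
Qed.

Lemma measurable_rv_cons (p : nat) : measurable_fun setT (@rv_cons p).
Proof.
apply/measurable_fun_rvP => i.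
case: (unliftP ord0 i) => [j|] ->.
  rewrite (_ : _ \o _ = @rv_coord R p j \o snd); last first.
    by apply/funext => z; rewrite /= /rv_coord /rv_cons mxE liftK.
  by apply: measurableT_comp => //; exact: measurable_rv_coord.
rewrite (_ : _ \o _ = fst); last first.
  by apply/funext => z; rewrite /= /rv_coord /rv_cons mxE unlift_none.
exact: measurable_fst.
Qed.

Lemma measurable_rv_uncons (p : nat) : measurable_fun setT (@rv_uncons p).
Proof.
apply/measurable_fun_pairP; split; first exact: measurable_rv_coord.
apply/measurable_fun_rvP => j.
rewrite (_ : _ \o _ = @rv_coord R p.+1 (lift ord0 j)).
  exact: measurable_rv_coord.
by apply/funext => x; rewrite /= /rv_coord mxE.
Qed.

Section step.
Context (p : nat) (mu : {sigma_finite_measure set 'rV[R]_p -> \bar R}).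

Definition rv_lebesgue_step : set 'rV[R]_p.+1 -> \bar R :=
  pushforward (@lebesgue_measure R \x mu)%E (@rv_cons p).


HB.instance Definition _ := Measure.copy rv_lebesgue_step
  (measure_function_pushforward__canonical__measure_function_Measure
    (@lebesgue_measure R \x mu)%E (@measurable_rv_cons p)).

Let rv_lebesgue_step_sigma_finite : sigma_finite setT rv_lebesgue_step.
Proof.
have /sigma_finiteP[F [TF ndF Foo]] := sigma_finiteT (@lebesgue_measure R).
have /sigma_finiteP[G [TG ndG Goo]] := sigma_finiteT mu.
exists (fun k => @rv_uncons p @^-1` (F k `*` G k)).
  apply/esym; rewrite -subTset => x _.
  have [n _ Fn] : (\bigcup_k F k) (rv_uncons x).1 by rewrite -TF.
  have [m _ Gm] : (\bigcup_k G k) (rv_uncons x).2 by rewrite -TG.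
  exists (maxn n m) => //; split.
    by move: Fn; exact/subsetPset/ndF/leq_maxl.
  by move: Gm; exact/subsetPset/ndG/leq_maxr.
move=> k; have [mF Fk] := Foo k; have [mG Gk] := Goo k; split.
  rewrite -[X in measurable X]setTI; apply: measurable_rv_uncons => //.
  exact: measurableX.
rewrite /rv_lebesgue_step /pushforward -comp_preimage.
rewrite (_ : _ \o _ = id) ?preimage_id; last first.
  by apply/funext => z /=; rewrite rv_consK.
by rewrite product_measure1E// lte_mul_pinfty// ge0_fin_numE.
Qed.

HB.instance Definition _ := Measure_isSigmaFinite.Build _ _ _ rv_lebesgue_step
  rv_lebesgue_step_sigma_finite.
End step.

(* p-dimensional Lebesgue measure, obtained by iterating the product with the *)
(* one-dimensional one.                                                       *)
Fixpoint rv_lebesgue (p : nat) : {sigma_finite_measure set 'rV[R]_p -> \bar R} :=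
  if p is p'.+1 then rv_lebesgue_step (rv_lebesgue p') else dirac (0 : 'rV[R]_0).

Lemma rv_lebesgueS (p : nat) (A : set (measurableTypeR R)) (B : set 'rV[R]_p) :
  measurable A -> measurable B ->
  (rv_lebesgue p.+1 (@rv_uncons p @^-1` (A `*` B)) =
   lebesgue_measure A * rv_lebesgue p B)%E.
Proof.
move=> mA mB; rewrite /= /rv_lebesgue_step /pushforward -comp_preimage.
rewrite (_ : _ \o _ = id) ?preimage_id ?product_measure1E//.
by apply/funext => z /=; rewrite rv_consK.
Qed.
End rv_lebesgue.

Section euclidean.
Context (R : realType) (p : nat).

Definition dotp (x y : 'rV[R]_p) : R := \sum_(i < p) x ord0 i * y ord0 i.

(* The library norm on matrices is the max norm.                              *)
Definition enorm (x : 'rV[R]_p) : R := Num.sqrt (dotp x x).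

Definition unit_rv (i : 'I_p) : 'rV[R]_p := delta_mx ord0 i.

Definition partial (l : seq 'I_p) (g : 'rV[R]_p -> R) : 'rV[R]_p -> R :=
  foldr (fun i u x => 'D_(unit_rv i) u x) g l.

Definition has_partials (s : nat) (g : 'rV[R]_p -> R) (y : 'rV[R]_p) : Prop :=
  forall (l : seq 'I_p) (i : 'I_p), (size l < s)%N ->
    derivable (partial l g) y (unit_rv i).

(* Taylor polynomial of order s of g at y, evaluated at the increment h; the  *)
(* sum over k-tuples of indices divided by k! is the multi-index form.        *)
Definition taylor (g : 'rV[R]_p -> R) (y h : 'rV[R]_p) (s : nat) : R :=
  \sum_(k < s.+1) (k`!)%:R^-1 *
    \sum_(l : k.-tuple 'I_p) partial l g y * \prod_(i <- l) h ord0 i.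

End euclidean.
Arguments unit_rv {R p} i.

Section probability_notions.
Context d (T : measurableType d) (R : realType) (P : probability T R).

Definition pr_support (p : nat) (X : T -> 'rV[R]_p) : set 'rV[R]_p :=
  [set x | forall e : R, 0 < e -> (0 < P (X @^-1` ball x e))%E].

(* g is a version of the regression function x |-> E(Z | X = x).              *)
Definition is_regression (p : nat) (X : T -> 'rV[R]_p) (Z : T -> R)
    (g : 'rV[R]_p -> R) : Prop :=
  [/\ P.-integrable setT (EFin \o Z),
      measurable_fun setT g,
      P.-integrable setT (EFin \o (g \o X)) &
      forall B : set 'rV[R]_p, measurable B ->
        (\int[P]_(w in X @^-1` B) (Z w)%:E =
         \int[P]_(w in X @^-1` B) (g (X w))%:E)%E].

Definition is_density (p : nat) (X : T -> 'rV[R]_p) (f : 'rV[R]_p -> R) : Prop :=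
  [/\ measurable_fun setT f, forall x, 0 <= f x &
      forall B : set 'rV[R]_p, measurable B ->
        (P (X @^-1` B) = \int[rv_lebesgue R p]_(x in B) (f x)%:E)%E].

(* (Y_ j, X_ j), j = 0, 1, ..., are independent copies of (Y, X).  As B j may *)
(* be the whole space, testing the initial segments is enough.                *)
Definition independent_copies (p : nat) (Y : T -> R) (X : T -> 'rV[R]_p)
    (Y_ : nat -> T -> R) (X_ : nat -> T -> 'rV[R]_p) : Prop :=
  (forall j (B : set (R * 'rV[R]_p)), measurable B ->
     P [set w | B (Y_ j w, X_ j w)] = P [set w | B (Y w, X w)]) /\
  (forall n (B : nat -> set (R * 'rV[R]_p)), (forall j, measurable (B j)) ->
     P [set w | forall j, (j < n)%N -> B j (Y_ j w, X_ j w)] =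
     (\prod_(j < n) P [set w | B j (Y_ j w, X_ j w)])%E).

Definition cvg_in_probability (q : nat) (U : nat -> T -> 'rV[R]_q)
    (u : 'rV[R]_q) : Prop :=
  forall e : R, 0 < e -> P [set w | e < enorm (U n w - u)] @[n --> \oo] --> 0%E.

(* For measurable D n this says P (D n > M) --> 1 for every M: then A n can   *)
(* be taken to be {D n > M}.  Measurability of D n is not presupposed.        *)
Definition cvg_in_probability_pinfty (D : nat -> T -> \bar R) : Prop :=
  forall M : R, exists2 A : nat -> set T,
    forall n, measurable (A n) /\ A n `<=` [set w | (M%:E < D n w)%E] &
    P (A n) @[n --> \oo] --> 1%E.

(* E exp(i Z)                                                                 *)
Definition expect_cis (Z : T -> R) : R[i] :=
  (fine 'E_P[fun w => cos (Z w)] +i* fine 'E_P[fun w => sin (Z w)])%C.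

End probability_notions.

Definition cis (R : realType) (a : R) : R[i] := (cos a +i* sin a)%C.

(* Data sets are n-tuples of pairs (response, covariate).                     *)
Section estimators.
Context (R : realType) (p q : nat).
Variables (k : R -> R) (h : nat -> R) (Tr : 'rV[R]_q -> R -> R).

Definition prod_kernel (y : 'rV[R]_p) : R := \prod_(s < p) k (y ord0 s).

Section sample.
Context (n : nat) (z : n.-tuple (R * 'rV[R]_p)).
Let Yv (v : 'I_n) : R := (tnth z v).1.
Let Xv (v : 'I_n) : 'rV[R]_p := (tnth z v).2.

Definition kernel_sum (a : 'I_n -> R) (x : 'rV[R]_p) : R :=
  (n%:R * h n ^+ p)^-1 *
    \sum_(v < n) prod_kernel ((h n)^-1 *: (x - Xv v)) * a v.

(* As k may take negative values, f_hat and s2_hat need not be positive; then *)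
(* 0^-1 = 0 and Num.sqrt is 0 on negative numbers.                            *)
Definition f_hat (x : 'rV[R]_p) : R := kernel_sum (fun=> 1) x.

Definition m_hat (th : 'rV[R]_q) (x : 'rV[R]_p) : R :=
  (f_hat x)^-1 * kernel_sum (fun v => Tr th (Yv v)) x.

Definition s2_hat (th : 'rV[R]_q) (x : 'rV[R]_p) : R :=
  (f_hat x)^-1 * kernel_sum (fun v => (Tr th (Yv v) - m_hat th x) ^+ 2) x.

Definition residual (th : 'rV[R]_q) (j : 'I_n) : R :=
  (Tr th (Yv j) - m_hat th (Xv j)) / Num.sqrt (s2_hat th (Xv j)).

Definition ecf (th : 'rV[R]_q) (t1 : R) (t2 : 'rV[R]_p) : R[i] :=
  n%:R^-1 * \sum_(j < n) cis (dotp t2 (Xv j) + t1 * residual th j).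

Definition test_statistic (W : R -> 'rV[R]_p -> R) (th : 'rV[R]_q) : \bar R :=
  (n%:R%:E * \int[@lebesgue_measure R]_t1 \int[rv_lebesgue R p]_t2
     (Normc.normc (ecf th t1 t2 - ecf th 0 t2 * ecf th t1 0) ^+ 2
        * W t1 t2)%:E)%E.

End sample.
End estimators.

Section assumptions.
Context d (T : measurableType d) (R : realType) (P : probability T R).
Context (p q : nat).

Definition kernel_assumption (k : R -> R) : Prop :=
  [/\ {within `[-1, 1], continuous k},
      (forall u, k (- u) = k u) /\ (forall u, 1 < `|u| -> k u = 0),
      forall r, (r <= p)%N ->
        \int[@lebesgue_measure R]_(u in `[-1, 1]) (u ^+ r * k u) = (r == 0%N)%:R &
      \int[@lebesgue_measure R]_(u in `[-1, 1]) (u ^+ p.+1 * k u) != 0].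

Definition bandwidth_assumption (h : nat -> R) : Prop :=
  (forall n, 0 < h n) /\
  exists2 delta : R, 0 < delta &
    (n%:R * h n ^+ p)^-1 + n%:R * h n `^ (p%:R + delta) @[n --> \oo] --> 0.

(* Expansion with a square-integrable remainder factor.  The base point y     *)
(* ranges over the interior of the support of X, where the derivatives do not *)
(* involve values outside of the support.                                     *)
Definition taylor_expandable (X : T -> 'rV[R]_p) (g : 'rV[R]_p -> R) (s : nat)
    (delta : R) : Prop :=
  exists b : 'rV[R]_p -> R,
    [/\ measurable_fun setT b,
        ('E_P[fun w => (`|b (X w)| ^+ 2)%R] < +oo)%E &
        forall y, (pr_support P X)° y ->
          has_partials s g y /\
          forall x, pr_support P X x ->
            `|g x - taylor g y (x - y) s|
              <= enorm (x - y) `^ (s%:R + delta) * b y].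

Definition density_assumption (X : T -> 'rV[R]_p) (s1 : nat) : Prop :=
  ('E_P[fun w => (enorm (X w) ^+ 2)%R] < +oo)%E /\
  exists f : 'rV[R]_p -> R,
    [/\ is_density P X f,
        (0 < ereal_inf [set (f x)%:E | x in pr_support P X])%E,
        (ereal_sup [set (f x)%:E | x in pr_support P X] < +oo)%E,
        exists2 delta1 : R, 0 < delta1 & taylor_expandable X f s1 delta1 &
        p%:R / 2 <= s1%:R + 1 :> R].

Definition regression_assumption (X : T -> 'rV[R]_p) (m sigma : 'rV[R]_p -> R)
    (s2 s3 : nat) : Prop :=
  [/\ exists2 delta2 : R, 0 < delta2 &
        taylor_expandable X m s2 delta2 /\ taylor_expandable X sigma s3 delta2,
      p%:R / 2 <= s2%:R :> R,
      p%:R / 2 <= s3%:R :> R,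
      ('E_P[fun w => (m (X w) ^+ 2)%R] < +oo)%E &
      ('E_P[fun w => (sigma (X w) ^+ 2)%R] < +oo)%E].

Definition transformation_class (Theta : set 'rV[R]_q)
    (Tr : 'rV[R]_q -> R -> R) : Prop :=
  [/\ forall th, Theta th -> {homo Tr th : x y / x < y},
      open Theta & measurable Theta].

(* dT s is the partial derivative of th |-> Tr th in its s-th coordinate at   *)
(* th0, and dm s that of the regression function th |-> m th.                 *)
Definition differentiability_assumption (Y : T -> R) (X : T -> 'rV[R]_p)
    (Theta : set 'rV[R]_q) (Tr : 'rV[R]_q -> R -> R)
    (m : 'rV[R]_q -> 'rV[R]_p -> R) (th0 : 'rV[R]_q) : Prop :=
  transformation_class Theta Tr /\
  exists (dT : 'I_q -> R -> R) (dm : 'I_q -> 'rV[R]_p -> R) (b : R -> R)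
         (xi delta4 : R),
    [/\ (forall s, measurable_fun setT (dT s)) /\
        (forall s, {ae P, forall w,
           is_derive th0 (unit_rv s) (fun th => Tr th (Y w)) (dT s (Y w))}),
        [/\ 0 < xi, 0 < delta4 & {ae P, forall w, forall th, Theta th ->
           enorm (th - th0) <= xi ->
           `|Tr th (Y w) - Tr th0 (Y w)
             - \sum_(s < q) (th ord0 s - th0 ord0 s) * dT s (Y w)|
             <= b (Y w) * enorm (th - th0) `^ (1 + delta4)}],
        [/\ measurable_fun setT b, ('E_P[fun w => (b (Y w) ^+ 2)%R] < +oo)%E &
           exists g, is_regression P X (fun w => `|b (Y w)|) g],
        forall s, [/\ is_regression P X (fun w => dT s (Y w)) (dm s),
           {ae P, forall w,
             is_derive th0 (unit_rv s) (fun th => m th (X w)) (dm s (X w))} &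
           ('E_P[fun w => (dm s (X w) ^+ 2)%R] < +oo)%E] &
        forall th, Theta th -> ('E_P[fun w => (Tr th (Y w) ^+ 2)%R] < +oo)%E].

Definition weight_assumption (W : R -> 'rV[R]_p -> R) : Prop :=
  exists (w1 : R -> R) (w2 : 'rV[R]_p -> R),
    [/\ forall t1 t2, W t1 t2 = w1 t1 * w2 t2,
        forall t, w1 (- t) = w1 t,
        (@lebesgue_measure R).-integrable setT (fun t : R => (t ^+ 2 * w1 t)%:E) &
        forall t, w2 (- t) = w2 t].

Definition lipschitz_assumption (Y : T -> R) (Theta : set 'rV[R]_q)
    (Tr : 'rV[R]_q -> R -> R) (th0 : 'rV[R]_q) : Prop :=
  transformation_class Theta Tr /\
  exists b : R -> R,
    [/\ measurable_fun setT b, ('E_P[fun w => (`|b (Y w)|)%R] < +oo)%E &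
        {ae P, forall w, forall th, Theta th ->
          `|Tr th (Y w) - Tr th0 (Y w)| <= b (Y w) * enorm (th - th0)}].

End assumptions.

(* Main.v *)
Require Import Defs.
From HB Require Import structures.
From mathcomp Require Import all_boot all_order all_algebra.
From mathcomp Require Import all_classical all_reals all_analysis.
From mathcomp Require Import measurable_realfun.
From mathcomp.real_closed Require Import complex.
From mathcomp Require Import ring lra.
Import Order.TTheory GRing.Theory Num.Theory.
Import numFieldNormedType.Exports.

(** The statistic is [n] times the weighted energy, that is the integral of the
    squared modulus against [W], of the difference [Dn] between the joint
    empirical characteristic function of covariates and residuals and the product
    of the marginal ones.  Its population counterpart [D], formed with the errors
    at [th0], has positive energy by assumption.  It therefore suffices that with
    large probability the energy of [Dn] exceeds a fixed positive number
    ([energy_diverges]).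

    Let [D0n] be built like [Dn] from the unobservable errors at [th0].  Then
    [|D|^2 <= 3 |Dn|^2 + 3 |Dn - D0n|^2 + 3 |D0n - D|^2].  A part of the weight of
    finite mass and with bounded [t1] already detects the energy of [D]
    ([integral_restrict_gt0]), and on this part the last two terms are small.  For
    [D0n - D] this is a law of large numbers: the mean of its square is of order
    [1 / n] at each argument ([gap_mean_sqr]), and Tonelli integrates this bound.
    For [Dn - D0n], the function [exp (i x)] is bounded and Lipschitz, so that the
    difference is at most [4 (1 + |t1|)] times the mean over the sample of
    [min 1 |residual - error|] ([gap_sample_cfB]).  The heart of the proof is that
    this mean tends to zero in probability ([residual_cvg]).

    A residual is a function of the response and of the kernel averages of [1], of
    the transformed responses and of their squares at the covariate ([residualE]).
    This function is locally Lipschitz where the density and the conditional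
    variance are away from zero ([studentized_modulus]), which excludes a small
    fraction of the observations ([good_points_large]).  The kernel averages with
    the parameter [th0] are consistent in mean, uniformly over the observations
    ([kernel_regression_cvg]).  Their bias is dominated by the local oscillation of
    an integrable function, the product of a regression function and the density,
    and tends to zero by continuity of translations in L1
    ([osc_vanishes_integrable]); working in L1 makes the boundary of the support
    harmless.  Their deviation from the conditional means is treated by truncation
    and a variance bound ([kdev_cvg]).  Passing from [th0] to the estimated
    parameter costs the kernel average of the supremum of the deviations of the
    transformations over a neighbourhood of [th0].  As the transformations are
    monotone, this supremum is a measurable function of the response
    ([measurable_family_deviation]), so that what is known for the generic response
    holds for the observations; its moments are small when the neighbourhood is
    ([transformation_envelope]), and so are its kernel averages
    ([expect_kernel_average]). *)

Set Implicit Arguments.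
Unset Strict Implicit.
Unset Printing Implicit Defensive.

Local Open Scope classical_set_scope.
Local Open Scope ring_scope.

(** * Preliminaries *)

Lemma le_of_eq disp (T : porderType disp) (x y : T) : x = y -> (x <= y)%O.
Proof. by move->. Qed.

Section measurable_sets.
Context d (T : measurableType d).

Lemma measurable_preimage d' (T' : measurableType d') (f : T -> T') (B : set T') :
  measurable_fun setT f -> measurable B -> measurable (f @^-1` B).
Proof. by move=> mf mB; rewrite -[X in measurable X]setTI; exact: mf. Qed.

Lemma measurable_true (b : T -> bool) : measurable_fun setT b -> measurable [set t | b t].
Proof. by move=> mb; exact: (measurable_preimage (B := [set true]) mb). Qed.

End measurable_sets.

(** * Boxes and product functions in R^p *)

Section rv_boxes.
Context (R : realType).
Implicit Types (p : nat).

Definition rv_box p (l u : 'I_p -> R) : set 'rV[R]_p :=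
  [set x | forall i, l i <= x ord0 i <= u i].

Lemma measurable_coord_preimage p (i : 'I_p) (B : set R) :
  measurable B -> measurable [set x : 'rV[R]_p | B (x ord0 i)].
Proof.
move=> mB; rewrite -[X in measurable X]setTI.
exact: (@measurable_rv_coord R p i measurableT B mB).
Qed.

Lemma measurable_rv_box p (l u : 'I_p -> R) : measurable (rv_box l u).
Proof.
rewrite (_ : rv_box l u =
    \bigcap_i [set x : 'rV[R]_p | `[l i, u i]%classic (x ord0 i)]); last first.
  apply/seteqP; split=> [x lux i _|x lux i]; first by rewrite /= in_itv/=.
  by have := lux i I; rewrite /= in_itv/=.
apply: fin_bigcap_measurable; first exact: finite_finset.
by move=> i _; apply: measurable_coord_preimage.
Qed.

Lemma rv_lebesgue_box p (l u : 'I_p -> R) : (forall i, l i <= u i) ->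
  rv_lebesgue R p (rv_box l u) = (\prod_i (u i - l i))%:E.
Proof.
elim: p l u => [|p IHp] l u lu.
  rewrite big_ord0 /= diracE (_ : rv_box l u = setT) ?in_setT//.
  by apply/seteqP; split=> // x _ [].
rewrite (_ : rv_box l u = @rv_uncons R p @^-1` (`[l ord0, u ord0]%classic `*`
    rv_box (fun i => l (lift ord0 i)) (fun i => u (lift ord0 i)))); last first.
  apply/seteqP; split=> x.
    move=> lux; split=> /=; first by rewrite in_itv/=; exact: lux.
    by move=> i; rewrite mxE; exact: lux.
  move=> [/=]; rewrite in_itv/= => x0 xS i.
  case: (unliftP ord0 i) => [j|] -> //.
  by have := xS j; rewrite mxE.
rewrite rv_lebesgueS//; last exact: measurable_rv_box.
rewrite lebesgue_measure_itv/= lte_fin IHp; last by move=> i; exact: lu.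
rewrite big_ord_recl EFinM; have [//|ul] := ltP (l ord0) (u ord0).
have -> : u ord0 = l ord0 by apply/le_anti; rewrite ul lu.
by rewrite subrr.
Qed.

Lemma rv_lebesgue_cube p (a : 'rV[R]_p) (r : R) : 0 <= r ->
  rv_lebesgue R p (rv_box (fun i => a ord0 i - r) (fun i => a ord0 i + r))
  = ((2 * r) ^+ p)%:E.
Proof.
move=> r0; rewrite rv_lebesgue_box; last by move=> i; lra.
congr EFin; rewrite (eq_bigr (fun=> 2 * r)); last by move=> i _; lra.
by rewrite prodr_const card_ord.
Qed.

Lemma measurable_prod_coord p (phi : 'I_p -> R -> R) :
  (forall i, measurable_fun setT (phi i)) ->
  measurable_fun setT (fun x : 'rV[R]_p => \prod_i phi i (x ord0 i)).
Proof.
move=> mphi; apply: measurable_prod => i _.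
apply: (measurableT_comp (mphi i)); exact: measurable_rv_coord.
Qed.

(** A product kernel is integrated one coordinate at a time, along the iterated
    product by which the Lebesgue measure of R^p is built. *)
Lemma rv_lebesgue_prod p (phi : 'I_p -> R -> R) :
  (forall i, (@lebesgue_measure R).-integrable setT (EFin \o phi i)) ->
  (rv_lebesgue R p).-integrable setT
    (fun x => (\prod_i phi i (x ord0 i))%:E) /\
  (\int[rv_lebesgue R p]_x (\prod_i phi i (x ord0 i))%:E =
   \prod_i \int[@lebesgue_measure R]_u (phi i u)%:E)%E.
Proof.
have mphi p0 (phi0 : 'I_p0 -> R -> R) :
    (forall i, (@lebesgue_measure R).-integrable setT (EFin \o phi0 i)) ->
    forall i, measurable_fun setT (phi0 i).
  by move=> H i; apply/measurable_EFinP; exact: measurable_int (H i).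
elim: p phi => [|p IHp] phi iphi.
  split.
    apply: (eq_integrable _ (EFin \o cst 1)) => //.
      by move=> x _; rewrite /= big_ord0.
    exact: (finite_measure_integrable_cst (dirac (0 : 'rV[R]_0)) 1).
  rewrite big_ord0 (eq_integral (cst 1%:E)); last by move=> x _; rewrite big_ord0.
  by rewrite integral_cst//= mul1e; apply: diracT.
pose psi (z : measurableTypeR R * 'rV[R]_p) : \bar R :=
  (phi ord0 z.1 * \prod_i phi (lift ord0 i) (z.2 ord0 i))%:E.
have mp := measurable_prod_coord (fun i => mphi _ _ iphi (lift ord0 i)).
have mpsi : measurable_fun setT psi.
  apply/measurable_EFinP/measurable_funM.
    apply: (measurableT_comp (mphi _ _ iphi _)); exact: measurable_fst.
  exact: (measurableT_comp mp measurable_snd).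
have [iT ET] := IHp (fun i => phi (lift ord0 i)) (fun i => iphi _).
have ipsi : (@lebesgue_measure R \x rv_lebesgue R p)%E.-integrable setT psi.
  apply/integrable12ltyP => //.
  under eq_integral.
    move=> x _; under eq_integral do rewrite /psi/= normrM EFinM.
    rewrite ge0_integralZl//; last first.
      exact/measurable_EFinP/measurableT_comp.
    over.
  rewrite /= ge0_integralZr//; last 2 first.
  - by have /integrable_abse/integrableP[] := iphi ord0.
  - by apply: integral_ge0 => ? _; rewrite lee_fin.
  rewrite lte_mul_pinfty//; first exact: integral_ge0.
    rewrite ge0_fin_numE//; last exact: integral_ge0.
    by have /integrableP[] := iphi ord0.
  by have /integrableP[] := iT.
have mPhi : measurable_fun setT (fun x : 'rV[R]_p.+1 => (\prod_i phi i (x ord0 i))%:E).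
  apply/measurable_EFinP; exact: (measurable_prod_coord (mphi _ _ iphi)).
have E : (fun x : 'rV[R]_p.+1 => (\prod_i phi i (x ord0 i))%:E) \o @rv_cons R p = psi.
  apply/funext => z; rewrite /psi /= big_ord_recl/= /rv_cons mxE unlift_none.
  by under eq_bigr do rewrite mxE liftK.
split; first by apply: integrable_pushforward => //=; first exact: measurable_rv_cons; rewrite E.
rewrite /= /rv_lebesgue_step integral_pushforward//=; last 2 first.
  exact: measurable_rv_cons.
  by rewrite E.
rewrite (eq_integral psi); last by move=> z _; rewrite -E.
rewrite -integral12_prod_meas1//= big_ord_recl/= /fubini_F/=.
under eq_integral.
  move=> x _; under eq_integral do rewrite /psi/= EFinM.
  rewrite integralZl//= ET; over.
have /fineK <- : (\prod_(i < p) \int[@lebesgue_measure R]_u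
    (phi (lift ord0 i) u)%:E)%E \is a fin_num.
  by rewrite -ET; exact: integrable_fin_num.
by rewrite /= integralZr//; exact: iphi.
Qed.

End rv_boxes.

(** * Change of measure *)

Section change_of_density.
Local Open Scope ereal_scope.
Context dV (V : measurableType dV) (R : realType).

Import HBNNSimple.

Let nnsfun_integral d (T : measurableType d) (mu : {measure set T -> \bar R})
    (X : T -> V) (g : T -> R) (f : {nnsfun V >-> R}) :
  measurable_fun setT X -> measurable_fun setT g -> (forall x, 0 <= g x)%R ->
  \int[mu]_x ((f (X x))%:E * (g x)%:E) =
  \sum_(k \in range f)
    (k%:E * \int[mu]_(x in X @^-1` (f @^-1` [set k])) (g x)%:E).
Proof.
move=> mX mg g0; pose eg := EFin \o g.
have mA k : measurable (X @^-1` (f @^-1` [set k])).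
  by apply: measurable_preimage => //; exact: mX.
have mpatch k : measurable_fun setT (eg \_ (X @^-1` (f @^-1` [set k]))).
  apply/(measurable_restrictT _ (mA k)); apply/measurable_funTS.
  exact/measurable_EFinP.
have patch0 k x : 0 <= (eg \_ (X @^-1` (f @^-1` [set k]))) x.
  by rewrite patchE; case: ifP => //; rewrite lee_fin.
transitivity (\int[mu]_x (\sum_(k \in range f)
    (k%:E * (eg \_ (X @^-1` (f @^-1` [set k]))) x))).
  apply: eq_integral => x _; rewrite fimfunE -fsumEFin//.
  rewrite !fsbig_finite//= ge0_sume_distrl; last first.
    by move=> k _; rewrite EFinM nnfun_muleindic_ge0.
  apply: eq_bigr => k _; rewrite EFinM -muleA; congr (_ * _).
  rewrite indicE patchE.
  have -> : (x \in X @^-1` (f @^-1` [set k])) = (X x \in f @^-1` [set k]) by [].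
  by case: ifP; rewrite ?mul1e ?mul0e.
rewrite ge0_integral_fsum//; last 2 first.
- by move=> k; exact: measurable_funeM.
- move=> k x _; have [kf|kf] := pselect (range f k).
    by apply: mule_ge0 => //; case: kf => y _ <-; rewrite lee_fin.
  rewrite patchE; case: ifPn => [|_]; last by rewrite mule0.
  by rewrite inE /= => xk; exfalso; apply: kf; exists (X x).
apply: eq_fsbigr => k /[!inE]-[y _ <-].
by rewrite [in RHS]integral_mkcond ge0_integralZl ?lee_fin.
Qed.

(** The measures [B |-> \int_(X @^-1` B) g] do not need to be constructed: two
    of them agree on nonnegative functions as soon as they agree on sets. *)
Lemma eq_integral_density d1 (T1 : measurableType d1) d2 (T2 : measurableType d2)
    (mu1 : {measure set T1 -> \bar R}) (mu2 : {measure set T2 -> \bar R})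
    (X1 : T1 -> V) (X2 : T2 -> V) (g1 : T1 -> R) (g2 : T2 -> R) :
  measurable_fun setT X1 -> measurable_fun setT X2 ->
  measurable_fun setT g1 -> measurable_fun setT g2 ->
  (forall x, 0 <= g1 x)%R -> (forall x, 0 <= g2 x)%R ->
  (forall B, measurable B -> \int[mu1]_(x in X1 @^-1` B) (g1 x)%:E =
                             \int[mu2]_(x in X2 @^-1` B) (g2 x)%:E) ->
  forall phi : V -> \bar R, measurable_fun setT phi -> (forall v, 0 <= phi v) ->
  \int[mu1]_x (phi (X1 x) * (g1 x)%:E) = \int[mu2]_x (phi (X2 x) * (g2 x)%:E).
Proof.
move=> mX1 mX2 mg1 mg2 g10 g20 g12 phi mphi phi0.
pose f_ := nnsfun_approx measurableT mphi.
have lim d (T : measurableType d) (mu : {measure set T -> \bar R})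
    (X : T -> V) (g : T -> R) :
  measurable_fun setT X -> measurable_fun setT g -> (forall x, 0 <= g x)%R ->
  \int[mu]_x (phi (X x) * (g x)%:E) =
  limn (fun n => \int[mu]_x ((f_ n (X x))%:E * (g x)%:E)).
  move=> mX mg g0; rewrite -monotone_convergence//=; last 3 first.
  - move=> n; apply: emeasurable_funM; apply/measurable_EFinP => //.
    exact: (measurableT_comp (measurable_funP (f_ n)) mX).
  - by move=> n x _; apply: mule_ge0 => //; rewrite lee_fin.
  - move=> x _ m n mn; apply: lee_wpmul2r; first by rewrite lee_fin.
    by rewrite lee_fin; exact/lefP/nd_nnsfun_approx.
  apply: eq_integral => x _; apply/esym/cvg_lim => //.
  by apply: cvgeZr => //; exact: cvg_nnsfun_approx.
rewrite !lim//; apply: congr_lim; apply/funext => n.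
rewrite !nnsfun_integral//; apply: eq_fsbigr => k _.
by rewrite g12.
Qed.

End change_of_density.

(** * Support and density of the covariates *)

Section support.
Context d (T : measurableType d) (R : realType) (P : probability T R).
Context (p : nat) (X : T -> 'rV[R]_p) (mX : measurable_fun setT X).

Lemma ball_rowP (x y : 'rV[R]_p) (e : R) : 0 < e ->
  (forall i, `|x ord0 i - y ord0 i| < e) -> ball x e y.
Proof. by move=> e0 xy; split=> // i j; rewrite !ord1; exact: xy. Qed.

Lemma measurable_rv_ball (x : 'rV[R]_p) (e : R) : 0 < e -> measurable (ball x e).
Proof.
move=> e0; rewrite (_ : ball x e = \bigcap_i [set y : 'rV[R]_p |
    ball (x ord0 i) e (y ord0 i)]).
  apply: fin_bigcap_measurable; first exact: finite_finset.
  move=> i _; apply: measurable_coord_preimage; exact: measurable_ball.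
apply/seteqP; split=> [y [_ xy] i _|y xy]; first exact: xy.
by apply: ball_rowP => // i; exact: xy.
Qed.

Let rbox (lu : {ffun 'I_p -> rat} * {ffun 'I_p -> rat}) : set 'rV[R]_p :=
  rv_box (fun i => ratr (lu.1 i)) (fun i => ratr (lu.2 i)).

(** A point outside of the support has a null neighbourhood, which contains a
    null box with rational corners around it; there are countably many of those. *)
Lemma pr_support_full : exists N : set 'rV[R]_p,
  [/\ measurable N, P (X @^-1` N) = 0%E & ~` N `<=` pr_support P X].
Proof.
pose F n := if unpickle n is Some lu then
  if P (X @^-1` rbox lu) == 0%E then rbox lu else set0 else set0.
have mF n : measurable (F n).
  rewrite /F; case: unpickle => // lu; case: ifP => // _.
  exact: measurable_rv_box.
exists (\bigcup_n F n); split.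
- exact: bigcupT_measurable.
- have mXF n : measurable (X @^-1` F n).
    by apply: measurable_preimage => //; exact: mX.
  rewrite preimage_bigcup; apply/negligibleP; first exact: bigcupT_measurable.
  apply: negligible_bigcup => n; apply/negligibleP => //.
  rewrite /F; case: unpickle => [lu|]; last by rewrite preimage_set0 measure0.
  by case: ifP => [/eqP//|_]; rewrite preimage_set0 measure0.
move=> x Nx e e0.
have rl i : exists l : rat, ratr l \in `]x ord0 i - e, x ord0 i[%R.
  by apply: rat_in_itvoo; lra.
have ru i : exists u : rat, ratr u \in `]x ord0 i, x ord0 i + e[%R.
  by apply: rat_in_itvoo; lra.
pose lu := ([ffun i => projT1 (cid (rl i))], [ffun i => projT1 (cid (ru i))]).
have luP i : [/\ x ord0 i - e < ratr (lu.1 i), ratr (lu.1 i) < x ord0 i,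
    x ord0 i < ratr (lu.2 i) & ratr (lu.2 i) < x ord0 i + e].
  rewrite /lu /= !ffunE; case: cid => l; case: cid => u /=.
  by rewrite !in_itv/= => /andP[? ?] /andP[? ?].
have sub : rbox lu `<=` ball x e.
  move=> y yb; apply: ball_rowP => // i; have [? ? ? ?] := luP i.
  by have /andP[? ?] := yb i; rewrite ltr_distl; apply/andP; split; lra.
have xb : rbox lu x.
  by move=> i; have [? ? ? ?] := luP i; apply/andP; split; exact: ltW.
have Pn0 : P (X @^-1` rbox lu) != 0%E.
  apply/negP => P0; apply: Nx; exists (pickle lu) => //.
  by rewrite /F pickleK P0.
have mrb : measurable (X @^-1` rbox lu).
  by rewrite -[X in measurable X]setTI; apply: mX => //; exact: measurable_rv_box.
rewrite lt0e measure_ge0 andbT; apply: contra Pn0 => /eqP P0.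
have sXball : X @^-1` rbox lu `<=` X @^-1` ball x e by move=> w /=; exact: sub.
apply/eqP; apply: (subset_measure0 _ _ sXball P0) => //.
by rewrite -[X in measurable X]setTI; apply: mX => //; exact: measurable_rv_ball.
Qed.

Lemma density_restrict (f : 'rV[R]_p -> R) (N : set 'rV[R]_p) :
  measurable N -> P (X @^-1` N) = 0%E -> is_density P X f ->
  is_density P X (fun x => f x * \1_(~` N) x).
Proof.
move=> mN PN [mf f0 fE]; split=> // [|x|B mB].
- by apply: measurable_funM => //; exact/measurable_indic/measurableC.
- by rewrite mulr_ge0.
- have mXN : measurable (X @^-1` N) by apply: measurable_preimage => //; exact: mX.
  have mXB : measurable (X @^-1` B) by apply: measurable_preimage => //; exact: mX.
  transitivity (P (X @^-1` (B `\` N))).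
    rewrite (_ : X @^-1` (B `\` N) = X @^-1` B `\` X @^-1` N)//.
    rewrite measureD//; last by rewrite -ge0_fin_numE// fin_num_measure.
    rewrite [X in (_ - X)%E](_ : _ = 0%E) ?sube0//.
    by apply: (subset_measure0 _ mXN _ PN) => //; exact: measurableI.
  rewrite fE; last exact: measurableD.
  rewrite setDE integral_mkcondr; apply: eq_integral => x _.
  by rewrite patchE indicE; case: ifP => _; rewrite ?mulr1 ?mulr0.
Qed.

Section density.
Context (f : 'rV[R]_p -> R) (fX : is_density P X f).

Lemma density_expectation (phi : 'rV[R]_p -> \bar R) :
  measurable_fun setT phi -> (forall x, 0 <= phi x)%E ->
  (\int[P]_w phi (X w) = \int[rv_lebesgue R p]_x (phi x * (f x)%:E))%E.
Proof.
move=> mphi phi0; have [mf f0 fE] := fX.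
rewrite -(@eq_integral_density _ _ _ _ _ _ _ P _ X id (cst 1) f)//.
- by apply: eq_integral => w _; rewrite mule1.
- move=> B mB; rewrite -fE// -[RHS]mul1e (integral_cst P _ 1%E)//.
  by apply: measurable_preimage => //; exact: mX.
Qed.

Lemma density_gt0 : P (X @^-1` [set x | f x <= 0]) = 0%E.
Proof.
have [mf f0 fE] := fX.
have mB : measurable [set x | f x <= 0].
  by rewrite -[X in measurable X]setTI; exact: measurable_fun_le.
rewrite fE// integral0_eq// => x /= fx0.
by apply/congr1/le_anti; rewrite fx0 f0.
Qed.

(** Transfers bounds in the Lebesgue sense to the law of the covariates. *)
Lemma density_le_integral (C : R) : (forall x, f x <= C) ->
  forall phi : 'rV[R]_p -> \bar R, measurable_fun setT phi -> (forall x, 0 <= phi x)%E ->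
  (\int[P]_w phi (X w) <= C%:E * \int[rv_lebesgue R p]_x phi x)%E.
Proof.
move=> fC phi mphi phi0; have [mf f0 fE] := fX.
rewrite density_expectation// -ge0_integralZl//; last first.
  by rewrite lee_fin (le_trans (f0 0)).
apply: ge0_le_integral => //.
- by move=> x _; rewrite mule_ge0// lee_fin.
- by apply: emeasurable_funM => //; exact/measurable_EFinP.
- exact: measurable_funeM.
- by move=> x _; rewrite muleC lee_wpmul2r// lee_fin.
Qed.

End density.

(** A density is only determined up to a null set: off the support, where
    nothing bounds it, it is replaced by zero. *)
Lemma bounded_density (f : 'rV[R]_p -> R) : is_density P X f ->
  (ereal_sup [set (f x)%:E | x in pr_support P X] < +oo)%E ->
  compact (pr_support P X) ->
  exists (f0 : 'rV[R]_p -> R) (C M : R), [/\ is_density P X f0, 0 < C, forall x, f0 x <= C, 0 < M &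
    forall x, f0 x != 0 -> forall i, `|x ord0 i| <= M].
Proof.
move=> fX supf /compact_bounded[M0 [_ M0P]].
have [N [mN PN Nsupp]] := pr_support_full.
pose C := Num.max 1 (fine (ereal_sup [set (f x)%:E | x in pr_support P X])).
pose M := `|M0| + 2.
exists (fun x => f x * \1_(~` N) x), C, M; split.
- exact: density_restrict.
- by rewrite lt_max ltr01.
- move=> x; rewrite indicE; case: (boolP (x \in ~` N)) => [|_]; last first.
    by rewrite mulr0 le_max ler01.
  rewrite inE => /Nsupp xs; rewrite mulr1.
  have le1 : ((f x)%:E <= ereal_sup [set (f x)%:E | x in pr_support P X])%E.
    by apply: ereal_sup_ubound; exists x.
  rewrite le_max; apply/orP; right; rewrite -lee_fin fineK//.
  by rewrite fin_numE -ltNye (lt_le_trans _ le1) ?ltNyr// lt_eqF.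
- by rewrite /M ltr_wpDl.
- move=> x; rewrite indicE; case: (boolP (x \in ~` N)) => [|_]; last first.
    by rewrite mulr0 eqxx.
  rewrite inE => /Nsupp xs _ i.
  have normx : `|x| <= `|M0| + 1.
    by apply: (M0P (`|M0| + 1)) => //; have := ler_norm M0; lra.
  have [_ /(_ ord0 i)] : ball (0 : 'rV[R]_p) M x.
    by rewrite mx_norm_ball /ball_/= sub0r normrN; rewrite /M; lra.
  by rewrite /ball/= mxE sub0r normrN => /ltW.
Qed.

End support.

(** * Local oscillation of integrable functions *)

Section simple_approximation.
Import HBSimple.

Lemma integrable_approx_sfun d (T : measurableType d) (R : realType)
    (m : {measure set T -> \bar R}) (g : T -> R) (e : R) :
  m.-integrable setT (EFin \o g) -> 0 < e ->
  exists s : {sfun T >-> R}, (\int[m]_z `|(g z - s z)%:E| <= e%:E)%E.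
Proof.
move=> ig e0; have [s [_ _ scvg]] := approximation_sfun_integrable measurableT ig.
move/fine_cvgP : scvg => [fint /cvgrPdist_le/(_ _ e0)].
move=> /(filterI fint)/filter_ex[n [/= tfin]]; rewrite sub0r normrN => te.
exists (s n); rewrite -(fineK tfin) lee_fin.
by apply: le_trans te; exact: ler_norm.
Qed.

End simple_approximation.

Section local_oscillation.
Context (R : realType) (p : nat).
Implicit Types (r : R) (x z : 'rV[R]_p) (g : 'rV[R]_p -> R) (A : set 'rV[R]_p).
Notation lambda := (rv_lebesgue R p).

Definition near_rel r : set ('rV[R]_p * 'rV[R]_p) :=
  [set xz : 'rV[R]_p * 'rV[R]_p | forall i, `|xz.1 ord0 i - xz.2 ord0 i| <= r].

Lemma measurable_fun_coord1 d (T : measurableType d) (u : T -> 'rV[R]_p) i :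
  measurable_fun setT u -> measurable_fun setT (fun t => u t ord0 i).
Proof. by move=> mu; exact: (measurableT_comp (@measurable_rv_coord R p i) mu). Qed.

Lemma measurable_near r : measurable (near_rel r).
Proof.
rewrite (_ : near_rel r =
    \bigcap_i [set xz : 'rV[R]_p * 'rV[R]_p | `|xz.1 ord0 i - xz.2 ord0 i| <= r]);
  last by apply/seteqP; split=> [xz h i _|xz h i]; exact: h.
apply: fin_bigcap_measurable; first exact: finite_finset.
move=> i _; rewrite -[X in measurable X]setTI; apply: measurable_fun_le => //.
apply: measurableT_comp => //; apply: measurable_funB.
  exact: (measurable_fun_coord1 _ measurable_fst).
exact: (measurable_fun_coord1 _ measurable_snd).
Qed.

Lemma near_sym r x z : \1_(near_rel r) (x, z) = \1_(near_rel r) (z, x) :> R.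
Proof.
rewrite !indicE; congr ((nat_of_bool _)%:R).
by apply/idP/idP; rewrite !inE => h i; rewrite distrC; exact: h.
Qed.

Lemma integral_near r x : 0 <= r ->
  (\int[lambda]_z (\1_(near_rel r) (x, z))%:E = ((2 * r) ^+ p)%:E)%E.
Proof.
move=> r0; rewrite -(rv_lebesgue_cube x)//.
have mb := @measurable_rv_box R p (fun i => x ord0 i - r) (fun i => x ord0 i + r).
rewrite -[X in _ = lambda X]setIT -integral_indic//.
apply: eq_integral => z _.
congr EFin; rewrite !indicE; congr ((nat_of_bool _)%:R).
by apply/idP/idP; rewrite !inE => h i; have := h i; rewrite /= distrC ler_distl.
Qed.

Lemma measurable_indic_near r : measurable_fun setT (\1_(near_rel r) : _ -> R).
Proof. by apply: measurable_indic; exact: measurable_near. Qed.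

Context (f : 'rV[R]_p -> R) (C M : R) (mf : measurable_fun setT f).
Context (f0 : forall x, 0 <= f x) (fC : forall x, f x <= C).
Context (M0 : 0 < M) (fM : forall x, f x != 0 -> forall i, `|x ord0 i| <= M).

Fact osc_key : unit. Proof. exact: tt. Qed.

(** The mean, over covariates with density [f], of the average of [|g z - g x|]
    on the cube of radius [r] around [x], up to the constant [2 ^ p]. *)
Definition osc r g : \bar R := locked_with osc_key (\int[lambda]_x \int[lambda]_z
  (f x * (r ^- p * (`|g z - g x| * \1_(near_rel r) (x, z))))%:E)%E.

Lemma oscE r g : osc r g = (\int[lambda]_x \int[lambda]_z
  (f x * (r ^- p * (`|g z - g x| * \1_(near_rel r) (x, z))))%:E)%E.
Proof. by rewrite /osc locked_withE. Qed.

Lemma measurable_osc r g : measurable_fun setT g ->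
  measurable_fun setT (fun xz : 'rV[R]_p * 'rV[R]_p =>
    (f xz.1 * (r ^- p * (`|g xz.2 - g xz.1| * \1_(near_rel r) xz)))%:E).
Proof.
move=> mg; apply/measurable_EFinP; apply: measurable_funM.
  exact: (measurableT_comp mf measurable_fst).
apply: measurable_funM => //; apply: measurable_funM; last exact: measurable_indic_near.
apply: measurableT_comp => //; apply: measurable_funB.
  exact: (measurableT_comp mg measurable_snd).
exact: (measurableT_comp mg measurable_fst).
Qed.

Lemma le_osc r g g1 g2 (a b : R) : 0 <= r -> 0 <= a -> 0 <= b ->
  measurable_fun setT g -> measurable_fun setT g1 -> measurable_fun setT g2 ->
  (forall x z, `|g z - g x| <= a * `|g1 z - g1 x| + b * `|g2 z - g2 x|) ->
  (osc r g <= a%:E * osc r g1 + b%:E * osc r g2)%E.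
Proof.
move=> r0 a0 b0 mg mg1 mg2 gle.
have F u := fubini_tonelli1 (m1 := lambda) (m2 := lambda) (fun xz =>
    (f xz.1 * (r ^- p * (`|u xz.2 - u xz.1| * \1_(near_rel r) xz)))%:E).
have ge0 (u : 'rV[R]_p -> R) (xz : 'rV[R]_p * 'rV[R]_p) :
    (0 <= (f xz.1 * (r ^- p * (`|u xz.2 - u xz.1| * \1_(near_rel r) xz)))%:E)%E.
  by rewrite lee_fin !mulr_ge0 ?invr_ge0 ?exprn_ge0.
rewrite !oscE -!F//; try exact: measurable_osc.
have m1 := measurable_osc r mg1; have m2 := measurable_osc r mg2.
rewrite -!ge0_integralZl ?lee_fin//.
rewrite -ge0_integralD//; last 4 first.
- by move=> xz _; apply: mule_ge0; [rewrite lee_fin|exact: ge0].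
- exact: measurable_funeM.
- by move=> xz _; apply: mule_ge0; [rewrite lee_fin|exact: ge0].
- exact: measurable_funeM.
apply: ge0_le_integral => //.
- exact: measurable_osc.
- by apply: emeasurable_funD; exact: measurable_funeM.
move=> [x z] _; rewrite -!EFinM -EFinD lee_fin/=.
have := gle x z; have := f0 x.
have : 0 <= r ^- p * \1_(near_rel r) (x, z) by rewrite !mulr_ge0 ?invr_ge0 ?exprn_ge0.
move: (r ^- p) (\1_(near_rel r) (x, z)) (f x) => u v w uv w0 h.
have := ler_wpM2l (mulr_ge0 w0 uv) h; lra.
Qed.

Definition big_box : set 'rV[R]_p := rv_box (fun=> - (M + 1)) (fun=> M + 1).

(** Bounding [|g z - g x|] by [|g z| + |g x|] leaves two terms that are exchanged
    by swapping [x] and [z].  Only an enlargement of the box carrying [f] matters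
    because [z] is within [r <= 1] of [x]. *)
Lemma osc_le_norm r g : 0 < r -> r <= 1 -> measurable_fun setT g ->
  (osc r g <= (2 * C * 2 ^+ p)%:E * \int[lambda]_(x in big_box) `|(g x)%:E|)%E.
Proof.
move=> r0 r1 mg.
have C0 : 0 <= C by exact: le_trans (fC 0).
pose gQ x : R := `|g x| * \1_big_box x.
have mbox : measurable big_box by exact: measurable_rv_box.
have mgQ : measurable_fun setT gQ.
  by apply: measurable_funM; [exact: measurableT_comp|exact: measurable_indic].
have gQ0 x : 0 <= gQ x by rewrite mulr_ge0.
have rp0 : 0 <= r ^- p by rewrite invr_ge0 exprn_ge0// ltW.
pose H1 (xz : 'rV[R]_p * 'rV[R]_p) : \bar R :=
  (gQ xz.1 * (C * (r ^- p * \1_(near_rel r) xz)))%:E.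
pose H2 := H1 \o (fun xz : 'rV[R]_p * 'rV[R]_p => (xz.2, xz.1)).
have mH1 : measurable_fun setT H1.
  apply/measurable_EFinP/measurable_funM.
    exact: (measurableT_comp mgQ measurable_fst).
  by do 2 apply: measurable_funM => //; exact: measurable_indic_near.
have mH2 : measurable_fun setT H2.
  apply: (measurableT_comp mH1).
  by apply/measurable_fun_pairP; split; [exact: measurable_snd|exact: measurable_fst].
have H10 xz : (0 <= H1 xz)%E by rewrite lee_fin !mulr_ge0.
have H20 xz : (0 <= H2 xz)%E by rewrite lee_fin !mulr_ge0.
have intH x : (\int[lambda]_z H1 (x, z) = (C * 2 ^+ p)%:E * (gQ x)%:E)%E.
  transitivity (\int[lambda]_z
     ((gQ x * (C * r ^- p))%:E * (\1_(near_rel r) (x, z))%:E))%E.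
    by apply: eq_integral => z _; rewrite -EFinM /H1/= !mulrA.
  rewrite ge0_integralZl//; last 2 first.
  - apply/measurable_EFinP.
    exact: (measurableT_comp (@measurable_indic_near r) (measurable_pair1 x)).
  - by rewrite lee_fin !mulr_ge0.
  rewrite integral_near ?ltW// -!EFinM; congr EFin.
  rewrite exprMn; have : r ^+ p != 0 by rewrite expf_neq0// gt_eqF.
  by move=> ?; field.
have mH := @measurable_osc r g mg.
have Fg := fubini_tonelli1 (m1 := lambda) (m2 := lambda) (fun xz =>
    (f xz.1 * (r ^- p * (`|g xz.2 - g xz.1| * \1_(near_rel r) xz)))%:E).
rewrite oscE -Fg//; last by move=> xz; rewrite lee_fin !mulr_ge0.
apply: (@le_trans _ _ (\int[lambda \x lambda]_xz (H1 xz + H2 xz))%E).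
  apply: ge0_le_integral => //.
  - by move=> xz _; rewrite lee_fin !mulr_ge0.
  - exact: emeasurable_funD.
  move=> [x z] _; rewrite /H1 /H2 /gQ -EFinD lee_fin/= near_sym.
  have [->|fx0] := eqVneq (f x) 0.
    by rewrite mul0r addr_ge0// !mulr_ge0.
  rewrite /gQ !(indicE _ (near_rel r)).
  case: (boolP ((z, x) \in near_rel r)); last by rewrite !mulr0 addr0.
  rewrite inE => /= nzx.
  have xb : x \in big_box.
    by rewrite inE => i; have := fM fx0 i; rewrite -ler_norml; lra.
  have zb : z \in big_box.
    rewrite inE => i; have := fM fx0 i; have := nzx i; rewrite -ler_norml /=.
    by have := ler_normD (z ord0 i - x ord0 i) (x ord0 i); rewrite subrK; lra.
  rewrite !indicE xb zb !mulr1.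
  have := ler_normB (g z) (g x); have := fC x; have := f0 x.
  move: (r ^- p) rp0 (normr_ge0 (g z)) (normr_ge0 (g x)) (normr_ge0 (g z - g x)).
  move=> u u0 a0 b0 c0 fx fxC abc.
  have h1 := ler_wpM2l (mulr_ge0 C0 u0) abc.
  have h2 := ler_wpM2r (mulr_ge0 u0 c0) fxC; lra.
rewrite ge0_integralD// fubini_tonelli1// fubini_tonelli2// /fubini_F /fubini_G.
rewrite (eq_integral (fun x => (C * 2 ^+ p)%:E * (gQ x)%:E)%E); last first.
  by move=> x _; exact: intH.
rewrite [X in (_ + X)%E](_ : _ = \int[lambda]_x ((C * 2 ^+ p)%:E * (gQ x)%:E))%E;
  last by apply: eq_integral => x _; rewrite -intH.
rewrite ge0_integralZl//; last 3 first.
- exact/measurable_EFinP.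
- by move=> x _; rewrite lee_fin.
- by rewrite lee_fin mulr_ge0.
have -> : (\int[lambda]_x (gQ x)%:E = \int[lambda]_(x in big_box) `|(g x)%:E|)%E.
  rewrite [RHS]integral_mkcond; apply: eq_integral => x _.
  by rewrite patchE /gQ indicE; case: ifP => _; rewrite ?mulr1 ?mulr0.
have I0 : (0 <= \int[lambda]_(x in big_box) `|(g x)%:E|)%E by exact: integral_ge0.
by rewrite -ge0_muleDl ?lee_fin ?mulr_ge0// -EFinD lee_wpmul2r// lee_fin; lra.
Qed.

Context (h : nat -> R) (h_gt0 : forall n, 0 < h n) (hcvg : h n @[n --> \oo] --> 0).

Definition osc_vanishes g :=
  forall e : R, 0 < e -> \forall n \near \oo, (osc (h n) g <= e%:E)%E.

Lemma osc_vanishesD (a b : R) g g1 g2 : 0 <= a -> 0 <= b ->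
  measurable_fun setT g -> measurable_fun setT g1 -> measurable_fun setT g2 ->
  (forall x z, `|g z - g x| <= a * `|g1 z - g1 x| + b * `|g2 z - g2 x|) ->
  osc_vanishes g1 -> osc_vanishes g2 -> osc_vanishes g.
Proof.
move=> a0 b0 mg mg1 mg2 gle v1 v2 e e0.
have [e' e'0 e'le] : exists2 e', 0 < e' & a * e' + b * e' <= e.
  exists (e / (a + b + 1)); first by rewrite divr_gt0// ltr_wpDl// addr_ge0.
  by rewrite -mulrDl mulrCA -[leRHS]mulr1 ler_pM2l// ler_pdivrMr ?mul1r; lra.
apply: filterS2 (v1 _ e'0) (v2 _ e'0) => n le1 le2.
apply: (le_trans (@le_osc (h n) _ _ _ _ _ _ a0 b0 mg mg1 mg2 gle)).
  exact: ltW.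
have ae : (0 <= a%:E)%E by rewrite lee_fin.
have be : (0 <= b%:E)%E by rewrite lee_fin.
apply: (le_trans (leeD (lee_wpmul2l ae le1) (lee_wpmul2l be le2))).
by rewrite -!EFinM -EFinD lee_fin.
Qed.

Lemma osc_vanishes0 (c : R) : osc_vanishes (cst c).
Proof.
move=> e e0; near=> n; apply: (@le_trans _ _ 0%E); last by rewrite lee_fin ltW.
rewrite oscE integral0_eq// => x _; rewrite integral0_eq// => z _.
by rewrite subrr normr0 mul0r !mulr0.
Unshelve. all: by end_near. Qed.

Lemma bandwidth_le (e : R) : 0 < e -> \forall n \near \oo, h n <= e.
Proof.
move=> e0; have := hcvg => /cvgrPdist_le/(_ _ e0); apply: filterS => n.
by rewrite sub0r normrN; apply: le_trans; exact: ler_norm.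
Qed.

(** By [osc_le_norm] the oscillation is continuous in [g] for the L1 distance,
    uniformly in the scale. *)
Lemma osc_vanishes_approx g : measurable_fun setT g ->
  (forall e : R, 0 < e -> exists g', [/\ measurable_fun setT g', osc_vanishes g' &
    (\int[lambda]_(x in big_box) `|(g x - g' x)%:E| <= e%:E)%E]) ->
  osc_vanishes g.
Proof.
move=> mg ag e e0; pose K := 2 * C * 2 ^+ p.
have K0 : 0 <= K by rewrite !mulr_ge0// (le_trans (f0 0)).
have [e1 e10 e1le] : exists2 e1, 0 < e1 & K * e1 <= e / 2.
  exists (e / 2 / (K + 1)); first by rewrite !divr_gt0// ltr_wpDl.
  rewrite mulrCA -[leRHS]mulr1 ler_pM2l ?divr_gt0// ler_pdivrMr ?mul1r; lra.
have [g' [mg' vg' gg']] := ag _ e10.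
pose gg x := g x - g' x.
have mgg : measurable_fun setT gg by exact: measurable_funB.
have e2 : 0 < e / 2 by rewrite divr_gt0.
apply: filterS2 (vg' _ e2) (bandwidth_le ltr01) => n le1 hn1.
apply: (@le_trans _ _ (1%:E * osc (h n) gg + 1%:E * osc (h n) g')%E).
  apply: le_osc => //; first exact: ltW.
  move=> x z; rewrite !mul1r.
  rewrite (_ : g z - g x = (gg z - gg x) + (g' z - g' x)).
    exact: ler_normD.
  by rewrite /gg; ring.
have Ke : (0 <= K%:E)%E by rewrite lee_fin.
have le2 := le_trans (osc_le_norm (h_gt0 n) hn1 mgg) (lee_wpmul2l Ke gg').
have le12 := leeD le2 le1; rewrite !mul1e; apply: (le_trans le12).
by rewrite -!EFinM -EFinD lee_fin; lra.
Qed.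

Lemma osc_vanishes_setC A : measurable A ->
  osc_vanishes \1_A -> osc_vanishes \1_(~` A).
Proof.
move=> mA vA; have mAC : measurable (~` A) by exact: measurableC.
apply: (@osc_vanishesD 1 0 _ \1_A \1_A) => //; try exact: measurable_indic.
by move=> x z; rewrite !indicE !in_setC; do 2 case: (_ \in _);
  rewrite /= ?subr0 ?sub0r ?subrr ?normrN ?normr0 ?mul0r ?addr0 ?mul1r ?normr1.
Qed.

Lemma osc_vanishes_setU A B : measurable A -> measurable B ->
  osc_vanishes \1_A -> osc_vanishes \1_B -> osc_vanishes \1_(A `|` B).
Proof.
move=> mA mB vA vB; have mAB : measurable (A `|` B) by exact: measurableU.
apply: (@osc_vanishesD 1 1 _ \1_A \1_B) => //; try exact: measurable_indic.
by move=> x z; rewrite !indicE !in_setU; do 4 case: (_ \in _);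
  rewrite /= ?subr0 ?sub0r ?subrr ?normrN ?normr0 ?mul1r ?normr1; lra.
Qed.

(** Finite unions exhaust a countable one in L1, as the box has finite volume. *)
Lemma osc_vanishes_bigcup (F : (set 'rV[R]_p)^nat) : (forall i, measurable (F i)) ->
  (forall i, osc_vanishes \1_(F i)) -> osc_vanishes \1_(\bigcup_i F i).
Proof.
move=> mF vF; have mU : measurable (\bigcup_i F i) by exact: bigcupT_measurable.
pose G n := \big[setU/set0]_(i < n) F i.
have mG n : measurable (G n) by exact: bigsetU_measurable.
have vG n : osc_vanishes \1_(G n).
  elim: n => [|n IHn]; first by rewrite /G big_ord0 indic0; exact: osc_vanishes0.
  have -> : G n.+1 = G n `|` F n by rewrite /G big_ord_recr.
  exact: (osc_vanishes_setU (mG n) (mF n) IHn (vF n)).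
apply: osc_vanishes_approx; first exact: measurable_indic.
move=> e e0.
pose tail n := big_box `&` ((\bigcup_i F i) `\` G n).
have mbox : measurable big_box by exact: measurable_rv_box.
have mtail n : measurable (tail n) by apply: measurableI => //; exact: measurableD.
have tail0 : \bigcap_n tail n = set0.
  rewrite -subset0 => x xt; have [_ [[i _ Fi] _]] := xt 0%N I.
  have [_ [_]] := xt i.+1 I; apply.
  by rewrite /G -bigcup_mkord; exists i => //=.
have nitail : nonincreasing_seq tail.
  move=> m n mn; apply/subsetPset => x [xb [xU xG]]; split=> //; split=> // xGm.
  apply: xG; move: xGm; rewrite /G -!bigcup_mkord => -[i/= im Fi].
  by exists i => //=; exact: leq_trans mn.
have lbox : (lambda big_box < +oo)%E.
  rewrite /big_box rv_lebesgue_box ?ltry// => i.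
  by have := M0 => M1; lra.
have tcvg : lambda (tail n) @[n --> \oo] --> 0%E.
  rewrite -(measure0 lambda) -tail0; apply: nonincreasing_cvg_mu => //.
    by apply: le_lt_trans lbox; apply: le_measure; rewrite ?inE//; exact: subIsetl.
  by rewrite tail0.
have [n [_ tn]] : exists n, (0 <= lambda (tail n) /\ lambda (tail n) <= e%:E)%E.
  move/fine_cvgP : tcvg => [fint /cvgrPdist_le/(_ _ e0)].
  move=> /(filterI fint)/filter_ex[n [/= tfin]]; rewrite sub0r normrN => te.
  exists n; split=> //; rewrite -(fineK tfin) lee_fin.
  by apply: le_trans te; exact: ler_norm.
exists \1_(G n); split=> //.
apply: le_trans tn; rewrite /tail setIC -integral_indic//; last exact: measurableD.
apply: ge0_le_integral => //.
- apply/measurable_funTS/measurableT_comp => //; apply/measurable_EFinP.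
  by apply: measurable_funB; exact: measurable_indic.
- apply/measurable_funTS/measurable_EFinP/measurable_indic; exact: measurableD.
move=> x _; rewrite lee_fin !indicE in_setD.
have : x \in G n -> x \in \bigcup_i F i.
  by rewrite !inE /G -bigcup_mkord => -[i _ Fi]; exists i.
by do 2 case: (_ \in _) => //=; rewrite ?subrr ?subr0 ?normr0 ?normr1//; case/(_ isT).
Qed.

(** The indicator of a half-space oscillates only in a slab around its boundary,
    of width proportional to the scale; inside the box the slab has a volume of
    the same order. *)
Lemma osc_vanishes_gt (i : 'I_p) (a : R) :
  osc_vanishes \1_[set x : 'rV[R]_p | a < x ord0 i].
Proof.
move=> e e0; pose A := [set x : 'rV[R]_p | a < x ord0 i].
have mA : measurable A.
  rewrite (_ : A = [set x | `]a, +oo[%classic (x ord0 i)]).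
    exact: measurable_coord_preimage.
  by apply/seteqP; split=> x; rewrite /A/= in_itv/= andbT.
have C0 : 0 <= C by exact: le_trans (fC 0).
pose L : R := C * 2 ^+ p * \prod_(j < p | j != i) (2 * M).
have L0 : 0 <= L by rewrite !mulr_ge0// prodr_ge0// => j _; rewrite mulr_ge0// ltW.
have [e1 e10 e1le] : exists2 e1, 0 < e1 & L * (2 * e1) <= e.
  exists (e / 2 / (L + 1)); first by rewrite !divr_gt0// ltr_wpDl.
  rewrite [2 * _]mulrCA mulrCA [2 * _]mulrA.
  rewrite (_ : L * _ = e * (L / (L + 1))); last by field; rewrite gt_eqF// ltr_wpDl.
  by rewrite -[leRHS]mulr1 ler_pM2l// ler_pdivrMr ?mul1r; lra.
apply: filterS (bandwidth_le e10) => n hn.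
have rp0 : 0 <= h n ^- p by rewrite invr_ge0 exprn_ge0// ltW.
pose B := rv_box (fun j => if j == i then a - h n else - M)
                 (fun j => if j == i then a + h n else M).
have mB : measurable B by exact: measurable_rv_box.
have lB : (\int[lambda]_x (\1_B x)%:E = (2 * h n * \prod_(j < p | j != i) (2 * M))%:E)%E.
  rewrite integral_indic// setIT; apply: (etrans (rv_lebesgue_box _)).
    by move=> j; case: ifP => _; have := h_gt0 n; have := M0; lra.
  rewrite (bigD1 i)//= eqxx; congr (_ * _)%:E; first by lra.
  by apply: eq_bigr => j /negbTE ->; lra.
have slab x z : f x * (h n ^- p * (`|\1_A z - \1_A x| * \1_(near_rel (h n)) (x, z)))
    <= C * h n ^- p * \1_B x * \1_(near_rel (h n)) (x, z).
  have [->|fx0] := eqVneq (f x) 0; first by rewrite mul0r !mulr_ge0.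
  rewrite !(indicE _ (near_rel _)).
  case: (boolP ((x, z) \in near_rel _)); last by rewrite !mulr0.
  rewrite inE => /= nxz; rewrite !mulr1.
  case: (boolP (x \in B)) => xB.
    rewrite [\1_B x]indicE xB mulr1.
    have : `|\1_A z - \1_A x| <= 1 :> R.
      by rewrite !indicE; do 2 case: (_ \in A);
        rewrite /= ?subr0 ?sub0r ?subrr ?normrN ?normr0 ?normr1.
    have := f0 x; have := fC x; move: rp0 (normr_ge0 (\1_A z - \1_A x : R)).
    move: (_ ^- _) `|_| => u v u0 v0 fx fx' v1.
    have h1 := ler_wpM2r (mulr_ge0 u0 v0) fx; have := ler_wpM2l (mulr_ge0 C0 u0) v1.
    by lra.
  suff -> : \1_A z = \1_A x :> R by rewrite subrr normr0 !mulr0 !mulr_ge0.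
  rewrite !indicE; congr ((nat_of_bool _)%:R).
  have xB' : ~ (a - h n <= x ord0 i <= a + h n).
    move=> xa; move/negP: xB; apply; rewrite inE => j; case: ifP => [/eqP->//|_].
    by have := fM fx0 j; rewrite -ler_norml.
  have := nxz i; rewrite ler_norml => zx.
  apply/idP/idP; rewrite !inE /A /= => ax; rewrite ltNge; apply/negP => xa;
    apply: xB'; apply/andP; split; lra.
apply: (@le_trans _ _ (L * (2 * h n))%:E); last first.
  by rewrite lee_fin (le_trans _ e1le)// ler_wpM2l//; lra.
rewrite oscE; apply: (@le_trans _ _ (\int[lambda]_x ((C * 2 ^+ p)%:E * (\1_B x)%:E))%E).
  apply: ge0_le_integral => //.
  - move=> x _; apply: integral_ge0 => z _; rewrite lee_fin !mulr_ge0//.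
  - apply: (@measurable_fun_fubini_tonelli_F _ _ _ _ _ lambda (fun xz =>
    (f xz.1 * (h n ^- p * (`|\1_A xz.2 - \1_A xz.1| * \1_(near_rel (h n)) xz)))%:E)).
      by apply: measurable_osc; exact: measurable_indic.
    by move=> xz; rewrite lee_fin !mulr_ge0.
  - by apply: measurable_funeM; apply/measurable_EFinP; exact: measurable_indic.
  move=> x _; apply: (@le_trans _ _ (\int[lambda]_z
     ((C * h n ^- p * \1_B x)%:E * (\1_(near_rel (h n)) (x, z))%:E))%E).
    apply: ge0_le_integral => //.
    - by move=> z _; rewrite lee_fin !mulr_ge0.
    - apply: (measurableT_comp (measurable_osc (h n) _) (measurable_pair1 x)).
      exact: measurable_indic.
    - apply: measurable_funeM; apply/measurable_EFinP.
      exact: (measurableT_comp (@measurable_indic_near _) (measurable_pair1 x)).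
    - by move=> z _; rewrite -EFinM lee_fin.
  rewrite ge0_integralZl//; last 2 first.
  - apply/measurable_EFinP.
    exact: (measurableT_comp (@measurable_indic_near _) (measurable_pair1 x)).
  - by rewrite lee_fin !mulr_ge0.
  rewrite integral_near; last exact: ltW.
  rewrite -EFinM -EFinM lee_fin exprMn; apply: le_of_eq.
  have : h n ^+ p != 0 by rewrite expf_neq0// gt_eqF.
  by move=> ?; field.
rewrite ge0_integralZl//; last 2 first.
- by apply/measurable_EFinP; exact: measurable_indic.
- by rewrite lee_fin mulr_ge0.
rewrite lB -EFinM lee_fin /L le_eqVlt; apply/orP; left.
by apply/eqP; ring.
Qed.

(** Sets with vanishing oscillation form a sigma-algebra that contains the
    coordinate half-spaces, hence every measurable set. *)
Lemma osc_vanishes_indic A : measurable A -> osc_vanishes \1_A.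
Proof.
pose S : set (set 'rV[R]_p) := [set A | measurable A /\ osc_vanishes \1_A].
have S0 : S set0 by split=> //; rewrite indic0; exact: osc_vanishes0.
have SC B : S B -> S (~` B).
  by move=> [mB vB]; split; [exact: measurableC|exact: (osc_vanishes_setC mB vB)].
have SU (F : (set 'rV[R]_p)^nat) : (forall i, S (F i)) -> S (\bigcup_i F i).
  move=> SF; have mF i : measurable (F i) by have [] := SF i.
  split; first exact: bigcupT_measurable.
  by apply: (osc_vanishes_bigcup mF) => i; have [] := SF i.
have Scoord i : (@ocitv R).-sigma.-measurable `<=`
    [set B : set R | S [set x : 'rV[R]_p | B (x ord0 i)]].
  rewrite RGenOInfty.measurableE; apply: smallest_sub.
    split=> [|B SB|F SF] /=; first exact: S0.
      have := SC _ SB; congr (S _); apply/seteqP; split=> [x nB|x [_ nB]] //.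
    exact: (SU (fun k => [set x : 'rV[R]_p | F k (x ord0 i)]) SF).
  move=> B [a ->] /=; split.
    exact: (measurable_coord_preimage i (measurable_itv `]a, +oo[)).
  rewrite (_ : [set x | _] = [set x : 'rV[R]_p | a < x ord0 i]).
    exact: osc_vanishes_gt.
  by apply/seteqP; split=> x /=; rewrite in_itv/= andbT.
have SE : g_sigma_preimage (@rv_coord R p) `<=` S.
  apply: smallest_sub.
    by split; [exact: S0|move=> B SB; rewrite setTD; exact: (SC _ SB)|exact: SU].
  apply: (big_ind (fun Z : set (set 'rV[R]_p) => Z `<=` S)).
  - exact: sub0set.
  - by move=> Z1 Z2 S1 S2 B [B1|B2]; [exact: (S1 _ B1)|exact: (S2 _ B2)].
  - by move=> i _ _ [B mB <-]; rewrite setTI; exact: (Scoord i B mB).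
by move=> mA; have [] := SE A mA.
Qed.

Lemma osc_vanishesZ (c : R) g : measurable_fun setT g ->
  osc_vanishes g -> osc_vanishes (fun x => c * g x).
Proof.
move=> mg vg; apply: (@osc_vanishesD `|c| 0 _ g g) => //.
  by apply: measurable_funM.
by move=> x z; rewrite -mulrBr normrM mul0r addr0.
Qed.

Import HBSimple.

Lemma osc_vanishes_sfun (s : {sfun 'rV[R]_p >-> R}) : osc_vanishes s.
Proof.
have -> : (s : _ -> R) = (fun x => \sum_(k \in range s) k * \1_(s @^-1` [set k]) x).
  by apply/funext => x; exact: fimfunE.
have mA k : measurable (s @^-1` [set k]) by exact: measurable_sfunP.
pose Q g := measurable_fun setT g /\ osc_vanishes g.
suff [] : Q (fun x => \sum_(k \in range s) k * \1_(s @^-1` [set k]) x) by [].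
rewrite (_ : (fun x => _) = (fun x => \sum_(k <- finmap.enum_fset (fset_set (range s)))
    k * \1_(s @^-1` [set k]) x)); last first.
  by apply/funext => x; rewrite fsbig_finite.
elim: (finmap.enum_fset _) => [|k r [mIH vIH]].
  rewrite (_ : (fun x => _) = cst 0); last by apply/funext => x; rewrite big_nil.
  by split=> //; exact: osc_vanishes0.
rewrite (_ : (fun x => _) = (fun x => k * \1_(s @^-1` [set k]) x +
    \sum_(j <- r) j * \1_(s @^-1` [set j]) x)); last first.
  by apply/funext => x; rewrite big_cons.
have mk : measurable_fun setT (fun x => k * \1_(s @^-1` [set k]) x).
  by apply: measurable_funM => //; exact: measurable_indic.
split; first exact: measurable_funD.
have vk : osc_vanishes (fun x => k * \1_(s @^-1` [set k]) x).
  by apply: osc_vanishesZ; [exact: measurable_indic|exact: osc_vanishes_indic].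
apply: (osc_vanishesD ler01 ler01 (measurable_funD mk mIH) mk mIH _ vk vIH).
by move=> x z; rewrite !mul1r opprD addrACA; exact: ler_normD.
Qed.

(** The continuity of translations in L1, in the form that controls the bias of
    kernel averages. *)
Lemma osc_vanishes_integrable g : lambda.-integrable setT (EFin \o g) ->
  osc_vanishes g.
Proof.
move=> ig; have mbox : measurable big_box by exact: measurable_rv_box.
have mg : measurable_fun setT g by apply/measurable_EFinP; exact: measurable_int ig.
apply: osc_vanishes_approx => // e e0; have [s sn] := integrable_approx_sfun ig e0.
exists s; split; [by []|exact: osc_vanishes_sfun|].
apply: le_trans sn; apply: ge0_subset_integral => //.
apply: measurableT_comp => //; apply/measurable_EFinP.
exact: measurable_funB.
Qed.

End local_oscillation.

(** * Kernels at a given scale *)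

Section kernel_scaling.
Context (R : realType).
Notation mu := (@lebesgue_measure R).

Lemma integral_rescaled (k : R -> R) (a r : R) : 0 < r ->
  {within `[-1, 1], continuous k} -> (forall u, 1 < `|u| -> k u = 0) ->
  (\int[mu]_u (r^-1 * k (r^-1 * (a - u)))%:E =
   \int[mu]_(u in `[(-1)%R, 1%R]) (k u)%:E)%E.
Proof.
move=> r0 kc k0.
pose F (u : R) := r^-1 * (a - u).
have Fa : F (a - r) = 1 by rewrite /F; field; exact: lt0r_neq0.
have Fb : F (a + r) = -1 by rewrite /F; field; exact: lt0r_neq0.
have dF (u : R) : is_derive u 1 F (- r^-1).
  by rewrite /F; apply: is_derive_eq; rewrite /GRing.scale/=; ring.
have F'E : derive1 F = cst (- r^-1).
  by apply/funext => u; rewrite derive1E; exact: derive_val.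
have ab : a - r <= a + r by lra.
have decF : {in `[a - r, a + r] &, {homo F : x y /~ (x < y)%R}}.
  by move=> x y _ _ xy; rewrite /F ltr_pM2l ?invr_gt0//; lra.
have cF : continuous F.
  by move=> u; apply: differentiable_continuous; apply/derivable1_diffP; have := dF u.
have := integration_by_substitution_decreasing (G := k) ab decF.
rewrite F'E Fa Fb => ->//.
- rewrite [RHS]integral_mkcond; apply: eq_integral => u _.
  rewrite patchE /= opprK mulrC; case: ifPn => //.
  rewrite notin_setE/= in_itv/= => /negP uab; rewrite k0 ?mul0r//.
  rewrite ltNge; apply: contra uab; rewrite /F normrM gtr0_norm ?invr_gt0//.
  rewrite mulrC ler_pdivrMr// mul1r ler_norml => /andP[? ?].
  by apply/andP; split; lra.
- by move=> u _; exact: cvg_cst.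
- exact: is_cvg_cst.
- exact: is_cvg_cst.
- split => [u _| |]; first by have := dF u.
    by apply: cvg_at_right_filter; exact: cF.
  by apply: cvg_at_left_filter; exact: cF.
Qed.

End kernel_scaling.

Lemma measurable_fun_integral_pair d1 d2 (T1 : measurableType d1)
    (T2 : measurableType d2) (R : realType)
    (m2 : {sigma_finite_measure set T2 -> \bar R}) (F : T1 * T2 -> \bar R) :
  measurable_fun setT F ->
  measurable_fun setT (fun x => \int[m2]_y F (x, y))%E.
Proof.
move=> mF.
rewrite (_ : (fun x => _) = ((fun x => \int[m2]_y (F^\+ (x, y))) \-
    (fun x => \int[m2]_y (F^\- (x, y))))%E); last first.
  apply/funext => x; rewrite [LHS]integralE; congr (_ - _)%E;
    by apply: eq_integral => y _; rewrite ?funeposE ?funenegE.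
apply: emeasurable_funB.
  apply: (measurable_fun_fubini_tonelli_F (F^\+)%E) => //.
  exact: measurable_funepos.
apply: (measurable_fun_fubini_tonelli_F (F^\-)%E) => //.
exact: measurable_funeneg.
Qed.

Section scaled_kernel.
Context (R : realType) (p : nat) (k : R -> R) (b : R).
Notation lambda := (rv_lebesgue R p).
Notation mu := (@lebesgue_measure R).

Definition scaled_kernel (r : R) (x z : 'rV[R]_p) : R :=
  r ^- p * prod_kernel k (r^-1 *: (x - z)).

Hypothesis kc : {within `[-1, 1], continuous k}.
Hypothesis k0 : forall u, 1 < `|u| -> k u = 0.
Hypothesis kb : forall u, `|k u| <= b.
Hypothesis k1 : (\int[mu]_(u in `[(-1)%R, 1%R]) (k u)%:E = 1)%E.

Lemma kernel_measurable : measurable_fun setT k.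
Proof.
rewrite (_ : k = k \_ `[-1, 1]); last first.
  apply/funext => u; rewrite patchE; case: ifPn => //.
  rewrite notin_setE/= in_itv/= => /negP u1; apply: k0; rewrite ltNge.
  by apply: contra u1; rewrite ler_norml.
apply/(measurable_restrictT _ (measurable_itv _)).
by apply: subspace_continuous_measurable_fun => //; exact: measurable_itv.
Qed.

Let b_ge0 : 0 <= b. Proof. exact: le_trans (kb 0). Qed.

Let coordE (r : R) (x z : 'rV[R]_p) (i : 'I_p) :
  (r^-1 *: (x - z)) ord0 i = r^-1 * (x ord0 i - z ord0 i).
Proof. by rewrite !mxE. Qed.

Lemma scaled_kernelE r x z :
  scaled_kernel r x z = \prod_i (r^-1 * k (r^-1 * (x ord0 i - z ord0 i))).
Proof.
rewrite /scaled_kernel /prod_kernel big_split/= prodr_const card_ord exprVn.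
by congr (_ * _); apply: eq_bigr => i _; rewrite coordE.
Qed.

Lemma measurable_scaled_kernel r :
  measurable_fun setT (fun xz : 'rV[R]_p * 'rV[R]_p => scaled_kernel r xz.1 xz.2).
Proof.
under eq_fun do rewrite scaled_kernelE.
apply: measurable_prod => i _; apply: measurable_funM => //.
apply: (measurableT_comp kernel_measurable); apply: measurable_funM => //.
apply: measurable_funB; apply: (measurableT_comp (@measurable_rv_coord R p i)).
  exact: measurable_fst.
exact: measurable_snd.
Qed.

Lemma scaled_kernel_le r x z : 0 < r ->
  `|scaled_kernel r x z| <= b ^+ p * (r ^- p * \1_(near_rel r) (x, z)).
Proof.
move=> r0; rewrite indicE; case: (boolP (_ \in _)) => xz.
  have rp0 : 0 <= r ^- p by rewrite invr_ge0 exprn_ge0// ltW.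
  rewrite mulr1 normrM (ger0_norm rp0) mulrC ler_wpM2r// /prod_kernel normr_prod.
  rewrite -[X in _ ^+ X]card_ord -prodr_const; apply: ler_prod => i _.
  by rewrite normr_ge0 kb.
have [i xzi] : exists i, r < `|x ord0 i - z ord0 i|.
  apply/not_existsP => xzr; move/negP: xz; apply; rewrite inE => i /=.
  by rewrite leNgt; apply/negP.
rewrite scaled_kernelE (bigD1 i)//= k0 ?mulr0 ?mul0r ?normr0//.
by rewrite normrM gtr0_norm ?invr_gt0// mulrC ltr_pdivlMr// mul1r.
Qed.

Lemma integral_scaled_kernel r x : 0 < r ->
  lambda.-integrable setT (fun z => (scaled_kernel r x z)%:E) /\
  (\int[lambda]_z (scaled_kernel r x z)%:E = 1)%E.
Proof.
move=> r0; pose phi i (u : R) := r^-1 * k (r^-1 * (x ord0 i - u)).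
have mphi i : measurable_fun setT (phi i).
  apply: measurable_funM => //; apply: (measurableT_comp kernel_measurable).
  by apply: measurable_funM => //; exact: measurable_funB.
have emphi i : measurable_fun (setT : set (measurableTypeR R)) (EFin \o phi i).
  by have /measurable_EFinP := mphi i.
have E i : (\int[mu]_u (phi i u)%:E = 1)%E by rewrite integral_rescaled.
have iphi i : mu.-integrable setT (EFin \o phi i).
  apply/integrableP; split => //.
  pose J := `[x ord0 i - r, x ord0 i + r].
  apply: (@le_lt_trans _ _ (\int[mu]_(u in [set` J]) (r^-1 * b)%:E)%E).
    rewrite [leRHS]integral_mkcond; apply: ge0_le_integral => //.
    - exact: (measurableT_comp _ (emphi i)).
    - by apply/(measurable_restrictT _ (measurable_itv _)); exact: measurable_cst.
    move=> u _; rewrite patchE; case: ifPn => [_|].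
      rewrite lee_fin normrM gtr0_norm ?invr_gt0//.
      by rewrite ler_wpM2l// invr_ge0 ltW.
    rewrite notin_setE/= in_itv/= => /negP uab.
    rewrite /phi k0 ?mulr0 ?normr0//.
    rewrite ltNge; apply: contra uab; rewrite normrM gtr0_norm ?invr_gt0//.
    rewrite mulrC ler_pdivrMr// mul1r ler_norml => /andP[? ?].
    by apply/andP; split; lra.
  have Joo : (mu [set` J] < +oo)%E.
    by rewrite lebesgue_measure_itv/=; case: ifP => _; rewrite -?EFinB ltry.
  rewrite (integral_cst mu (measurable_itv J) (r^-1 * b)%:E).
  by apply: lte_mul_pinfty => //; rewrite lee_fin mulr_ge0// invr_ge0 ltW.
have [] := rv_lebesgue_prod iphi.
have -> : (fun z : 'rV[R]_p => (\prod_i phi i (z ord0 i))%:E) =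
          (fun z => (scaled_kernel r x z)%:E).
  by apply/funext => z; rewrite scaled_kernelE.
by move=> ? ->; split=> //; apply: big1 => i _; exact: E.
Qed.

Context (f : 'rV[R]_p -> R) (mf : measurable_fun setT f) (f0 : forall x, 0 <= f x).

Lemma integrable_kernelM r x (g : 'rV[R]_p -> R) : 0 < r ->
  lambda.-integrable setT (EFin \o g) ->
  lambda.-integrable setT (fun z => (scaled_kernel r x z * g z)%:E).
Proof.
move=> r0 ig; have rp0 : 0 <= r ^- p by rewrite invr_ge0 exprn_ge0// ltW.
have bp0 : 0 <= b ^+ p * r ^- p by rewrite mulr_ge0// exprn_ge0.
apply: (@le_integrable _ _ _ _ _ measurableT _ (fun z => (b ^+ p * r ^- p)%:E * `|(g z)%:E|)%E).
- apply/measurable_EFinP/measurable_funM.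
    exact: (measurableT_comp (measurable_scaled_kernel r) (measurable_pair1 x)).
  by apply/measurable_EFinP; exact: measurable_int ig.
- move=> z _; rewrite /= lee_fin normrM [leRHS]normrM normr_id (ger0_norm bp0).
  rewrite ler_wpM2r//; apply: (le_trans (scaled_kernel_le _ _ r0)).
  by rewrite ler_wpM2l ?exprn_ge0// ler_piMr// indicE lern1 leq_b1.
- by apply: integrableZl => //; exact: integrable_abse ig.
Qed.

(** The kernel integrates to one, so that the bias is a kernel average of
    [g z - g x]; the kernel being bounded with bounded support, this is at most
    an oscillation. *)
Lemma kernel_bias_le r (g : 'rV[R]_p -> R) : 0 < r ->
  lambda.-integrable setT (EFin \o g) ->
  (\int[lambda]_x (f x * `|fine (\int[lambda]_z (scaled_kernel r x z * g z)%:E) - g x|)%:E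
   <= (b ^+ p)%:E * osc f r g)%E.
Proof.
move=> r0 ig; have mg : measurable_fun setT g by apply/measurable_EFinP; exact: measurable_int ig.
have bp0 : 0 <= b ^+ p by rewrite exprn_ge0.
have rp0 : 0 <= r ^- p by rewrite invr_ge0 exprn_ge0// ltW.
have mK x := measurableT_comp (measurable_scaled_kernel r) (measurable_pair1 x).
pose H (xz : 'rV[R]_p * 'rV[R]_p) : R :=
  f xz.1 * (r ^- p * (`|g xz.2 - g xz.1| * \1_(near_rel r) xz)).
have mH : measurable_fun setT (EFin \o H).
  exact: (measurable_osc mf r mg).
have H0 xz : 0 <= H xz by rewrite /H !mulr_ge0.
have mKg : measurable_fun setT (fun xz => (scaled_kernel r xz.1 xz.2 * g xz.2)%:E).
  apply/measurable_EFinP/measurable_funM; first exact: measurable_scaled_kernel.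
  exact: (measurableT_comp mg measurable_snd).
have mHx x : measurable_fun setT (fun z => (H (x, z))%:E).
  exact: (measurableT_comp mH (measurable_pair1 x)).
rewrite oscE -ge0_integralZl//; last 2 first.
- exact: (measurable_fun_integral_pair lambda mH).
- by move=> x _; apply: integral_ge0 => z _; rewrite lee_fin; exact: (H0 (x, z)).
apply: ge0_le_integral => //.
- by move=> x _; rewrite lee_fin mulr_ge0.
- apply/measurable_EFinP/measurable_funM => //; apply: measurableT_comp => //.
  apply: measurable_funB => //; apply: measurableT_comp => //.
  exact: (measurable_fun_integral_pair lambda mKg).
- by apply: measurable_funeM; exact: (measurable_fun_integral_pair lambda mH).
move=> x _.
have iKg := integrable_kernelM x r0 ig.
have [iK K1] := integral_scaled_kernel x r0.
have iKgx : lambda.-integrable setT (fun z => (scaled_kernel r x z * g x)%:E).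
  under eq_fun do rewrite EFinM; exact: integrableZr.
rewrite EFinM; have -> : (`|fine (\int[lambda]_z (scaled_kernel r x z * g z)%:E) - g x|%:E
    = `|\int[lambda]_z (scaled_kernel r x z * (g z - g x))%:E|)%E.
  have Kgx : (\int[lambda]_z (scaled_kernel r x z * g x)%:E = (g x)%:E)%E.
    by under eq_integral do rewrite EFinM; rewrite integralZr// K1 mul1e.
  rewrite [in RHS](eq_integral (fun z => (scaled_kernel r x z * g z)%:E
      - (scaled_kernel r x z * g x)%:E)%E); last first.
    by move=> z _; rewrite mulrBr EFinB.
  rewrite integralB//= Kgx -[X in (X - _)%E]fineK//.
  exact: integrable_fin_num.
have mKgB : measurable_fun setT (fun z => (scaled_kernel r x z * (g z - g x))%:E).
  by apply/measurable_EFinP/measurable_funM; [exact: mK|exact: measurable_funB].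
rewrite (le_trans (lee_wpmul2l _ (le_abse_integral _ measurableT mKgB)))// ?lee_fin//.
rewrite -[leLHS]ge0_integralZl ?lee_fin//; last exact: measurableT_comp.
rewrite -[leRHS]ge0_integralZl ?lee_fin//; last 2 first.
- exact: mHx.
- by move=> z _; rewrite lee_fin; exact: (H0 (x, z)).
apply: ge0_le_integral => //.
- by move=> z _; rewrite -EFinM lee_fin mulr_ge0.
- by apply: measurable_funeM; exact: measurableT_comp.
- by apply: measurable_funeM; exact: mHx.
move=> z _; rewrite -!EFinM lee_fin normrM.
have := ler_wpM2l (mulr_ge0 (f0 x) (normr_ge0 (g z - g x))) (scaled_kernel_le x z r0).
by lra.
Qed.

End scaled_kernel.

(** * Independent copies *)

Lemma integral_cst_prob d (T : measurableType d) (R : realType)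
  (P : probability T R) (c : R) : (\int[P]_x c%:E = c%:E)%E.
Proof. by have := expectation_cst P c; rewrite unlock. Qed.

Lemma integral_law d d' (T : measurableType d) (T' : measurableType d') (R : realType)
    (P : probability T R) (m : {measure set T' -> \bar R}) (f : T -> T') :
  measurable_fun setT f -> (forall A, measurable A -> P (f @^-1` A) = m A) ->
  forall phi : T' -> \bar R, measurable_fun setT phi ->
  (\int[P]_w phi (f w) = \int[m]_x phi x)%E.
Proof.
move=> mf fm phi mphi.
pose pf : {mfun T >-> T'} := HB.pack f (isMeasurableFun.Build _ _ _ _ f mf).
have dE A : measurable A -> A `<=` setT -> distribution P pf A = m A.
  by move=> mA _; exact: fm.
have ge0 (psi : T' -> \bar R) : measurable_fun setT psi -> (forall x, 0 <= psi x)%E ->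
    (\int[P]_w psi (f w) = \int[m]_x psi x)%E.
  move=> mpsi psi0; rewrite -(eq_measure_integral m dE) /distribution.
  by rewrite ge0_integral_pushforward.
rewrite [LHS]integralE [RHS]integralE; congr (_ - _)%E.
  rewrite -ge0//; first by apply: eq_integral => w _; rewrite !funeposE.
  exact: measurable_funepos.
rewrite -ge0//; first by apply: eq_integral => w _; rewrite !funenegE.
exact: measurable_funeneg.
Qed.

Section iid.
Context d (T : measurableType d) (R : realType) (P : probability T R).
Context dV (V : measurableType dV) (mu : probability V R).
Context (Z : nat -> T -> V) (mZ : forall j, measurable_fun setT (Z j)).
Hypothesis Zmu : forall j B, measurable B -> P (Z j @^-1` B) = mu B.
Hypothesis Zindep : forall n (B : nat -> set V), (forall j, measurable (B j)) ->
  P [set w | forall j, (j < n)%N -> B j (Z j w)] = (\prod_(j < n) P (Z j @^-1` B j))%E.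

(** Independence is stated for initial segments of the sequence; the other
    factors are filled with the whole space.  Three indices are enough for the
    covariances between two summands that share one observation. *)
Lemma iid_rect3 j v u (A B C : set V) : j != v -> j != u -> v != u ->
  measurable A -> measurable B -> measurable C ->
  P [set w | [/\ A (Z j w), B (Z v w) & C (Z u w)]] = (mu A * mu B * mu C)%E.
Proof.
move=> jv ju vu mA mB mC.
pose D i := if i == j then A else if i == v then B else if i == u then C else setT.
have mD i : measurable (D i) by rewrite /D; do 3 case: ifP => // _.
pose n := (maxn j (maxn v u)).+1.
have jn : (j < n)%N by rewrite ltnS leq_maxl.
have vn : (v < n)%N by rewrite ltnS leq_max leq_maxl orbT.
have un : (u < n)%N by rewrite ltnS !leq_max leqnn !orbT.
have Dj : D j = A by rewrite /D eqxx.
have Dv : D v = B by rewrite /D eq_sym (negbTE jv) eqxx.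
have Du : D u = C by rewrite /D ![u == _]eq_sym (negbTE ju) (negbTE vu) eqxx.
transitivity (P [set w | forall i, (i < n)%N -> D i (Z i w)]).
  congr (P _); apply/seteqP; split=> w /=.
    move=> [Aj Bv Cu] i _; rewrite /D; case: eqP => [->//|_].
    by case: eqP => [->//|_]; case: eqP => [->|].
  by move=> h; split; [rewrite -Dj|rewrite -Dv|rewrite -Du]; exact: h.
rewrite Zindep//.
under eq_bigr do rewrite Zmu//.
rewrite (bigD1 (Ordinal jn))//= (bigD1 (Ordinal vn))/=; last first.
  by rewrite -val_eqE/= eq_sym.
rewrite (bigD1 (Ordinal un))/=; last by rewrite -!val_eqE/= ![u == _]eq_sym ju vu.
rewrite big1 ?mule1 ?Dj ?Dv ?Du ?muleA// => i /andP[/andP[ij iv] iu].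
rewrite /D (negbTE (ij : val i != j)) (negbTE (iv : val i != v)) (negbTE (iu : val i != u)).
exact: probability_setT.
Qed.

Lemma iid_rect2 j v (A B : set V) : j != v -> measurable A -> measurable B ->
  P [set w | A (Z j w) /\ B (Z v w)] = (mu A * mu B)%E.
Proof.
move=> jv mA mB; pose u := (maxn j v).+1.
have ju : j != u by rewrite ltn_eqF// ltnS leq_maxl.
have vu : v != u by rewrite ltn_eqF// ltnS leq_maxr.
have := iid_rect3 jv ju vu mA mB measurableT.
rewrite [X in (_ * X)%E](_ : _ = 1%E) ?mule1 => [<-|]; last exact: probability_setT.
by congr (P _); apply/seteqP; split=> w [] //=.
Qed.

Lemma iid_integral1 j (phi : V -> \bar R) : measurable_fun setT phi ->
  (\int[P]_w phi (Z j w) = \int[mu]_x phi x)%E.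
Proof. exact: (integral_law (mZ j) (Zmu j)). Qed.

Let mZ2 j v : measurable_fun setT (fun w => (Z j w, Z v w)).
Proof. by apply/measurable_fun_pairP; split; exact: mZ. Qed.

Let law2 j v (A : set (V * V)) : j != v -> measurable A ->
  P ((fun w => (Z j w, Z v w)) @^-1` A) = (mu \x mu)%E A.
Proof.
move=> jv mA; apply/esym.
pose pf : {mfun T >-> (V * V)%type} :=
  HB.pack (fun w => (Z j w, Z v w)) (isMeasurableFun.Build _ _ _ _ _ (mZ2 j v)).
apply: (product_measure_unique (m1 := mu) (m2 := mu) (m' := distribution P pf)) => //.
by move=> B C mB mC; rewrite -(iid_rect2 jv mB mC).
Qed.

Lemma iid_integral2 j v (phi : V * V -> \bar R) : j != v ->
  measurable_fun setT phi -> (forall x, 0 <= phi x)%E ->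
  (\int[P]_w phi (Z j w, Z v w) = \int[mu]_x \int[mu]_y phi (x, y))%E.
Proof.
move=> jv mphi phi0; rewrite -(fubini_tonelli1 phi)//.
apply: (integral_law (mZ2 j v)) => //.
by move=> A mA; exact: law2.
Qed.

(** The first two coordinates enter through an arbitrary measure [mu2] equal to
    the product on measurable sets, so that it can be instantiated by the law of
    the pair, which is a probability by construction. *)
Let law3 (mu2 : {sigma_finite_measure set (V * V)%type -> \bar R}) j v u
    (A : set (V * V * V)) : (forall D, measurable D -> mu2 D = (mu \x mu)%E D) ->
  j != v -> j != u -> v != u -> measurable A ->
  P ((fun w => (Z j w, Z v w, Z u w)) @^-1` A) = (mu2 \x mu)%E A.
Proof.
move=> mu2E jv ju vu mA; apply/esym.
have mZ3 : measurable_fun setT (fun w => (Z j w, Z v w, Z u w)).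
  by apply/measurable_fun_pairP; split; [exact: mZ2|exact: mZ].
pose pf : {mfun T >-> (V * V * V)%type} :=
  HB.pack (fun w => (Z j w, Z v w, Z u w)) (isMeasurableFun.Build _ _ _ _ _ mZ3).
apply: (product_measure_unique (m1 := mu2) (m2 := mu)
  (m' := distribution P pf)) => //.
move=> D C mD mC.
have mZC : measurable (Z u @^-1` C) by apply: measurable_preimage => //; exact: mZ.
pose m1 : {measure set (V * V)%type -> \bar R} :=
  measure_function_pushforward__canonical__measure_function_Measure
    (mrestr P mZC) (mZ2 j v).
have muC0 : (0 <= fine (mu C))%R by rewrite fine_ge0.
pose c := NngNum muC0.
pose m2 : {measure set (V * V)%type -> \bar R} := mscale c (mu \x mu)%E.
have m2E E : m2 E = (mu C * (mu \x mu) E)%E.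
  by rewrite -[LHS]/((fine (mu C))%:E * (mu \x mu) E)%E fineK ?fin_num_measure.
have m12 : m1 D = m2 D.
  pose G : set (set (V * V)) :=
    [set E | exists A, measurable A /\ exists B, measurable B /\ E = A `*` B].
  have GI : setI_closed G.
    move=> _ _ [X1 [mX1 [X2 [mX2 ->]]]] [Y1 [mY1 [Y2 [mY2 ->]]]].
    rewrite -setXI; exists (X1 `&` Y1); split; first exact: measurableI.
    by exists (X2 `&` Y2); split => //; exact: measurableI.
  apply: (measure_unique G (fun=> setT)) => //.
  - rewrite measurable_prod_measurableType //; congr (<<s _ >>).
    rewrite predeqE => E; split => [[A' mA' [B mB <-]]|[A' [mA' [B [mB ->]]]]].
      by exists A'; split => //; exists B.
    by exists A' => //; exists B.
  - by move=> _; exists setT; split=> //; exists setT; split=> //; rewrite setXTT.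
  - by rewrite bigcup_const.
  - move=> _ [A' [mA' [B [mB ->]]]].
    rewrite m2E product_measure1E// muleC -(iid_rect3 jv ju vu mA' mB mC) /m1/= /pushforward /mrestr.
    by congr (P _); apply/seteqP; split=> w [] //= [].
  - move=> _; apply: (@le_lt_trans _ _ 1%E); last exact: ltry.
    apply: (@probability_le1 _ _ _ P ((fun w => (Z j w, Z v w)) @^-1` setT `&` Z u @^-1` C)).
    by rewrite preimage_setT setTI.
transitivity (m1 D).
  by rewrite /m1/= /pushforward /mrestr.
by rewrite m12 m2E muleC mu2E.
Qed.

Lemma bounded_integrable d' (T' : measurableType d') (m : probability T' R)
    (phi : T' -> R) (c : R) : measurable_fun setT phi -> (forall x, `|phi x| <= c) ->
  m.-integrable setT (EFin \o phi).
Proof.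
move=> mphi phic.
apply: (le_integrable measurableT _ _ (finite_measure_integrable_cst m c measurableT)).
  exact/measurable_EFinP.
by move=> x _; rewrite lee_fin (le_trans (phic x))// ler_norm.
Qed.

(** Integrating over the third observation first, the other two being fixed,
    gives zero. *)
Lemma iid_uncorrelated j v u (xi : V * V -> R) (c : R) :
  j != v -> j != u -> v != u -> measurable_fun setT xi -> (forall x, `|xi x| <= c) ->
  (forall a, \int[mu]_b (xi (a, b))%:E = 0)%E ->
  (\int[P]_w (xi (Z j w, Z v w) * xi (Z j w, Z u w))%:E = 0)%E.
Proof.
move=> jv ju vu mxi xic xi0.
pose phi (x : V * V * V) := (xi x.1 * xi (x.1.1, x.2))%:E.
have mphi : measurable_fun setT phi.
  apply/measurable_EFinP/measurable_funM; first exact: (measurableT_comp mxi measurable_fst).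
  apply: (measurableT_comp mxi); apply/measurable_fun_pairP; split.
    exact: (measurableT_comp measurable_fst measurable_fst).
  exact: measurable_snd.
have mZ3 : measurable_fun setT (fun w => (Z j w, Z v w, Z u w)).
  by apply/measurable_fun_pairP; split; [exact: mZ2|exact: mZ].
have phic x : `|fine (phi x)| <= c * c by rewrite normrM ler_pM.
pose pf : {mfun T >-> (V * V)%type} :=
  HB.pack (fun w => (Z j w, Z v w)) (isMeasurableFun.Build _ _ _ _ _ (mZ2 j v)).
pose mu2 : probability (V * V)%type R := distribution P pf.
have mu2E D : measurable D -> mu2 D = (mu \x mu)%E D by move=> mD; rewrite -(law2 jv).
have law A (mA : measurable A) := law3 mu2E jv ju vu mA.
rewrite -[LHS]/(\int[P]_w (phi (Z j w, Z v w, Z u w)))%E.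
rewrite (integral_law mZ3 law mphi).
have iphi : (mu2 \x mu)%E.-integrable setT phi.
  apply/integrable12ltyP => //.
  have inner x : (\int[mu]_y `|phi (x, y)| <= (c * c)%:E)%E.
    rewrite -(integral_cst_prob mu (c * c)).
    apply: ge0_le_integral => //.
    - apply: measurableT_comp => //; exact: (measurableT_comp mphi (measurable_pair1 x)).
    - by move=> y _; rewrite lee_fin; exact: (phic (x, y)).
  apply: (@le_lt_trans _ _ (\int[mu2]_x (c * c)%:E)%E).
    apply: ge0_le_integral => //.
    - by move=> x _; exact: integral_ge0.
    - apply: (measurable_fun_integral_pair mu (F := fun z => `|phi z|%E)).
      exact: measurableT_comp.
  by rewrite integral_cst_prob ltry.
rewrite -(integral12_prod_meas1 iphi) integral0_eq// => x _.
have ixi : mu.-integrable setT (fun y => (xi (x.1, y))%:E).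
  apply: (@bounded_integrable _ _ mu (fun y => xi (x.1, y)) c) => //.
  exact: (measurableT_comp mxi (measurable_pair1 x.1)).
rewrite /fubini_F /phi/=; under eq_integral do rewrite EFinM.
by rewrite integralZl// xi0 mule0.
Qed.

Let measurable_pairZ j v (xi : V * V -> R) : measurable_fun setT xi ->
  measurable_fun setT (fun w => xi (Z j w, Z v w)).
Proof. by move=> mxi; exact: (measurableT_comp mxi (mZ2 j v)). Qed.

Let sum_bound (I : seq nat) (F : nat -> R) (c : R) :
  (forall v, `|F v| <= c) -> `|\sum_(v <- I) F v| <= (size I)%:R * c.
Proof.
move=> Fc; rewrite mulr_natl; elim: I => [|v I IHI]; first by rewrite big_nil normr0.
by rewrite big_cons/= mulrS (le_trans (ler_normD _ _))// lerD.
Qed.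

(** Given [Z j] the summands are centered and independent: squaring the sum
    leaves the diagonal terms. *)
Lemma iid_variance j (I : seq nat) (xi : V * V -> R) (c : R) :
  uniq I -> j \notin I -> measurable_fun setT xi -> (forall x, `|xi x| <= c) ->
  (forall a, \int[mu]_b (xi (a, b))%:E = 0)%E ->
  (\int[P]_w ((\sum_(v <- I) xi (Z j w, Z v w)) ^+ 2)%:E =
   (size I)%:R%:E * \int[mu]_a \int[mu]_b ((xi (a, b)) ^+ 2)%:E)%E.
Proof.
move=> + + mxi xic xi0.
have c0 : 0 <= c by apply: le_trans (xic (point, point)).
pose x v w := xi (Z j w, Z v w).
have mx v : measurable_fun setT (x v) by exact: measurable_pairZ.
have mS (I' : seq nat) : measurable_fun setT (fun w => \sum_(v <- I') x v w).
  by apply: measurable_sum => v; exact: mx.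
have Sc (I' : seq nat) w : `|\sum_(v <- I') x v w| <= (size I')%:R * c.
  by apply: sum_bound => v; exact: xic.
have cross v (I' : seq nat) : j != v -> v \notin I' -> j \notin I' ->
    (\int[P]_w (x v w * \sum_(u <- I') x u w)%:E = 0)%E.
  move=> jv; elim: I' => [|u I' IHI].
    by move=> _ _; rewrite integral0_eq// => w _; rewrite big_nil mulr0.
  rewrite !inE !negb_or => /andP[vu vI] /andP[ju jI].
  under eq_integral do rewrite big_cons mulrDr EFinD.
  rewrite integralD//; last 2 first.
  - apply: (@bounded_integrable _ _ P (fun w => x v w * x u w) (c * c)).
      exact: measurable_funM.
    by move=> w; rewrite normrM ler_pM// xic.
  - apply: (@bounded_integrable _ _ P (fun w => x v w * \sum_(u <- I') x u w)
      (c * ((size I')%:R * c))).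
      exact: measurable_funM.
    by move=> w; rewrite normrM ler_pM// xic.
  by rewrite IHI// adde0; exact: (iid_uncorrelated jv ju vu mxi xic xi0).
elim: I => [|v I IHI].
  move=> _ _; rewrite mul0e integral0_eq// => w _.
  by rewrite big_nil expr0n.
rewrite cons_uniq !inE negb_or => /andP[vI uI] /andP[jv jI].
under eq_integral do rewrite big_cons sqrrD EFinD EFinD.
have ix2 : P.-integrable setT (EFin \o (fun w => x v w ^+ 2)).
  apply: (bounded_integrable P (c := c ^+ 2)); first exact: measurable_funX.
  by move=> w; rewrite normrX lerXn2r ?nnegrE// xic.
have iS2 : P.-integrable setT (EFin \o (fun w => (\sum_(v <- I) x v w) ^+ 2)).
  apply: (bounded_integrable P (c := ((size I)%:R * c) ^+ 2)); first exact: measurable_funX.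
  by move=> w; rewrite normrX lerXn2r ?nnegrE ?mulr_ge0.
have ixS : P.-integrable setT (EFin \o (fun w => x v w * (\sum_(v <- I) x v w) *+ 2)).
  apply: (bounded_integrable P (c := (c * ((size I)%:R * c)) *+ 2)).
    by under eq_fun do rewrite -mulr_natl; apply: measurable_funM => //; exact: measurable_funM.
  by move=> w; rewrite normrMn lerMn2r/= normrM ler_pM// xic.
rewrite integralD//; last exact: integrableD.
rewrite integralD// IHI//.
have -> : (\int[P]_w (x v w * (\sum_(v <- I) x v w) *+ 2)%:E = 0)%E.
  under eq_integral do rewrite -mulr_natl EFinM.
  rewrite integralZl//; first by rewrite cross// mule0.
  apply: (bounded_integrable P (c := (c * ((size I)%:R * c)))).
    exact: measurable_funM.
  by move=> w; rewrite normrM ler_pM// xic.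
rewrite adde0 (iid_integral2 jv (phi := fun z => ((xi z) ^+ 2)%:E)).
- rewrite -[X in (X + _)%E]mul1e -ge0_muleDl ?lee_fin// -EFinD.
  by rewrite -[in RHS]natr1 addrC.
- by apply/measurable_EFinP; exact: measurable_funX.
- by move=> z; rewrite lee_fin sqr_ge0.
Qed.

(** ** Kernel averages over the sample *)

(** The conditional mean of a summand of the average below, given [Z j = a]. *)
Definition kmean (kap : V * V -> R) (psi : V -> R) (a : V) : R :=
  fine (\int[mu]_b (kap (a, b) * psi b)%:E)%E.

Definition kdev (kap : V * V -> R) (psi : V -> R) (n j : nat) (w : T) : R :=
  `|n%:R^-1 * \sum_(v < n) kap (Z j w, Z v w) * psi (Z v w) - kmean kap psi (Z j w)|.

Section kernel_average.
Variables (kap : V * V -> R) (beta C : R).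
Hypothesis mkap : measurable_fun setT kap.
Hypothesis kapb : forall x, `|kap x| <= beta.
Hypothesis C0 : 0 <= C.
Hypothesis kapC : forall b, (\int[mu]_a `|(kap (a, b))%:E| <= C%:E)%E.

Let beta0 : 0 <= beta. Proof. exact: le_trans (kapb (point, point)). Qed.

Let mF (phi : V -> R) : measurable_fun setT phi -> measurable_fun setT
  (fun x : V * V => (kap x * phi x.2)%:E).
Proof.
move=> mphi; apply/measurable_EFinP/measurable_funM => //.
exact: (measurableT_comp mphi measurable_snd).
Qed.

Lemma measurable_kmean (psi : V -> R) :
  measurable_fun setT psi -> measurable_fun setT (kmean kap psi).
Proof.
move=> mpsi; apply: measurableT_comp => //.
exact: (measurable_fun_integral_pair mu (mF mpsi)).
Qed.

Let mFr (phi : V -> R) : measurable_fun setT phi -> measurable_fun setT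
  (fun x : V * V => kap x * phi x.2).
Proof. by move=> mphi; apply/measurable_EFinP; exact: mF. Qed.

Let mFa (phi : V -> R) : measurable_fun setT phi -> measurable_fun setT
  (fun x : V * V => `|(kap x * phi x.2)%:E|%E).
Proof. by move=> mphi; apply: measurableT_comp => //; exact: mF. Qed.

(** Schur test: integrals of [kap] over its first argument, bounded by [C],
    suffice since the second argument is the one that [phi] depends on. *)
Let integral_kapM (phi : V -> R) : measurable_fun setT phi ->
  (\int[mu]_a \int[mu]_b `|(kap (a, b) * phi b)%:E| <= C%:E * \int[mu]_b `|(phi b)%:E|)%E.
Proof.
move=> mphi; rewrite (fubini_tonelli (fun x => `|(kap x * phi x.2)%:E|%E))//; last exact: mFa.
rewrite -ge0_integralZl ?lee_fin//; last exact/measurableT_comp/measurable_EFinP.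
apply: ge0_le_integral => //.
- by move=> b _; exact: integral_ge0.
- apply: (measurable_fun_fubini_tonelli_G (fun x => `|(kap x * phi x.2)%:E|%E)) => //.
  exact: mFa.
- by apply: measurable_funeM; exact/measurableT_comp/measurable_EFinP.
move=> b _; rewrite [leLHS](eq_integral (fun a => `|(phi b)%:E| * `|(kap (a, b))%:E|)%E).
  rewrite ge0_integralZl//; last first.
    by apply/measurableT_comp/measurable_EFinP => //; exact: (measurableT_comp mkap (measurable_pair2 b)).
  by rewrite muleC lee_wpmul2r.
by move=> a _; rewrite -abseM -EFinM mulrC.
Qed.

Lemma le_kmean (psi : V -> R) a : measurable_fun setT psi ->
  (`|kmean kap psi a|%:E <= \int[mu]_b `|(kap (a, b) * psi b)%:E|)%E.
Proof.
move=> mpsi; apply: (@le_trans _ _ `|\int[mu]_b (kap (a, b) * psi b)%:E|%E).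
  rewrite /kmean; case: (\int[mu]_b _)%E => [r| |] //=; rewrite ?normr0 ?leey//.
apply: le_abse_integral => //.
exact: (measurableT_comp (mF mpsi) (measurable_pair1 a)).
Qed.

Lemma expect_kmean j (psi : V -> R) : measurable_fun setT psi ->
  (\int[P]_w `|kmean kap psi (Z j w)|%:E <= C%:E * \int[mu]_b `|(psi b)%:E|)%E.
Proof.
move=> mpsi; have mk := measurable_kmean mpsi.
rewrite (iid_integral1 j (phi := fun a => `|kmean kap psi a|%:E)); last first.
  by apply/measurable_EFinP; exact: measurableT_comp.
apply: le_trans (integral_kapM mpsi); apply: ge0_le_integral => //.
- by apply/measurable_EFinP; exact: measurableT_comp.
- apply: (measurable_fun_integral_pair mu (F := fun x => `|(kap x * psi x.2)%:E|%E)).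
  exact: mFa.
- by move=> a _; exact: le_kmean.
Qed.

(** The diagonal summand [v = j] is not averaged by independence; it is bounded by
    the maximum [beta] of the kernel, divided by [n]. *)
Lemma expect_kernel_average n j (psi : V -> R) : (j < n)%N -> measurable_fun setT psi ->
  (\int[P]_w (n%:R^-1 * \sum_(v < n) `|kap (Z j w, Z v w) * psi (Z v w)|)%:E <=
   (beta / n%:R + C)%:E * \int[mu]_b `|(psi b)%:E|)%E.
Proof.
move=> jn mpsi; have n0 : (0 < n%:R :> R) by rewrite ltr0n (leq_ltn_trans _ jn).
have I0 : (0 <= \int[mu]_b `|(psi b)%:E|)%E by exact: integral_ge0.
have mterm v : measurable_fun setT (fun w => `|kap (Z j w, Z v w) * psi (Z v w)|%:E).
  apply/measurable_EFinP/measurableT_comp => //.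
  exact: (measurableT_comp (mFr mpsi) (mZ2 j v)).
have term v : (\int[P]_w `|kap (Z j w, Z v w) * psi (Z v w)|%:E <=
    (if v == j then beta else C)%:E * \int[mu]_b `|(psi b)%:E|)%E.
  case: eqP => [->|/eqP vj].
    rewrite -(iid_integral1 j (phi := fun b => `|(psi b)%:E|%E))//; last first.
      exact/measurableT_comp/measurable_EFinP.
    have mpsiZ : measurable_fun setT (fun w => `|(psi (Z j w))%:E|%E).
      by apply/measurableT_comp/measurable_EFinP => //; exact: (measurableT_comp mpsi (mZ j)).
    rewrite -ge0_integralZl ?lee_fin//; apply: ge0_le_integral => //.
      exact: measurable_funeM.
    by move=> w _; rewrite -EFinM lee_fin normrM ler_wpM2r.
  rewrite eq_sym in vj.
  rewrite (iid_integral2 vj (phi := fun x => `|(kap x * psi x.2)%:E|%E))//.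
    exact: (integral_kapM mpsi).
  exact: mFa.
under eq_integral do rewrite EFinM -sumEFin.
rewrite ge0_integralZl ?lee_fin ?invr_ge0 ?ler0n//; last 2 first.
- by apply: emeasurable_sum => v.
- by move=> w _; apply: sume_ge0 => v _; rewrite lee_fin.
rewrite ge0_integral_sum//.
apply: (@le_trans _ _ (n%:R^-1%:E * \sum_(v < n)
    ((if v == j :> nat then beta else C)%:E * \int[mu]_b `|(psi b)%:E|))%E).
  by apply: lee_wpmul2l; [rewrite lee_fin invr_ge0 ler0n|exact: lee_sum].
rewrite -ge0_sume_distrl; last by move=> v _; rewrite lee_fin; case: ifP.
rewrite muleA lee_wpmul2r// sumEFin -EFinM lee_fin.
rewrite (bigD1 (Ordinal jn))//= eqxx.
rewrite (eq_bigr (fun=> C)); last by move=> v; rewrite -val_eqE/= => /negbTE ->.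
rewrite sumr_const cardC1 card_ord mulrDr mulrC lerD2l// ler_pdivrMl//.
by rewrite -[leLHS]mulr_natl ler_wpM2r// ler_nat leq_pred.
Qed.

Lemma measurable_kdev (psi : V -> R) n j : measurable_fun setT psi ->
  measurable_fun setT (kdev kap psi n j).
Proof.
move=> mpsi; apply: measurableT_comp => //; apply: measurable_funB.
  apply: measurable_funM => //; apply: measurable_sum => v.
  exact: (measurableT_comp (mFr mpsi) (mZ2 j v)).
by apply: (measurableT_comp (measurable_kmean mpsi)); exact: mZ.
Qed.

Lemma kdev_le_norm (psi : V -> R) n j : (j < n)%N -> measurable_fun setT psi ->
  (\int[P]_w (kdev kap psi n j w)%:E <=
   (beta / n%:R + 2 * C)%:E * \int[mu]_b `|(psi b)%:E|)%E.
Proof.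
move=> jn mpsi; have I0 : (0 <= \int[mu]_b `|(psi b)%:E|)%E by exact: integral_ge0.
pose A w : R := n%:R^-1 * \sum_(v < n) `|kap (Z j w, Z v w) * psi (Z v w)|.
pose B w : R := `|kmean kap psi (Z j w)|.
have mA : measurable_fun setT (EFin \o A).
  apply/measurable_EFinP/measurable_funM => //; apply: measurable_sum => v.
  apply: measurableT_comp => //.
  exact: (measurableT_comp (mFr mpsi) (mZ2 j v)).
have mB : measurable_fun setT (EFin \o B).
  apply/measurable_EFinP/measurableT_comp => //.
  exact: (measurableT_comp (measurable_kmean mpsi) (mZ j)).
have A0 w : 0 <= A w by rewrite mulr_ge0 ?invr_ge0// sumr_ge0.
apply: (@le_trans _ _ (\int[P]_w ((A w)%:E + (B w)%:E))%E).
  apply: ge0_le_integral => //.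
  - by move=> w _; rewrite lee_fin /kdev.
  - exact/measurable_EFinP/measurable_kdev.
  - exact: emeasurable_funD.
  move=> w _; rewrite -EFinD lee_fin (le_trans (ler_normB _ _))// lerD2r//.
  by rewrite normrM ger0_norm ?invr_ge0// ler_wpM2l ?invr_ge0// ler_norm_sum.
have EA0 w : (0 <= (A w)%:E)%E by rewrite lee_fin.
have EB0 w : (0 <= (B w)%:E)%E by rewrite lee_fin /B.
rewrite ge0_integralD//.
apply: (le_trans (leeD (expect_kernel_average jn mpsi) (expect_kmean j mpsi))).
rewrite -ge0_muleDl ?lee_fin// -?EFinD.
  by rewrite lee_wpmul2r// lee_fin; lra.
by rewrite addr_ge0// divr_ge0.
Qed.

Lemma kdevB (psi psi1 : V -> R) n j w : mu.-integrable setT (EFin \o psi) ->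
  mu.-integrable setT (EFin \o psi1) ->
  kdev kap psi n j w <= kdev kap psi1 n j w + kdev kap (fun v => psi v - psi1 v) n j w.
Proof.
move=> ipsi ipsi1.
have ik phi a : mu.-integrable setT (EFin \o phi) ->
    mu.-integrable setT (fun b => (kap (a, b) * phi b)%:E).
  move=> iphi; have mphi : measurable_fun setT phi.
    by apply/measurable_EFinP; exact: measurable_int iphi.
  apply: (le_integrable measurableT _ _ (integrableZl measurableT beta iphi)).
    exact: (measurableT_comp (mF mphi) (measurable_pair1 a)).
  by move=> b _; rewrite lee_fin !normrM ler_wpM2r// (le_trans (kapb _))// ler_norm.
have kmB a : kmean kap (fun v => psi v - psi1 v) a = kmean kap psi a - kmean kap psi1 a.
  rewrite /kmean; under eq_integral do rewrite mulrBr EFinB.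
  rewrite integralB//; [|exact: ik|exact: ik].
  by rewrite fineB//; apply: integrable_fin_num => //; exact: ik.
rewrite /kdev kmB.
rewrite (eq_bigr (fun v : 'I_n => kap (Z j w, Z v w) * psi1 (Z v w) +
  kap (Z j w, Z v w) * (psi (Z v w) - psi1 (Z v w)))); last by move=> v _; ring.
rewrite big_split/= mulrDr opprB.
set a := _ * _; set b := _ * _; set c := kmean _ _ _; set e := kmean _ _ _.
have -> : a + b - c = (a - e) + (b + (e - c)) by ring.
exact: ler_normD.
Qed.

(** For bounded [psi] the second moment decides: after centering, the cross terms
    vanish, and the variance of a summand is of order [beta], not [beta ^+ 2],
    because one of the two kernel factors integrates to a constant.  The parameter
    [s] turns the second moment into a first one. *)
Lemma kdev_le_bounded (psi : V -> R) (L s : R) n j : (j < n)%N ->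
  measurable_fun setT psi -> (forall v, `|psi v| <= L) -> 0 < s ->
  (\int[P]_w (kdev kap psi n j w)%:E <=
   (2 * (beta / n%:R) * C * L ^+ 2 / s + s / 2 + 2 * (beta / n%:R) * L)%:E)%E.
Proof.
move=> jn mpsi psiL s0; have n0 : (0 < n%:R :> R) by rewrite ltr0n (leq_ltn_trans _ jn).
have L0 : 0 <= L by exact: le_trans (psiL point).
have ikpsi a : mu.-integrable setT (fun b => (kap (a, b) * psi b)%:E).
  apply: (bounded_integrable mu (phi := fun b => kap (a, b) * psi b) (c := beta * L)).
    exact: (measurableT_comp (mFr mpsi) (measurable_pair1 a)).
  by move=> b; rewrite normrM ler_pM.
pose xi (x : V * V) : R := kap x * psi x.2 - kmean kap psi x.1.
have mxi : measurable_fun setT xi.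
  apply: measurable_funB; first exact: mFr.
  exact: (measurableT_comp (measurable_kmean mpsi) measurable_fst).
have kmL a : `|kmean kap psi a| <= beta * L.
  rewrite -lee_fin (le_trans (le_kmean a mpsi))// -(integral_cst_prob mu (beta * L)).
  apply: ge0_le_integral => //.
  - exact: (measurableT_comp (mFa mpsi) (measurable_pair1 a)).
  - by move=> b _; rewrite lee_fin normrM ler_pM.
have xiL x : `|xi x| <= 2 * (beta * L).
  rewrite (le_trans (ler_normB _ _))// mulr_natl mulr2n lerD// normrM.
  by rewrite ler_pM.
have xi0 a : (\int[mu]_b (xi (a, b))%:E = 0)%E.
  under eq_integral do rewrite /xi/= EFinB.
  rewrite integralB//; last exact: (finite_measure_integrable_cst mu).
  rewrite integral_cst_prob /kmean fineK ?subee//; exact: integrable_fin_num.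
have psi1 : (\int[mu]_b `|(psi b)%:E| <= L%:E)%E.
  rewrite -(integral_cst_prob mu L); apply: ge0_le_integral => //.
  - exact/measurableT_comp/measurable_EFinP.
  - by move=> b _; rewrite lee_fin.
have xi2 : (\int[mu]_a \int[mu]_b ((xi (a, b)) ^+ 2)%:E <= (4 * beta * C * L ^+ 2)%:E)%E.
  apply: (@le_trans _ _ (\int[mu]_a \int[mu]_b ((2 * (beta * L))%:E *
      (`|(kap (a, b) * psi b)%:E| + `|kmean kap psi a|%:E)))%E).
    apply: ge0_le_integral => //.
    - by move=> a _; apply: integral_ge0 => b _; rewrite lee_fin sqr_ge0.
    - apply: (measurable_fun_integral_pair mu (F := fun x => ((xi x) ^+ 2)%:E)).
      by apply/measurable_EFinP; exact: measurable_funX.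
    - apply: (measurable_fun_integral_pair mu (F := fun x => ((2 * (beta * L))%:E *
        (`|(kap x * psi x.2)%:E| + `|kmean kap psi x.1|%:E))%E)).
      apply: measurable_funeM; apply: emeasurable_funD; first exact: mFa.
      apply/measurable_EFinP/measurableT_comp => //.
      exact: (measurableT_comp (measurable_kmean mpsi) measurable_fst).
    move=> a _; apply: ge0_le_integral => //.
    - by move=> b _; rewrite lee_fin sqr_ge0.
    - apply/measurable_EFinP/measurable_funX.
      exact: (measurableT_comp mxi (measurable_pair1 a)).
    - apply: measurable_funeM; apply: emeasurable_funD => //.
      exact: (measurableT_comp (mFa mpsi) (measurable_pair1 a)).
    move=> b _; rewrite -EFinD -EFinM lee_fin -real_normK ?num_real// expr2.
    by rewrite ler_pM// (le_trans (ler_normB _ _)).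
  have bL0 : (0 <= (2 * (beta * L))%:E :> \bar R)%E by rewrite lee_fin !mulr_ge0.
  have mk : measurable_fun setT (fun a => `|kmean kap psi a|%:E).
    by apply/measurable_EFinP/measurableT_comp => //; exact: measurable_kmean.
  have mi : measurable_fun setT (fun a => \int[mu]_b `|(kap (a, b) * psi b)%:E|)%E.
    exact: (measurable_fun_integral_pair mu (mFa mpsi)).
  have E a : (\int[mu]_b ((2 * (beta * L))%:E *
      (`|(kap (a, b) * psi b)%:E| + `|kmean kap psi a|%:E)) = (2 * (beta * L))%:E *
      (\int[mu]_b `|(kap (a, b) * psi b)%:E| + `|kmean kap psi a|%:E))%E.
    have ma : measurable_fun setT (fun b => `|(kap (a, b) * psi b)%:E|%E).
      exact: (measurableT_comp (mFa mpsi) (measurable_pair1 a)).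
    have mb : measurable_fun setT (fun b => `|(kap (a, b) * psi b)%:E| +
        `|kmean kap psi a|%:E)%E by exact: emeasurable_funD.
    rewrite ge0_integralZl//; last by move=> b _; exact: adde_ge0.
    by rewrite ge0_integralD// integral_cst_prob.
  under eq_integral do rewrite E.
  rewrite ge0_integralZl//; last 2 first.
  - exact: emeasurable_funD.
  - by move=> a _; apply: adde_ge0 => //; exact: integral_ge0.
  rewrite ge0_integralD//; last by move=> a _; exact: integral_ge0.
  have ekm : (\int[mu]_a `|kmean kap psi a|%:E <= C%:E * L%:E)%E.
    rewrite -(iid_integral1 0 (phi := fun a => `|kmean kap psi a|%:E))//.
    by apply: (le_trans (expect_kmean 0 mpsi)); rewrite lee_wpmul2l.
  have eki : (\int[mu]_a \int[mu]_b `|(kap (a, b) * psi b)%:E| <= C%:E * L%:E)%E.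
    by apply: (le_trans (integral_kapM mpsi)); rewrite lee_wpmul2l.
  apply: (le_trans (lee_wpmul2l bL0 (leeD eki ekm))).
  by rewrite -(EFinM C L) -EFinD -EFinM lee_fin; lra.
pose I := [seq v <- iota 0 n | v != j].
pose S w := \sum_(v <- I) xi (Z j w, Z v w).
have mS : measurable_fun setT S by apply: measurable_sum => v; exact: measurable_pairZ.
have jI : j \notin I by rewrite mem_filter eqxx.
have uI : uniq I by rewrite filter_uniq// iota_uniq.
have sI : ((size I)%:R <= n%:R :> R).
  by rewrite ler_nat (leq_trans (size_subseq (filter_subseq _ _)))// size_iota.
have S2 := iid_variance uI jI mxi xiL xi0.
have key w : kdev kap psi n j w <=
    S w ^+ 2 / (2 * n%:R ^+ 2 * s) + (s / 2 + 2 * (beta / n%:R) * L).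
  have -> : kdev kap psi n j w = `|n%:R^-1 * (xi (Z j w, Z j w) + S w)|.
    rewrite /kdev; congr (`| _ |).
    have -> : kmean kap psi (Z j w) = n%:R^-1 * \sum_(v < n) kmean kap psi (Z j w).
      by rewrite sumr_const card_ord -[X in _^-1 * X]mulr_natl mulKf// gt_eqF.
    rewrite -mulrBr -sumrB; congr (_ * _).
    rewrite -(big_mkord xpredT (fun v => kap (Z j w, Z v w) * psi (Z v w) - kmean kap psi (Z j w))).
    rewrite /index_iota subn0 (bigD1_seq j)/= ?iota_uniq ?mem_iota//.
    by rewrite /S /I big_filter.
  rewrite mulrDr (le_trans (ler_normD _ _))// addrC.
  have h1 : `|n%:R^-1 * xi (Z j w, Z j w)| <= 2 * (beta / n%:R) * L.
    have ni : 0 <= n%:R^-1 :> R by rewrite invr_ge0 ltW.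
    rewrite normrM (ger0_norm ni).
    by have := ler_wpM2l ni (xiL (Z j w, Z j w)); lra.
  (* Weighted arithmetic-geometric mean: [s] trades the second moment against a constant. *)
  have h2 : `|n%:R^-1 * S w| <= S w ^+ 2 / (2 * n%:R ^+ 2 * s) + s / 2.
    set x := n%:R^-1 * S w.
    have -> : S w ^+ 2 / (2 * n%:R ^+ 2 * s) = x ^+ 2 / (2 * s).
      by rewrite /x; field; rewrite !gt_eqF.
    have x2 : x ^+ 2 = `|x| ^+ 2 by rewrite real_normK ?num_real.
    rewrite x2 -subr_ge0.
    have -> : `|x| ^+ 2 / (2 * s) + s / 2 - `|x| = (`|x| - s) ^+ 2 / (2 * s).
      by field; rewrite gt_eqF.
    by rewrite mulr_ge0 ?sqr_ge0// invr_ge0 mulr_ge0// ltW.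
  by lra.
pose D := s / 2 + 2 * (beta / n%:R) * L.
have D0 : 0 <= D by rewrite addr_ge0 ?mulr_ge0 ?invr_ge0// ltW.
have c0 : 0 <= (2 * n%:R ^+ 2 * s)^-1 by rewrite invr_ge0 !mulr_ge0// ltW.
apply: (@le_trans _ _ (\int[P]_w ((2 * n%:R ^+ 2 * s)^-1%:E * (S w ^+ 2)%:E + D%:E))%E).
  apply: ge0_le_integral => //.
  - by move=> w _; rewrite lee_fin /kdev.
  - exact/measurable_EFinP/measurable_kdev.
  - apply: emeasurable_funD => //; apply: measurable_funeM.
    by apply/measurable_EFinP; exact: measurable_funX.
  by move=> w _; rewrite -EFinM -EFinD lee_fin mulrC; exact: key.
have mS2 : measurable_fun setT (fun w => (S w ^+ 2)%:E).
  by apply/measurable_EFinP; exact: measurable_funX.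
have S20 w : (0 <= (S w ^+ 2)%:E)%E by rewrite lee_fin sqr_ge0.
rewrite ge0_integralD//; last 2 first.
- by move=> w _; rewrite mule_ge0// lee_fin.
- exact: measurable_funeM.
rewrite ge0_integralZl ?lee_fin// S2 integral_cst_prob.
have sxi : ((size I)%:R%:E * \int[mu]_a \int[mu]_b ((xi (a, b)) ^+ 2)%:E <=
    (n%:R * (4 * beta * C * L ^+ 2))%:E)%E.
  rewrite EFinM; apply: lee_pmul => //.
  by apply: integral_ge0 => a _; apply: integral_ge0 => b _; rewrite lee_fin sqr_ge0.
apply: (@le_trans _ _ ((2 * n%:R ^+ 2 * s)^-1%:E * (n%:R * (4 * beta * C * L ^+ 2))%:E + D%:E)%E).
  by apply: leeD => //; apply: lee_wpmul2l; rewrite ?lee_fin.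
rewrite -EFinM -EFinD lee_fin /D; apply: le_of_eq.
by field; rewrite !gt_eqF.
Qed.

End kernel_average.

Import HBSimple.

(** An integrable [psi] is approximated in L1 by a bounded one; [kdev_le_norm]
    controls the error uniformly in [n], and [kdev_le_bounded] the rest as soon as
    the kernel bounds are negligible with respect to [n]. *)
Lemma kdev_cvg (kap : nat -> V * V -> R) (beta : nat -> R) (C : R) (psi : V -> R) :
  (forall n, measurable_fun setT (kap n)) ->
  (forall n x, `|kap n x| <= beta n) -> 0 <= C ->
  (forall n b, (\int[mu]_a `|(kap n (a, b))%:E| <= C%:E)%E) ->
  beta n / n%:R @[n --> \oo] --> 0 -> mu.-integrable setT (EFin \o psi) ->
  forall e : R, 0 < e -> \forall n \near \oo, forall j, (j < n)%N ->
    (\int[P]_w (kdev (kap n) psi n j w)%:E <= e%:E)%E.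
Proof.
move=> mkap kapb C0 kapC bcvg ipsi e e0.
have mpsi : measurable_fun setT psi by apply/measurable_EFinP; exact: measurable_int ipsi.
have [psi1 [L [L0 mpsi1 psi1L psi1e]]] : exists (psi1 : V -> R) (L : R),
    [/\ 0 <= L, measurable_fun setT psi1,
    (forall v, `|psi1 v| <= L) &
    (\int[mu]_v `|(psi v - psi1 v)%:E| <= (e / (8 * C + 4))%:E)%E].
  have e1 : 0 < e / (8 * C + 4) by rewrite divr_gt0//; lra.
  have [s sn] := integrable_approx_sfun ipsi e1.
  have [M [_ sM]] := simple_bounded s.
  exists s, (`|M| + 1); split=> //.
  by move=> v; apply: (sM (`|M| + 1)) => //; have := ler_norm M; lra.
have ipsi1 : mu.-integrable setT (EFin \o psi1) by exact: (bounded_integrable mu mpsi1 psi1L).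
have mB : measurable_fun setT (fun v => psi v - psi1 v) by exact: measurable_funB.
(* [kdev_le_bounded] with [s = e / 4] has [beta n / n] times [D - 1] as first and last terms. *)
pose D := 8 * C * L ^+ 2 / e + 2 * L + 1.
have D0 : 0 < D.
  by rewrite ltr_wpDl// addr_ge0 ?mulr_ge0 ?sqr_ge0 ?invr_ge0// ltW.
have d0 : 0 < Num.min 1 (e / 4 / D) by rewrite lt_min ltr01/= !divr_gt0.
move/cvgrPdist_le : bcvg => /(_ _ d0); apply: filterS => n; rewrite sub0r normrN => bn j jn.
have b0 : 0 <= beta n / n%:R.
  by rewrite divr_ge0// (le_trans (normr_ge0 _) (kapb n (point, point))).
have {bn} /andP[b1 bD] : (beta n / n%:R <= 1) && (beta n / n%:R <= e / 4 / D).
  by rewrite -le_min (le_trans _ bn)// ler_norm.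
have e40 : 0 < e / 4 by rewrite divr_gt0.
have h1 := kdev_le_bounded (mkap n) (kapb n) C0 (kapC n) jn mpsi1 psi1L e40.
have h2 := kdev_le_norm (mkap n) (kapb n) C0 (kapC n) jn mB.
have mk1 := measurable_kdev (mkap n) n j mpsi1.
have mk2 := measurable_kdev (mkap n) n j mB.
have k0 phi w : (0 <= (kdev (kap n) phi n j w)%:E)%E by rewrite lee_fin /kdev.
apply: (@le_trans _ _ (\int[P]_w ((kdev (kap n) psi1 n j w)%:E +
    (kdev (kap n) (fun v => psi v - psi1 v) n j w)%:E))%E).
  apply: ge0_le_integral => //.
  - by apply/measurable_EFinP; exact: measurable_kdev.
  - by apply: emeasurable_funD; exact/measurable_EFinP.
  - by move=> w _; rewrite -EFinD lee_fin; exact: (kdevB (mkap n) (kapb n)).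
rewrite ge0_integralD//; [|exact/measurable_EFinP|exact/measurable_EFinP].
have c0 : (0 <= (beta n / n%:R + 2 * C)%:E :> \bar R)%E by rewrite lee_fin; lra.
have h3 := le_trans h2 (lee_wpmul2l c0 psi1e).
apply: (le_trans (leeD h1 h3)).
rewrite -EFinM -EFinD lee_fin.
have p1 : (beta n / n%:R + 2 * C) * (e / (8 * C + 4)) <= e / 4.
  rewrite mulrA ler_pdivrMr; last by lra.
  have : (1 + 2 * C - (beta n / n%:R + 2 * C)) * e >= 0 by rewrite mulr_ge0; lra.
  by lra.
have p2 : beta n / n%:R * D <= e / 4 by rewrite -ler_pdivlMr.
have -> : 2 * (beta n / n%:R) * C * L ^+ 2 / (e / 4) + e / 4 / 2 + 2 * (beta n / n%:R) * L =
    beta n / n%:R * (D - 1) + e / 8.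
  by rewrite /D; move: (beta n / n%:R) => u; field; rewrite gt_eqF.
by lra.
Qed.

End iid.

(** * Regression functions *)

Section regression.
Context d (T : measurableType d) (R : realType) (P : probability T R) (p : nat).
Context (X : T -> 'rV[R]_p) (mX : measurable_fun setT X).

(** The positive and the negative part of [D] have the same integral on every
    event [X @^-1` B], hence also against nonnegative functions of [X]. *)
Lemma centered_orthogonal (D : T -> R) (phi : 'rV[R]_p -> R) :
  P.-integrable setT (EFin \o D) ->
  (forall B, measurable B -> \int[P]_(w in X @^-1` B) (D w)%:E = 0)%E ->
  measurable_fun setT phi ->
  P.-integrable setT (fun w => (phi (X w) * D w)%:E) ->
  (\int[P]_w (phi (X w) * D w)%:E = 0)%E.
Proof.
move=> iD D0 mphi iphiD.
have mD : measurable_fun setT D by apply/measurable_EFinP; exact: measurable_int iD.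
pose Dp w := Num.max (D w) 0; pose Dn w := Num.max (- D w) 0.
have mDp : measurable_fun setT Dp by exact: measurable_maxr.
have mDn : measurable_fun setT Dn by apply: measurable_maxr => //; exact: measurableT_comp.
have Dp0 w : 0 <= Dp w by rewrite le_max lexx orbT.
have Dn0 w : 0 <= Dn w by rewrite le_max lexx orbT.
have DE w : D w = Dp w - Dn w by rewrite /Dp /Dn /Num.max; do 2 case: ifP; lra.
have DpD w : Dp w <= `|D w| by rewrite ge_max ler_norm normr_ge0.
have DnD w : Dn w <= `|D w| by rewrite ge_max -normrN ler_norm normr_ge0.
have iDp : P.-integrable setT (EFin \o Dp).
  apply: (le_integrable measurableT _ _ iD); first exact/measurable_EFinP.
  by move=> w _; rewrite lee_fin ger0_norm.
have iDn : P.-integrable setT (EFin \o Dn).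
  apply: (le_integrable measurableT _ _ iD); first exact/measurable_EFinP.
  by move=> w _; rewrite lee_fin ger0_norm.
have sets B : measurable B ->
    (\int[P]_(w in X @^-1` B) (Dp w)%:E = \int[P]_(w in X @^-1` B) (Dn w)%:E)%E.
  move=> mB; have mXB : measurable (X @^-1` B) by apply: measurable_preimage => //; exact: mX.
  have := D0 B mB; under eq_integral do rewrite DE EFinB.
  rewrite integralB//; [|exact: (integrableS measurableT)|exact: (integrableS measurableT)].
  have fp : (\int[P]_(w in X @^-1` B) (Dp w)%:E)%E \is a fin_num.
    by apply: integrable_fin_num => //; exact: (integrableS measurableT).
  have fn : (\int[P]_(w in X @^-1` B) (Dn w)%:E)%E \is a fin_num.
    by apply: integrable_fin_num => //; exact: (integrableS measurableT).
  by move/eqP; rewrite sube_eq ?fin_num_adde_defl// add0e => /eqP.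
have main (psi : 'rV[R]_p -> R) : measurable_fun setT psi -> (forall x, 0 <= psi x) ->
    (forall x, psi x <= `|phi x|) ->
    P.-integrable setT (fun w => (psi (X w) * D w)%:E) /\
    (\int[P]_w (psi (X w) * D w)%:E = 0)%E.
  move=> mpsi psi0 psiphi.
  have mpsiX : measurable_fun setT (fun w => psi (X w)) by exact: (measurableT_comp mpsi mX).
  have bnd (E : T -> R) : measurable_fun setT E -> (forall w, `|E w| <= `|D w|) ->
      P.-integrable setT (fun w => (psi (X w) * E w)%:E).
    move=> mE ED; apply: (le_integrable measurableT _ _ iphiD).
      by apply/measurable_EFinP; exact: measurable_funM.
    by move=> w _; rewrite lee_fin !normrM ler_pM// ger0_norm.
  have ip : P.-integrable setT (fun w => (psi (X w) * Dp w)%:E).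
    by apply: bnd => // w; rewrite ger0_norm.
  have in_ : P.-integrable setT (fun w => (psi (X w) * Dn w)%:E).
    by apply: bnd => // w; rewrite ger0_norm.
  split; first exact: bnd.
  under eq_integral do rewrite DE mulrBr EFinB.
  rewrite integralB//.
  have eqd : (\int[P]_w (psi (X w) * Dp w)%:E = \int[P]_w (psi (X w) * Dn w)%:E)%E.
    apply: (eq_integral_density (mu1 := P) (mu2 := P) mX mX mDp mDn Dp0 Dn0 sets
      (phi := EFin \o psi)) => //.
    exact/measurable_EFinP.
  rewrite eqd.
  by rewrite subee//; exact: integrable_fin_num.
pose pp x := Num.max (phi x) 0; pose pn x : R := Num.max (- phi x) 0.
have [] := main pp; first exact: measurable_maxr.
- by move=> x; rewrite le_max lexx orbT.
- by move=> x; rewrite ge_max ler_norm normr_ge0.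
move=> i1 z1; have [] := main pn.
- by apply: measurable_maxr => //; exact: measurableT_comp.
- by move=> x; rewrite le_max lexx orbT.
- by move=> x; rewrite ge_max -normrN ler_norm normr_ge0.
move=> i2 z2.
rewrite (eq_integral (fun w => (pp (X w) * D w)%:E - (pn (X w) * D w)%:E)%E).
  by rewrite integralB// z1 z2 sube0.
move=> w _; rewrite -EFinB -mulrBl; congr (_ * _)%:E.
by rewrite /pp /pn /Num.max; do 2 case: ifP; lra.
Qed.

Lemma regression_mul (Q : T -> R) (g phi : 'rV[R]_p -> R) : is_regression P X Q g ->
  measurable_fun setT phi ->
  P.-integrable setT (fun w => (phi (X w) * Q w)%:E) ->
  P.-integrable setT (fun w => (phi (X w) * g (X w))%:E) ->
  (\int[P]_w (phi (X w) * Q w)%:E = \int[P]_w (phi (X w) * g (X w))%:E)%E.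
Proof.
move=> [iQ mg ig Qg] mphi i1 i2.
have iD : P.-integrable setT (EFin \o (fun w => Q w - g (X w))).
  rewrite (_ : EFin \o _ = (EFin \o Q) \- (EFin \o (g \o X)))%E; last by apply/funext.
  exact: integrableB.
have DB : P.-integrable setT (fun w => (phi (X w) * (Q w - g (X w)))%:E).
  under eq_fun do rewrite mulrBr EFinB; exact: integrableB.
have := centered_orthogonal iD _ mphi DB.
have -> : (\int[P]_w (phi (X w) * (Q w - g (X w)))%:E = \int[P]_w (phi (X w) * Q w)%:E
    - \int[P]_w (phi (X w) * g (X w))%:E)%E.
  by under eq_integral do rewrite mulrBr EFinB; rewrite integralB.
have f1 : (\int[P]_w (phi (X w) * Q w)%:E)%E \is a fin_num by exact: integrable_fin_num.
have f2 : (\int[P]_w (phi (X w) * g (X w))%:E)%E \is a fin_num by exact: integrable_fin_num.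
move=> H; have {H} : (\int[P]_w (phi (X w) * Q w)%:E - \int[P]_w (phi (X w) * g (X w))%:E = 0)%E.
  apply: H => B mB; have mXB : measurable (X @^-1` B) by apply: measurable_preimage => //; exact: mX.
  under eq_integral do rewrite EFinB.
  rewrite integralB//; [|exact: (integrableS measurableT)|exact: (integrableS measurableT)].
  rewrite Qg// subee//; apply: integrable_fin_num => //; exact: (integrableS measurableT).
by move/eqP; rewrite sube_eq ?fin_num_adde_defl// add0e => /eqP.
Qed.

(** The cross term [m (X w) * (Q w - m (X w))] of the square is centered given [X]. *)
Lemma regression_sqr (Q : T -> R) (m s2 : 'rV[R]_p -> R) :
  is_regression P X Q m -> is_regression P X (fun w => (Q w - m (X w)) ^+ 2) s2 ->
  P.-integrable setT (fun w => (Q w ^+ 2)%:E) ->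
  P.-integrable setT (fun w => (m (X w) ^+ 2)%:E) ->
  is_regression P X (fun w => Q w ^+ 2) (fun x => s2 x + m x ^+ 2).
Proof.
move=> [iQ mm im Qm] [iV ms2 is2 Vs2] iQ2 im2.
have mQ : measurable_fun setT Q by apply/measurable_EFinP; exact: measurable_int iQ.
have mmX : measurable_fun setT (fun w => m (X w)) by exact: (measurableT_comp mm mX).
have imQ : P.-integrable setT (fun w => (m (X w) * (Q w - m (X w)))%:E).
  apply: (le_integrable measurableT _ _
    (integrableD measurableT iQ2 (integrableZl measurableT 2 im2))).
    by apply/measurable_EFinP; apply: measurable_funM => //; exact: measurable_funB.
  move=> w _; rewrite /= lee_fin [leRHS]ger0_norm; last first.
    by rewrite addr_ge0 ?sqr_ge0// mulr_ge0 ?sqr_ge0.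
  move: (Q w) (m (X w)) => a b; rewrite ler_norml; apply/andP; split.
    by have := sqr_ge0 (2 * a + b); have := sqr_ge0 a; have := sqr_ge0 b; rewrite !expr2; lra.
  by have := sqr_ge0 (2 * a - b); have := sqr_ge0 a; have := sqr_ge0 b; rewrite !expr2; lra.
have E w : Q w ^+ 2 = (Q w - m (X w)) ^+ 2 + (2 * (m (X w) * (Q w - m (X w))) + m (X w) ^+ 2).
  by ring.
split=> //.
- by apply: measurable_funD => //; exact: measurable_funX.
- rewrite (_ : EFin \o _ = (EFin \o (s2 \o X)) \+ (fun w => (m (X w) ^+ 2)%:E))%E//.
  exact: integrableD.
move=> B mB; have mXB : measurable (X @^-1` B) by apply: measurable_preimage => //; exact: mX.
have S f : P.-integrable setT f -> P.-integrable (X @^-1` B) f.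
  exact: (integrableS measurableT).
under eq_integral do rewrite E EFinD EFinD.
rewrite integralD//; [|exact: S|apply: integrableD => //; apply: S => //]; last first.
  by under eq_fun do rewrite EFinM; exact: integrableZl.
rewrite integralD//; [|apply: S|exact: S]; last first.
  by under eq_fun do rewrite EFinM; exact: integrableZl.
rewrite Vs2//.
have -> : (\int[P]_(w in X @^-1` B) (2 * (m (X w) * (Q w - m (X w))))%:E = 0)%E.
  under eq_integral do rewrite EFinM.
  rewrite integralZl//; last exact: S.
  rewrite [X in (_ * X)%E](_ : _ = 0%E) ?mule0//.
  rewrite integral_mkcond.
  have patchX : (fun w => (m (X w) * (Q w - m (X w)))%:E) \_ (X @^-1` B) =
      (fun w => (m (X w) * \1_B (X w) * (Q w - m (X w)))%:E).
    apply/funext => w; rewrite patchE indicE.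
    have -> : (w \in X @^-1` B) = (X w \in B) by [].
    by case: ifP => _; rewrite ?mulr1// mulr0 mul0r.
  rewrite patchX; apply: (centered_orthogonal (D := fun w => Q w - m (X w))
    (phi := fun x => m x * \1_B x)).
  - rewrite (_ : EFin \o _ = (EFin \o Q) \- (EFin \o (m \o X)))%E; last by apply/funext.
    exact: integrableB.
  - move=> B' mB'; have mXB' : measurable (X @^-1` B').
      by apply: measurable_preimage => //; exact: mX.
    under eq_integral do rewrite EFinB.
    rewrite integralB//; [|exact: (integrableS measurableT)|exact: (integrableS measurableT)].
    by rewrite Qm// subee//; apply: integrable_fin_num => //; exact: (integrableS measurableT).
  - by apply: measurable_funM => //; exact: measurable_indic.
  - rewrite -patchX; apply: (integrable_mkcond _ mXB).1; exact: S.
rewrite add0e -integralD//; [exact: S|exact: S].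
Qed.

End regression.

(** * Consistency of kernel averages *)

Lemma density_integral d (T : measurableType d) (R : realType) (P : probability T R)
    (p : nat) (X : T -> 'rV[R]_p) (f phi : 'rV[R]_p -> R) :
  measurable_fun setT X -> is_density P X f -> measurable_fun setT phi ->
  (\int[P]_w (phi (X w))%:E = \int[rv_lebesgue R p]_x (phi x * f x)%:E)%E.
Proof.
move=> mX fX mphi; have [_ f0 _] := fX.
rewrite [LHS]integralE [RHS]integralE; congr (_ - _)%E.
- transitivity (\int[P]_w ((EFin \o phi)^\+ (X w)))%E.
    by apply: eq_integral => w _; rewrite !funeposE.
  rewrite (density_expectation mX fX)//.
  + apply: eq_integral => x _; rewrite !funeposE/= EFinM.
    by rewrite -EFin_max -EFin_max -EFinM maxr_pMl// mul0r.
  + by apply: measurable_funepos; exact/measurable_EFinP.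
- transitivity (\int[P]_w ((EFin \o phi)^\- (X w)))%E.
    by apply: eq_integral => w _; rewrite !funenegE.
  rewrite (density_expectation mX fX)//.
  + apply: eq_integral => x _; rewrite !funenegE/=.
    by rewrite -EFin_max -EFin_max -EFinM maxr_pMl// mul0r mulNr.
  + by apply: measurable_funeneg; exact/measurable_EFinP.
Qed.

Section kernel_regression.
Context d (T : measurableType d) (R : realType) (P : probability T R) (p : nat).
Notation V := (R * 'rV[R]_p)%type.
Notation lambda := (rv_lebesgue R p).
Context (Y : T -> R) (X : T -> 'rV[R]_p).
Hypothesis mY : measurable_fun setT Y.
Hypothesis mX : measurable_fun setT X.
Context (mu : probability V R) (Z : nat -> T -> V).
Hypothesis mZ : forall j, measurable_fun setT (Z j).
Hypothesis law0 : forall B, measurable B -> P ((fun w => (Y w, X w)) @^-1` B) = mu B.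
Hypothesis Zmu : forall j B, measurable B -> P (Z j @^-1` B) = mu B.
Hypothesis Zindep : forall n (B : nat -> set V), (forall j, measurable (B j)) ->
  P [set w | forall j, (j < n)%N -> B j (Z j w)] = (\prod_(j < n) P (Z j @^-1` B j))%E.
Context (k : R -> R) (b : R).
Hypothesis kc : {within `[-1, 1], continuous k}.
Hypothesis k0 : forall u, 1 < `|u| -> k u = 0.
Hypothesis kb : forall u, `|k u| <= b.
Hypothesis k1 : (\int[@lebesgue_measure R]_(u in `[(-1)%R, 1%R]) (k u)%:E = 1)%E.
Context (h : nat -> R).
Hypothesis h_gt0 : forall n, 0 < h n.
Hypothesis hcvg : h n @[n --> \oo] --> 0.
Hypothesis nhcvg : (n%:R * h n ^+ p)^-1 @[n --> \oo] --> 0.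
Context (f : 'rV[R]_p -> R) (C M : R).
Hypothesis fX : is_density P X f.
Hypothesis C_gt0 : 0 < C.
Hypothesis fC : forall x, f x <= C.
Hypothesis M_gt0 : 0 < M.
Hypothesis fM : forall x, f x != 0 -> forall i, `|x ord0 i| <= M.

Let b_ge0 : 0 <= b. Proof. exact: le_trans (kb 0). Qed.

Let mYX : measurable_fun setT (fun w => (Y w, X w)).
Proof. exact/measurable_fun_pairP. Qed.

Let mf : measurable_fun setT f. Proof. by case: fX. Qed.
Let f0 x : 0 <= f x. Proof. by case: fX. Qed.

Definition pair_kernel n (x : V * V) : R := scaled_kernel k (h n) x.1.2 x.2.2.

Lemma measurable_pair_kernel n : measurable_fun setT (pair_kernel n).
Proof.
have ms2 : measurable_fun setT (fun x : V * V => (x.1.2, x.2.2)).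
  apply/measurable_fun_pairP; split.
    exact: (measurableT_comp measurable_snd measurable_fst).
  exact: (measurableT_comp measurable_snd measurable_snd).
exact: (measurableT_comp (measurable_scaled_kernel kc k0 (h n)) ms2).
Qed.

Let hp0 n : 0 <= h n ^- p. Proof. by rewrite invr_ge0 exprn_ge0// ltW. Qed.

Lemma pair_kernel_le n x : `|pair_kernel n x| <= b ^+ p * h n ^- p.
Proof.
apply: (le_trans (scaled_kernel_le k0 kb _ _ (h_gt0 n))).
by rewrite ler_wpM2l ?exprn_ge0// ler_piMr// indicE lern1 leq_b1.
Qed.

Lemma integral_pair_kernel n c :
  (\int[mu]_a `|(pair_kernel n (a, c))%:E| <= (C * (b ^+ p * 2 ^+ p))%:E)%E.
Proof.
have mk := measurable_pair_kernel n.
rewrite -(integral_law mYX law0); last first.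
  by apply/measurableT_comp/measurable_EFinP => //; exact: (measurableT_comp mk (measurable_pair2 c)).
rewrite /pair_kernel/=.
have mk2 : measurable_fun setT (fun x => `|(scaled_kernel k (h n) x c.2)%:E|%E).
  apply/measurableT_comp/measurable_EFinP => //.
  exact: (measurableT_comp (measurable_scaled_kernel kc k0 (h n)) (measurable_pair2 c.2)).
apply: (le_trans (density_le_integral mX fX fC mk2 _)) => //.
have C0 : (0 <= C%:E)%E by rewrite lee_fin ltW.
rewrite EFinM; apply: (lee_wpmul2l C0).
apply: (@le_trans _ _ (\int[lambda]_x
    ((b ^+ p * h n ^- p)%:E * (\1_(near_rel (h n)) (c.2, x))%:E))%E).
  apply: ge0_le_integral => //.
  - apply: measurable_funeM; apply/measurable_EFinP.
    exact: (measurableT_comp (@measurable_indic_near _ _ (h n)) (measurable_pair1 c.2)).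
  move=> x _; rewrite -EFinM lee_fin near_sym -mulrA.
  exact: scaled_kernel_le.
rewrite ge0_integralZl//; last 2 first.
- apply/measurable_EFinP.
  exact: (measurableT_comp (@measurable_indic_near _ _ (h n)) (measurable_pair1 c.2)).
- by rewrite lee_fin mulr_ge0// exprn_ge0.
rewrite integral_near; last exact: ltW.
rewrite -EFinM lee_fin exprMn; apply: le_of_eq.
have : h n ^+ p != 0 by rewrite expf_neq0// gt_eqF.
by move=> hn; field.
Qed.

(** The mean absolute error splits into the deviation from the conditional mean
    given the [j]-th observation, [kdev_cvg], and the bias of that conditional
    mean, [kernel_bias_le], which involves the integrable function [r * f] only
    through its oscillation.  Both bounds are uniform in [j]. *)
Lemma kernel_regression_cvg (psi : V -> R) (r : 'rV[R]_p -> R) :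
  measurable_fun setT psi -> is_regression P X (fun w => psi (Y w, X w)) r ->
  forall e : R, 0 < e -> \forall n \near \oo, forall j, (j < n)%N ->
    (\int[P]_w `|n%:R^-1 * (\sum_(v < n) pair_kernel n (Z j w, Z v w) * psi (Z v w))
       - r (Z j w).2 * f (Z j w).2|%:E <= e%:E)%E.
Proof.
move=> mpsi rpsi e e0; have [iQ mr ir _] := rpsi.
have ipsi : mu.-integrable setT (EFin \o psi).
  apply/integrableP; split; first exact/measurable_EFinP.
  have /integrableP[_] := iQ; apply: le_lt_trans.
  rewrite -(integral_law mYX law0 (phi := fun v => `|(psi v)%:E|%E))//.
  by apply/measurableT_comp => //; exact/measurable_EFinP.
pose g x := r x * f x.
have mg : measurable_fun setT g by exact: measurable_funM.
have ig : lambda.-integrable setT (EFin \o g).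
  apply/integrableP; split; first exact/measurable_EFinP.
  have /integrableP[_] := ir; apply: le_lt_trans.
  have := density_expectation mX fX (phi := fun x => `|(r x)%:E|%E) => /= ->//.
    apply: le_of_eq; apply: eq_integral => x _.
    by rewrite normrM (ger0_norm (f0 x)).
  exact/measurable_EFinP/measurableT_comp.
have kmE n a : kmean mu (pair_kernel n) psi a =
    fine (\int[lambda]_z (scaled_kernel k (h n) a.2 z * g z)%:E)%E.
  rewrite /kmean; congr fine.
  have msk : measurable_fun setT (scaled_kernel k (h n) a.2).
    exact: (measurableT_comp (measurable_scaled_kernel kc k0 (h n)) (measurable_pair1 a.2)).
  have msX : measurable_fun setT (fun w => scaled_kernel k (h n) a.2 (X w)).
    exact: (measurableT_comp msk mX).
  have skb w : `|scaled_kernel k (h n) a.2 (X w)| <= `|b ^+ p * h n ^- p|.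
    exact: (le_trans (pair_kernel_le n (a, (Y w, X w))) (ler_norm _)).
  rewrite -(integral_law mYX law0 (phi := fun c => (pair_kernel n (a, c) * psi c)%:E)).
    rewrite /pair_kernel/= (regression_mul mX rpsi msk); first last.
    - apply: (le_integrable measurableT _ _ (integrableZl measurableT (b ^+ p * h n ^- p) ir)).
        by apply/measurable_EFinP/measurable_funM => //; exact: (measurableT_comp mr mX).
      by move=> w _; rewrite /= lee_fin normrM [leRHS]normrM ler_wpM2r.
    - apply: (le_integrable measurableT _ _ (integrableZl measurableT (b ^+ p * h n ^- p) iQ)).
        by apply/measurable_EFinP/measurable_funM => //; exact: (measurableT_comp mpsi mYX).
      by move=> w _; rewrite /= lee_fin normrM [leRHS]normrM ler_wpM2r.
    have := density_integral mX fX (phi := fun x => scaled_kernel k (h n) a.2 x * r x).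
    move=> /= ->; last exact: measurable_funM.
    by apply: eq_integral => z _; rewrite mulrA.
  apply/measurable_EFinP/measurable_funM => //.
  exact: (measurableT_comp (measurable_pair_kernel n) (measurable_pair1 a)).
have bcvg : b ^+ p * h n ^- p / n%:R @[n --> \oo] --> 0.
  rewrite (_ : 0 = b ^+ p * 0); last by rewrite mulr0.
  rewrite (_ : (fun n => _) = (fun n => b ^+ p * (n%:R * h n ^+ p)^-1)).
    by apply: cvgM => //; exact: cvg_cst.
  by apply/funext => n; rewrite invfM; ring.
have e2 : 0 < e / 2 by rewrite divr_gt0.
have e3 : 0 < e / 2 / (b ^+ p + 1) by rewrite divr_gt0// ltr_wpDl// exprn_ge0.
have CC : 0 <= C * (b ^+ p * 2 ^+ p) by rewrite mulr_ge0 ?mulr_ge0 ?exprn_ge0// ltW.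
have V1 := kdev_cvg mZ Zmu Zindep measurable_pair_kernel pair_kernel_le CC
  integral_pair_kernel bcvg ipsi e2.
have V2 := osc_vanishes_integrable mf f0 fC M_gt0 fM h_gt0 hcvg ig e3.
apply: filterS2 V1 V2 => n V1 V2 j jn.
pose G x : R := `|fine (\int[lambda]_z (scaled_kernel k (h n) x z * g z)%:E)%E - g x|.
have mG : measurable_fun setT G.
  apply: measurableT_comp => //; apply: measurable_funB => //; apply: measurableT_comp => //.
  apply: (measurable_fun_integral_pair lambda
    (F := fun xz => (scaled_kernel k (h n) xz.1 xz.2 * g xz.2)%:E)).
  apply/measurable_EFinP/measurable_funM; first exact: measurable_scaled_kernel.
  exact: (measurableT_comp mg measurable_snd).
have GE : (\int[P]_w (G (Z j w).2)%:E <= (e / 2)%:E)%E.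
  have mG2 : measurable_fun setT (fun v : V => (G v.2)%:E).
    by apply/measurable_EFinP; exact: (measurableT_comp mG measurable_snd).
  rewrite (integral_law (mZ j) (Zmu j) mG2) -(integral_law mYX law0 mG2)/=.
  have := density_expectation mX fX (phi := EFin \o G) => /= ->; last 2 first.
  - exact/measurable_EFinP.
  - by move=> x; rewrite lee_fin /G.
  under eq_integral do rewrite muleC.
  apply: (le_trans (kernel_bias_le kc k0 kb k1 mf f0 (h_gt0 n) ig)).
  have bp0 : (0 <= (b ^+ p)%:E :> \bar R)%E by rewrite lee_fin exprn_ge0.
  apply: (le_trans (lee_wpmul2l bp0 V2)).
  rewrite -EFinM lee_fin mulrCA -[leRHS]mulr1 ler_pM2l// ler_pdivrMr ?mul1r; first by lra.
  by rewrite ltr_wpDl// exprn_ge0.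
have mk := measurable_kdev mu mZ (measurable_pair_kernel n) n j mpsi.
have mGZ : measurable_fun setT (fun w => (G (Z j w).2)%:E).
  apply/measurable_EFinP; apply: (measurableT_comp mG).
  exact: (measurableT_comp measurable_snd (mZ j)).
apply: (@le_trans _ _ (\int[P]_w ((kdev mu Z (pair_kernel n) psi n j w)%:E + (G (Z j w).2)%:E))%E).
  apply: ge0_le_integral => //.
  - apply/measurable_EFinP/measurableT_comp => //; apply: measurable_funB.
      apply: measurable_funM => //; apply: measurable_sum => v; apply: measurable_funM.
        apply: (measurableT_comp (measurable_pair_kernel n)).
        by apply/measurable_fun_pairP; split; exact: mZ.
      exact: (measurableT_comp mpsi (mZ v)).
    apply: (measurableT_comp mg).
    exact: (measurableT_comp measurable_snd (mZ j)).
  - by apply: emeasurable_funD => //; exact/measurable_EFinP.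
  move=> w _; rewrite -EFinD lee_fin /kdev kmE /G.
  apply: (le_trans _ (ler_normD _ _)); apply: le_of_eq.
  by congr (`| _ |); rewrite /g; ring.
rewrite ge0_integralD//; last 3 first.
- by move=> w _; rewrite lee_fin /kdev.
- exact/measurable_EFinP.
- by move=> w _; rewrite lee_fin /G.
by rewrite [e]splitr EFinD; exact: (leeD (V1 j jn) GE).
Qed.

End kernel_regression.

(** * Transformations near the limit parameter *)

Section euclidean_norm.
Context (R : realType) (q : nat).
Implicit Types x : 'rV[R]_q.

Lemma enorm_ge0 x : 0 <= enorm x. Proof. exact: sqrtr_ge0. Qed.

Lemma coord_le_enorm x (s : 'I_q) : `|x ord0 s| <= enorm x.
Proof.
rewrite -sqrtr_sqr ler_wsqrtr// /dotp (bigD1 s)//= -expr2 lerDl sumr_ge0// => i _.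
by rewrite -expr2 sqr_ge0.
Qed.

Lemma enormZ_unit (c : R) (s : 'I_q) : 0 <= c -> enorm (c *: unit_rv s) = c.
Proof.
move=> c0; rewrite /enorm /dotp (bigD1 s)//= big1 => [|i si].
  by rewrite addr0 !mxE !eqxx mulr1 -expr2 sqrtr_sqr ger0_norm.
by rewrite !mxE eqxx (negbTE si) mulr0 mul0r.
Qed.

Lemma measurable_sqrtr : measurable_fun setT (@Num.sqrt R).
Proof. by apply: nondecreasing_measurable => // x y; exact: ler_wsqrtr. Qed.

Lemma measurable_enorm d (T : measurableType d) (u : T -> 'rV[R]_q) :
  measurable_fun setT u -> measurable_fun setT (fun w => enorm (u w)).
Proof.
move=> mu; apply: (measurableT_comp measurable_sqrtr).
by apply: measurable_sum => i; apply: measurable_funM; exact: measurable_fun_coord1.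
Qed.

End euclidean_norm.

Section monotone_family.
Context (R : realType) (I : Type) (A : set I) (F : I -> R -> R) (F0 : R -> R).
Hypothesis Fnd : forall i, A i -> nondecreasing_fun (F i).
Hypothesis F0nd : nondecreasing_fun F0.

Definition family_deviation (y : R) : \bar R :=
  ereal_sup [set `|F i y - F0 y|%:E | i in A].

(** The supremum may range over uncountably many indices.  It is measurable
    since for each threshold [r] the points [y] such that some [F i y] exceeds
    [r] form an interval; a rational [r] separates [F i y] from [F0 y]. *)
Lemma measurable_family_deviation : measurable_fun setT family_deviation.
Proof.
apply: (measurability _ (ErealGenOInfty.measurableE R)) => /= _ [_ [c ->] <-].
rewrite setTI.
pose U (r : rat) := [set y | F0 y < ratr r] `&` [set y | exists2 i, A i & ratr r + c < F i y].
pose L (r : rat) := [set y | ratr r < F0 y] `&` [set y | exists2 i, A i & F i y < ratr r - c].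
rewrite (_ : _ @^-1` _ = (\bigcup_r U r) `|` (\bigcup_r L r)); last first.
  apply/seteqP; split=> y /=.
    rewrite in_itv/= andbT /family_deviation => /ereal_sup_gt[_ [i Ai <-]].
    rewrite lte_fin ltr_normr => /orP[cF|cF].
      have /rat_in_itvoo[r] : F0 y < F i y - c by lra.
      by rewrite in_itv/= => /andP[? ?]; left; exists r => //; split=> //=; exists i => //; lra.
    have /rat_in_itvoo[r] : F i y + c < F0 y by lra.
    by rewrite in_itv/= => /andP[? ?]; right; exists r => //; split=> //=; exists i => //; lra.
  rewrite in_itv/= andbT => -[[r _ [/= h [i Ai h']]]|[r _ [/= h [i Ai h']]]].
    apply: (@lt_le_trans _ _ `|F i y - F0 y|%:E); last by apply: ereal_sup_ubound; exists i.
    by rewrite lte_fin (lt_le_trans _ (ler_norm _))//; lra.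
  apply: (@lt_le_trans _ _ `|F i y - F0 y|%:E); last by apply: ereal_sup_ubound; exists i.
  by rewrite lte_fin distrC (lt_le_trans _ (ler_norm _))//; lra.
apply: measurableU; apply: bigcupT_measurable_rat => r; apply: measurableI;
  apply: is_interval_measurable => s t /=.
- by move=> _ ft u /andP[_ ut]; exact: le_lt_trans (F0nd ut) ft.
- move=> [i Ai fs] _ u /andP[su _]; exists i => //; exact: lt_le_trans fs (Fnd Ai su).
- by move=> fs _ u /andP[su _]; exact: lt_le_trans fs (F0nd su).
- move=> _ [i Ai ft] u /andP[_ ut]; exists i => //; exact: le_lt_trans (Fnd Ai ut) ft.
Qed.

End monotone_family.

Section square_integrable.
Context d (T : measurableType d) (R : realType) (P : probability T R).

Definition L2 (g : T -> R) : Prop :=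
  measurable_fun setT g /\ (\int[P]_w (g w ^+ 2)%:E < +oo)%E.

Lemma L2D (f g : T -> R) : L2 f -> L2 g -> L2 (fun w => f w + g w).
Proof.
move=> [mf f2] [mg g2]; split; first exact: measurable_funD.
have mf2 : measurable_fun setT (fun w => (f w ^+ 2)%:E) by exact/measurable_EFinP/measurable_funX.
have mg2 : measurable_fun setT (fun w => (g w ^+ 2)%:E) by exact/measurable_EFinP/measurable_funX.
apply: (@le_lt_trans _ _ (\int[P]_w (2%:E * (f w ^+ 2)%:E + 2%:E * (g w ^+ 2)%:E))%E).
  apply: ge0_le_integral => //.
  - by move=> w _; rewrite lee_fin sqr_ge0.
  - exact/measurable_EFinP/measurable_funX/measurable_funD.
  - by apply: emeasurable_funD; exact: measurable_funeM.
  - by move=> w _; rewrite -!EFinM -EFinD lee_fin; have := sqr_ge0 (f w - g w);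
      rewrite sqrrB sqrrD; lra.
rewrite ge0_integralD//; last 4 first.
- by move=> w _; rewrite mule_ge0// lee_fin ?sqr_ge0.
- exact: measurable_funeM.
- by move=> w _; rewrite mule_ge0// lee_fin ?sqr_ge0.
- exact: measurable_funeM.
rewrite !ge0_integralZl//; try by move=> w _; rewrite lee_fin sqr_ge0.
by rewrite lte_add_pinfty// lte_mul_pinfty.
Qed.

Lemma L2_le (f g : T -> R) : measurable_fun setT f -> L2 g ->
  {ae P, forall w, `|f w| <= `|g w|} -> L2 f.
Proof.
move=> mf [mg g2] fg; split=> //; apply: le_lt_trans g2.
apply: ae_ge0_le_integral => //.
- by move=> w _; rewrite lee_fin sqr_ge0.
- exact/measurable_EFinP/measurable_funX.
- by move=> w _; rewrite lee_fin sqr_ge0.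
- exact/measurable_EFinP/measurable_funX.
apply: filterS fg => w fg _; rewrite lee_fin -[f w ^+ 2]real_normK ?num_real//.
by rewrite -[g w ^+ 2]real_normK ?num_real// lerXn2r.
Qed.

Lemma L2Z (c : R) (f : T -> R) : L2 f -> L2 (fun w => c * f w).
Proof.
move=> [mf f2]; split; first exact: measurable_funM.
under eq_integral do rewrite exprMn EFinM.
rewrite ge0_integralZl//; last 3 first.
- exact/measurable_EFinP/measurable_funX.
- by move=> w _; rewrite lee_fin sqr_ge0.
- by rewrite lee_fin sqr_ge0.
by rewrite lte_mul_pinfty// lee_fin sqr_ge0.
Qed.

Lemma L2_norm (f : T -> R) : L2 f -> L2 (fun w => `|f w|).
Proof.
move=> f2; have [mf _] := f2; apply: (L2_le _ f2); first exact: measurableT_comp.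
by apply: aeW => w; rewrite normr_id.
Qed.

Lemma L2_sum (J : Type) (s : seq J) (f : J -> T -> R) :
  (forall j, L2 (f j)) -> L2 (fun w => \sum_(j <- s) f j w).
Proof.
move=> fL; elim: s => [|j s IHs].
  under eq_fun do rewrite big_nil; split; first exact: measurable_cst.
  by rewrite integral0_eq// => w _; rewrite expr0n.
by under eq_fun do rewrite big_cons; exact: L2D.
Qed.

End square_integrable.

Section envelope.
Context d (T : measurableType d) (R : realType) (P : probability T R) (p q : nat).
Context (Y : T -> R) (X : T -> 'rV[R]_p).
Hypothesis mY : measurable_fun setT Y.
Context (Theta : set 'rV[R]_q) (Tr : 'rV[R]_q -> R -> R).
Context (m : 'rV[R]_q -> 'rV[R]_p -> R) (th0 : 'rV[R]_q).
Hypothesis th0_in : Theta th0.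
Hypothesis diff : differentiability_assumption P Y X Theta Tr m th0.

Let Tr_nd th : Theta th -> nondecreasing_fun (Tr th).
Proof.
have [[Trlt _ _] _] := diff => Tth x y; rewrite le_eqVlt => /predU1P[->//|xy].
by apply/ltW; exact: Trlt.
Qed.

Lemma measurable_transformation th : Theta th -> measurable_fun setT (Tr th).
Proof. by move=> Tth; apply: nondecreasing_measurable => //; exact: Tr_nd. Qed.

Lemma transformation_L2 th : Theta th -> L2 P (fun w => Tr th (Y w)).
Proof.
have [_ [dT [dm [b [xi [delta4 [_ _ _ _ TL2]]]]]]] := diff.
move=> Tth; split; first exact: (measurableT_comp (measurable_transformation Tth) mY).
by have := TL2 _ Tth; rewrite unlock.
Qed.

(** The expansion at [th0] bounds the increments by the partial derivatives and
    the remainder factor.  The partial derivatives are square integrable because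
    a move along one coordinate of the parameter expresses them through the
    remainder factor and transformed responses, which have second moments. *)
Lemma transformation_lipschitz : exists (r : R) (G : T -> R),
  [/\ 0 < r, r <= 1, L2 P G, forall w, 0 <= G w & {ae P, forall w, forall th, Theta th ->
    enorm (th - th0) <= r -> `|Tr th (Y w) - Tr th0 (Y w)| <= enorm (th - th0) * G w}].
Proof.
have [[_ oTheta _] [dT [dm [b [xi [delta4 [[mdT _] [xi0 d40 Texp] [mb b2 _] _ TL2]]]]]]] := diff.
have mdTY s : measurable_fun setT (fun w => dT s (Y w)).
  exact: (measurableT_comp (mdT s) mY).
have bL2 : L2 P (fun w => b (Y w)).
  by split; [exact: (measurableT_comp mb mY)|move: b2; rewrite unlock].
pose r := Num.min 1 xi.
have r0 : 0 < r by rewrite lt_min ltr01.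
have r1 : r <= 1 by rewrite ge_min lexx.
have rxi : r <= xi by rewrite ge_min lexx orbT.
have powle x : 0 <= x -> x <= r -> x `^ (1 + delta4) <= x.
  rewrite le_eqVlt => /predU1P[<-|x0 xr]; first by rewrite powR0// gt_eqF// addr_gt0.
  rewrite -[leRHS](powRr1 (ltW x0)); apply: ger_powR; first by rewrite x0 (le_trans xr).
  by rewrite lerDl ltW.
have dTL2 s : L2 P (fun w => dT s (Y w)).
  have /nbhs_ballP[e /= e0 eT] : nbhs th0 Theta by exact: open_nbhs_nbhs.
  pose c := Num.min (e / 2) r.
  have c0 : 0 < c by rewrite lt_min divr_gt0.
  have cr : c <= r by rewrite ge_min lexx orbT.
  have ce : c < e.
    have : c <= e / 2 by rewrite ge_min lexx.
    by have : 0 < e by []; lra.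
  pose th := th0 + c *: unit_rv s.
  have Tth : Theta th.
    apply: eT; apply: ball_rowP => // i; rewrite /th !mxE opprD addNKr normrN.
    by rewrite normrM gtr0_norm// eqxx/=; case: eqP => _; rewrite ?normr1 ?normr0 ?mulr1 ?mulr0.
  have thE : th - th0 = c *: unit_rv s by rewrite /th addrC addKr.
  have eth : enorm (th - th0) = c by rewrite thE enormZ_unit// ltW.
  have GL2 : L2 P (fun w => c^-1 * (`|Tr th (Y w)| + (`|Tr th0 (Y w)| + `|b (Y w)|))).
    by apply: L2Z; apply: L2D; [|apply: L2D]; apply: L2_norm => //; exact: transformation_L2.
  apply: (L2_le (mdTY s) GL2); apply: filterS Texp => w /(_ th Tth).
  rewrite eth => /(_ (le_trans cr rxi)).
  have -> : \sum_(s' < q) (th ord0 s' - th0 ord0 s') * dT s' (Y w) = c * dT s (Y w).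
    rewrite (bigD1 s)//= big1 ?addr0 => [|i si].
      by have := congr1 (fun u : 'rV_q => u ord0 s) thE; rewrite !mxE !eqxx mulr1 => ->.
    have := congr1 (fun u : 'rV_q => u ord0 i) thE; rewrite !mxE eqxx (negbTE si) mulr0 => ->.
    by rewrite mul0r.
  move=> le1; rewrite [leRHS]ger0_norm; last first.
    by apply: mulr_ge0; [rewrite invr_ge0 ltW|rewrite !addr_ge0].
  rewrite ler_pdivlMl// -{1}(gtr0_norm c0) -normrM.
  have cp := powle _ (ltW c0) cr.
  have le2 : b (Y w) * c `^ (1 + delta4) <= `|b (Y w)|.
    apply: (@le_trans _ _ (`|b (Y w)| * c `^ (1 + delta4))).
      by rewrite ler_wpM2r ?powR_ge0// ler_norm.
    by rewrite ler_piMr// (le_trans cp)// (le_trans cr).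
  move: le1 le2; move: (c * _) => u; rewrite ler_norml => /andP[? ?] ?.
  have := ler_norm (Tr th (Y w)); have := ler_norm (Tr th0 (Y w)).
  have := ler_norm (- Tr th (Y w)); have := ler_norm (- Tr th0 (Y w)).
  by rewrite !normrN ler_norml => *; apply/andP; split; lra.
exists r, (fun w => \sum_s `|dT s (Y w)| + `|b (Y w)|); split=> //.
- apply: L2D; last exact: L2_norm.
  by apply: L2_sum => s; exact: L2_norm.
- by move=> w; rewrite addr_ge0// sumr_ge0.
apply: filterS Texp => w Texp th Tth thr.
have := Texp th Tth (le_trans thr rxi).
set x := enorm _; have x0 : 0 <= x by exact: enorm_ge0.
have xp := powle _ x0 thr.
have le2 : b (Y w) * x `^ (1 + delta4) <= x * `|b (Y w)|.
  apply: (@le_trans _ _ (`|b (Y w)| * x `^ (1 + delta4))).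
    by rewrite ler_wpM2r ?powR_ge0// ler_norm.
  by rewrite mulrC ler_wpM2r.
set S := \sum_(s < q) _.
have le3 : `|S| <= x * \sum_s `|dT s (Y w)|.
  rewrite mulr_sumr (le_trans (ler_norm_sum _ _ _))// ler_sum// => s _.
  rewrite normrM ler_wpM2r//; have := coord_le_enorm (th - th0) s.
  by rewrite !mxE.
move: le2 le3; rewrite mulrDr; move: (x * _) (x * _) => u v.
rewrite !ler_norml => h1 /andP[? ?] /andP[? ?]; apply/andP; split; lra.
Qed.

(** A measurable envelope is needed because the almost sure bound on the
    deviations holds for the generic response [Y]; through the envelope it
    becomes a property of the law of [Y] and passes to the observations. *)
Lemma transformation_envelope (eta : R) : 0 < eta ->
  exists (delta : R) (O : R -> R) (N : set R),
  [/\ 0 < delta, measurable_fun setT O /\ (forall y, 0 <= O y),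
    measurable N /\ P (Y @^-1` N) = 0%E,
    forall y, ~ N y -> forall th, Theta th -> enorm (th - th0) <= delta ->
      `|Tr th y - Tr th0 y| <= O y &
    (\int[P]_w (O (Y w) + (O (Y w) ^+ 2 + 2 * `|Tr th0 (Y w)| * O (Y w)))%:E <= eta%:E)%E].
Proof.
move=> eta0; have [r [G [r0 r1 [mG G2] G0 lip]]] := transformation_lipschitz.
have [mT0 T2] := transformation_L2 th0_in.
pose H w := 1 + 3 * G w ^+ 2 + Tr th0 (Y w) ^+ 2.
have mH : measurable_fun setT (fun w => (H w)%:E).
  apply/measurable_EFinP; apply: measurable_funD; last exact: measurable_funX.
  by apply: measurable_funD => //; apply: measurable_funM => //; exact: measurable_funX.
have H0 w : 0 <= H w by have := sqr_ge0 (G w); have := sqr_ge0 (Tr th0 (Y w)); rewrite /H; lra.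
have Hoo : (\int[P]_w (H w)%:E < +oo)%E.
  have mG2 : measurable_fun setT (fun w => (G w ^+ 2)%:E) by exact/measurable_EFinP/measurable_funX.
  have mT2 : measurable_fun setT (fun w => (Tr th0 (Y w) ^+ 2)%:E) by exact/measurable_EFinP/measurable_funX.
  rewrite (eq_integral (fun w => 1%:E + 3%:E * (G w ^+ 2)%:E + (Tr th0 (Y w) ^+ 2)%:E)%E); last first.
    by move=> w _; rewrite -EFinM -!EFinD.
  have G20 w : (0 <= (G w ^+ 2)%:E)%E by rewrite lee_fin sqr_ge0.
  have T20 w : (0 <= (Tr th0 (Y w) ^+ 2)%:E)%E by rewrite lee_fin sqr_ge0.
  have G30 w : (0 <= 3%:E * (G w ^+ 2)%:E)%E by rewrite mule_ge0.
  rewrite ge0_integralD//; last 2 first.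
  - by move=> w _; rewrite adde_ge0.
  - by apply: emeasurable_funD => //; exact: measurable_funeM.
  rewrite ge0_integralD//; last exact: measurable_funeM.
  rewrite integral_cst_prob ge0_integralZl//.
  apply: lte_add_pinfty => //; apply: lte_add_pinfty; first exact: ltry.
  exact: lte_mul_pinfty.
pose K := fine (\int[P]_w (H w)%:E).
have KE : (\int[P]_w (H w)%:E = K%:E)%E.
  rewrite fineK// ge0_fin_numE//; apply: integral_ge0 => w _.
  by rewrite lee_fin.
have K0 : 0 <= K by apply/fine_ge0/integral_ge0 => w _; rewrite lee_fin.
pose delta := Num.min r (eta / (K + 1)).
have d0 : 0 < delta by rewrite lt_min r0 divr_gt0// ltr_wpDl.
have dr : delta <= r by rewrite ge_min lexx.
have deta : delta * K <= eta.
  apply: (@le_trans _ _ (eta / (K + 1) * K)).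
    by rewrite ler_wpM2r// ge_min lexx orbT.
  by rewrite mulrAC ler_pdivrMr ?ltr_wpDl// ler_pM2l// lerDl.
pose A := [set th | Theta th /\ enorm (th - th0) <= delta].
pose D := family_deviation A Tr (Tr th0).
have mD : measurable_fun setT D.
  by apply: measurable_family_deviation => [th [Tth _]|]; exact: Tr_nd.
have D0 y : (0 <= D y)%E.
  apply: ereal_sup_ubound; exists th0; last by rewrite subrr normr0.
  by split=> //; rewrite subrr /enorm /dotp big1 ?sqrtr0 ?ltW// => i _; rewrite mxE mul0r.
have DG : {ae P, forall w, (D (Y w) <= (delta * G w)%:E)%E}.
  apply: filterS lip => w lip; apply: ge_ereal_sup => _ [th [Tth thd] <-].
  rewrite lee_fin (le_trans (lip th Tth (le_trans thd dr)))//.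
  by rewrite ler_wpM2r.
pose N := [set y | D y = +oo%E].
have mN : measurable N.
  by rewrite -[X in measurable X]setTI; exact: (mD measurableT [set +oo%E] (emeasurable_set1 _)).
exists delta, (fine \o D), N; split=> //.
- split; first exact: measurableT_comp.
  by move=> y; rewrite /= fine_ge0.
- split=> //; apply/negligibleP.
    by apply: measurable_preimage => //; exact: mY.
  apply: negligibleS DG => w /= DY.
  by rewrite (DY : D (Y w) = +oo%E) leye_eq.
- move=> y Ny th Tth thd; rewrite -lee_fin /= fineK.
    by apply: ereal_sup_ubound; exists th.
  by rewrite ge0_fin_numE// ltey; apply/eqP.
have mO : measurable_fun setT (fun w => fine (D (Y w))).
  by apply: measurableT_comp => //; exact: (measurableT_comp mD mY).
apply: (@le_trans _ _ (\int[P]_w (delta%:E * (H w)%:E))%E).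
  apply: ae_ge0_le_integral => //.
  - by move=> w _; rewrite lee_fin !addr_ge0 ?mulr_ge0 ?fine_ge0 ?sqr_ge0.
  - apply/measurable_EFinP/measurable_funD => //; apply: measurable_funD.
      exact: measurable_funX.
    by apply: measurable_funM => //; apply: measurable_funM => //; exact: measurableT_comp.
  - by move=> w _; apply: mule_ge0; rewrite lee_fin ?H0// ltW.
  - exact: measurable_funeM.
  apply: filterS DG => w DG _ /=; rewrite -EFinM lee_fin.
  have {DG} : fine (D (Y w)) <= delta * G w.
    by rewrite -lee_fin fineK// ge0_fin_numE// (le_lt_trans DG)// ltry.
  have : 0 <= fine (D (Y w)) by rewrite fine_ge0.
  move: (fine _) => o o0 oG; rewrite /H.
  have t0 := normr_ge0 (Tr th0 (Y w)).
  have -> : Tr th0 (Y w) ^+ 2 = `|Tr th0 (Y w)| ^+ 2 by rewrite real_normK ?num_real.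
  move: `|_| t0 => t t0; have g0 := G0 w; move: (G w) g0 oG => g g0 oG.
  have h1 : o ^+ 2 <= delta * g ^+ 2.
    rewrite expr2 (le_trans (ler_pM o0 o0 oG oG))//.
    rewrite (_ : delta * g * (delta * g) = delta * (delta * g ^+ 2)); last by ring.
    by rewrite (ler_wpM2l (ltW d0))// ler_piMl ?sqr_ge0// (le_trans dr).
  have h2 : 2 * t * o <= delta * (t ^+ 2 + g ^+ 2).
    apply: (le_trans (ler_wpM2l _ oG)); first by rewrite mulr_ge0.
    rewrite (_ : 2 * t * (delta * g) = delta * (2 * t * g)); last by ring.
    rewrite (ler_wpM2l (ltW d0))//; have := sqr_ge0 (t - g); rewrite sqrrB; lra.
  have h3 : o <= delta * (1 + g ^+ 2).
    apply: (le_trans oG); rewrite (ler_wpM2l (ltW d0))//.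
    by have := sqr_ge0 (1 - g); have := sqr_ge0 g; rewrite sqrrB; lra.
  by have := ltW d0; lra.
have -> : (\int[P]_w (delta%:E * (H w)%:E) = delta%:E * \int[P]_w (H w)%:E)%E.
  by apply: ge0_integralZl_EFin => //; [move=> w _; rewrite lee_fin|exact: ltW].
by rewrite KE -EFinM lee_fin.
Qed.

End envelope.

(** * Residuals *)

Section studentized.
Context (R : realType).

(** The studentized residual is a locally Lipschitz function of the kernel
    averages [F], [A], [B] estimating [f], [m f], [(s + m ^+ 2) f], as long as
    [f] and [s] stay away from [0].  The power [7] is the crude Lipschitz
    constant that the bounds by [M] add up to. *)
Lemma studentized_modulus (M eta : R) : 1 <= M -> 0 < eta ->
  exists2 tau : R, 0 < tau & forall t f m s t' F A B : R,
  M^-1 <= f <= M -> `|m| <= M -> M^-1 <= s <= M -> `|t| <= M ->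
  `|F - f| <= tau -> `|A - m * f| <= tau -> `|B - (s + m ^+ 2) * f| <= tau ->
  `|t' - t| <= tau ->
  0 < F /\
  `|(t' - F^-1 * A) / Num.sqrt (F^-1 * B - (F^-1 * A) ^+ 2) - (t - m) / Num.sqrt s| <= eta.
Proof.
move=> M1 eta0; have M0 : 0 < M by lra.
pose e := Num.min 1 eta.
have e0 : 0 < e by rewrite lt_min ltr01.
have e1 : e <= 1 by rewrite ge_min lexx.
have eeta : e <= eta by rewrite ge_min lexx orbT.
have Mn n : 1 <= M ^+ n by rewrite exprn_ege1.
have MnS n : M ^+ n <= M ^+ n.+1 by rewrite exprS ler_peMl// (le_trans _ (Mn n)).
pose tau := e / (82 * M ^+ 7).
have tau0 : 0 < tau by rewrite divr_gt0// mulr_gt0// (lt_le_trans _ (Mn _)).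
have tauE : 82 * M ^+ 7 * tau = e.
  by rewrite /tau mulrC divfK// gt_eqF// mulr_gt0// (lt_le_trans _ (Mn _)).
clearbody tau; exists tau => // t f m s t' F A B /andP[f1 f2] mM /andP[s1 s2] tM dF dA dB dt.
have tauM n : (n <= 7)%N -> M ^+ n * tau <= e / 82.
  move=> n7; rewrite ler_pdivlMr// -tauE [leRHS](_ : _ = M ^+ 7 * tau * 82); last by ring.
  by rewrite ler_pM2r// ler_pM2r// ler_weXn2l.
have iM : M^-1 * M = 1 by rewrite mulVf// gt_eqF.
have iM0 : 0 < M^-1 by rewrite invr_gt0.
have iM1 : M^-1 <= 1 by rewrite invf_le1.
have tauiM : tau <= M^-1 / 82.
  have := tauM 1%N isT; rewrite expr1 => h.
  rewrite -(ler_pM2l M0); apply: (le_trans h); rewrite mulrA (mulrC M) iM; lra.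
have F1 : M^-1 / 2 <= F by move: dF; rewrite ler_norml => /andP[? _]; lra.
have F0 : 0 < F by rewrite (lt_le_trans _ F1)// divr_gt0.
split=> //; apply: le_trans eeta.
have iF : F^-1 <= 2 * M.
  rewrite -(ler_pM2l F0) mulfV ?gt_eqF//.
  have := ler_wpM2r (ltW M0) F1; rewrite mulrAC iM; lra.
have iF0 : 0 < F^-1 by rewrite invr_gt0.
have t4 := tauM 4%N isT; have t3 := tauM 3%N isT; have t2 := tauM 2%N isT.
have t7 := tauM 7%N isT; have t1 := tauM 1%N isT.
have u_le : `|F^-1 * A - m| <= 4 * (M ^+ 2 * tau).
  rewrite (_ : F^-1 * A - m = F^-1 * ((A - m * f) - m * (F - f))); last first.
    by field; rewrite gt_eqF.
  rewrite normrM (gtr0_norm iF0).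
  apply: (@le_trans _ _ (2 * M * (tau + M * tau))).
    apply: ler_pM => //; first exact: ltW.
    rewrite (le_trans (ler_normB _ _))// lerD// normrM ler_pM//.
  have : M * tau <= M ^+ 2 * tau by rewrite ler_pM2r// -[leLHS]expr1 MnS.
  rewrite (_ : 2 * M * (tau + M * tau) = 2 * (M * tau) + 2 * (M ^+ 2 * tau)); first by lra.
  by ring.
have v_le : `|F^-1 * B - (s + m ^+ 2)| <= 6 * (M ^+ 3 * tau).
  rewrite (_ : F^-1 * B - _ = F^-1 * ((B - (s + m ^+ 2) * f) - (s + m ^+ 2) * (F - f))); last first.
    by field; rewrite gt_eqF.
  rewrite normrM (gtr0_norm iF0).
  have sm : `|s + m ^+ 2| <= M + M ^+ 2.
    rewrite (le_trans (ler_normD _ _))// lerD//.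
      by rewrite ger0_norm// (le_trans _ s1)// ltW.
    by rewrite normrX lerXn2r// nnegrE// ltW.
  apply: (@le_trans _ _ (2 * M * (tau + (M + M ^+ 2) * tau))).
    apply: ler_pM => //; first exact: ltW.
    by rewrite (le_trans (ler_normB _ _))// lerD// normrM ler_pM.
  have : M * tau <= M ^+ 3 * tau by rewrite ler_pM2r// (le_trans _ (MnS 2%N))// -[leLHS]expr1 MnS.
  have : M ^+ 2 * tau <= M ^+ 3 * tau by rewrite ler_pM2r// MnS.
  rewrite (_ : 2 * M * _ = 2 * (M * tau) + 2 * (M ^+ 2 * tau) + 2 * (M ^+ 3 * tau)); last by ring.
  by lra.
move: u_le v_le; set a := F^-1 * A; set b := F^-1 * B => u_le v_le.
have aM : `|a| <= M + 1.
  rewrite -(subrK m a) (le_trans (ler_normD _ _))//; lra.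
have S_le : `|(b - a ^+ 2) - s| <= 18 * (M ^+ 3 * tau).
  rewrite (_ : _ - s = (b - (s + m ^+ 2)) - (a - m) * (a + m)); last by ring.
  rewrite (le_trans (ler_normB _ _))// normrM.
  have am : `|a + m| <= 3 * M by rewrite (le_trans (ler_normD _ _))//; lra.
  have := ler_pM (normr_ge0 _) (normr_ge0 _) u_le am.
  rewrite (_ : 4 * (M ^+ 2 * tau) * (3 * M) = 12 * (M ^+ 3 * tau)); last by ring.
  by lra.
move: S_le; set S := b - a ^+ 2 => S_le.
have t3' : M ^+ 3 * tau <= M^-1 / 82.
  rewrite -(ler_pM2l M0) (_ : M * (M ^+ 3 * tau) = M ^+ 4 * tau); last by ring.
  by apply: (le_trans t4); rewrite mulrA (mulrC M) iM; lra.
have S1 : M^-1 / 2 <= S by move: S_le; rewrite ler_norml => /andP[? _]; lra.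
have iM2 : M^-1 ^+ 2 <= M^-1 by rewrite expr2 ler_piMr// ltW.
have sq_ge (c z : R) : 0 < c -> c ^+ 2 <= z -> c <= Num.sqrt z.
  by move=> c0 cz; rewrite -(ger0_norm (ltW c0)) -sqrtr_sqr; exact: ler_wsqrtr.
have x1 : M^-1 / 2 <= Num.sqrt S.
  apply: sq_ge; first by rewrite divr_gt0.
  apply: le_trans S1; rewrite (_ : (M^-1 / 2) ^+ 2 = M^-1 ^+ 2 / 4); first by lra.
  by rewrite expr_div_n -natrX.
have y1 : M^-1 <= Num.sqrt s by apply: sq_ge => //; exact: le_trans s1.
have x2 : Num.sqrt S ^+ 2 = S by rewrite sqr_sqrtr// (le_trans _ S1)// ltW// divr_gt0.
have y2 : Num.sqrt s ^+ 2 = s by rewrite sqr_sqrtr// (le_trans _ s1)// ltW.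
move: x1 y1 x2 y2; move: (Num.sqrt S) (Num.sqrt s) => x y x1 y1 x2 y2.
have x0 : 0 < x by rewrite (lt_le_trans _ x1)// divr_gt0.
have y0 : 0 < y by rewrite (lt_le_trans _ y1).
have ix : x^-1 <= 2 * M.
  rewrite -(ler_pM2l x0) mulfV ?gt_eqF//.
  have := ler_wpM2r (ltW M0) x1; rewrite mulrAC iM; lra.
have iy : y^-1 <= M.
  rewrite -(ler_pM2l y0) mulfV ?gt_eqF//.
  by have := ler_wpM2r (ltW M0) y1; rewrite iM.
have ix0 : 0 < x^-1 by rewrite invr_gt0.
have iy0 : 0 < y^-1 by rewrite invr_gt0.
have xy_le : `|y - x| <= 18 * (M ^+ 4 * tau).
  rewrite (_ : y - x = (s - S) * (x + y)^-1); last first.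
    by rewrite -x2 -y2; field; rewrite gt_eqF// addr_gt0.
  have ixy : (x + y)^-1 <= M.
    by apply: le_trans iy; rewrite lef_pV2 ?posrE ?addr_gt0// lerDr ltW.
  have ixy0 : 0 <= (x + y)^-1 by rewrite invr_ge0 ltW// addr_gt0.
  rewrite normrM distrC (ger0_norm ixy0).
  apply: (le_trans (ler_pM (normr_ge0 _) ixy0 S_le ixy)).
  by apply: le_of_eq; ring.
have tm : `|t - m| <= 2 * M by rewrite (le_trans (ler_normB _ _))//; lra.
have dtm : `|(t' - a) - (t - m)| <= tau + 4 * (M ^+ 2 * tau).
  rewrite (_ : _ - _ = (t' - t) - (a - m)); last by ring.
  by rewrite (le_trans (ler_normB _ _))// lerD.
rewrite (_ : _ - _ = ((t' - a) - (t - m)) * x^-1 + (t - m) * (y - x) * (x^-1 * y^-1)); last first.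
  by field; rewrite !gt_eqF.
rewrite (le_trans (ler_normD _ _))// !normrM (gtr0_norm ix0) (gtr0_norm iy0).
have l1 := ler_pM (normr_ge0 _) (ltW ix0) dtm ix.
have l2 := ler_pM (normr_ge0 _) (normr_ge0 _) tm xy_le.
have l3 := ler_pM (ltW ix0) (ltW iy0) ix iy.
have l4 := ler_pM (mulr_ge0 (normr_ge0 _) (normr_ge0 _)) (mulr_ge0 (ltW ix0) (ltW iy0)) l2 l3.
apply: (le_trans (lerD l1 l4)).
have Mle n : (n <= 7)%N -> M ^+ n * tau <= M ^+ 7 * tau.
  by move=> n7; rewrite ler_pM2r// ler_weXn2l.
have := Mle 1%N isT; have := Mle 3%N isT.
rewrite expr1 -tauE.
rewrite (_ : (tau + _) * _ = 2 * (M * tau) + 8 * (M ^+ 3 * tau)); last by ring.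
rewrite (_ : 2 * M * _ * _ = 72 * (M ^+ 7 * tau)); last by ring.
by lra.
Qed.

End studentized.

Section residual_averages.
Context (R : realType) (p q : nat) (k : R -> R) (h : nat -> R) (Tr : 'rV[R]_q -> R -> R).
Notation V := (R * 'rV[R]_p)%type.

Definition kernel_mean n (z : nat -> V) (psi : V -> R) (j : nat) : R :=
  n%:R^-1 * \sum_(v < n) pair_kernel k h n (z j, z v) * psi (z v).

Lemma kernel_sumE n (z : nat -> V) (psi : V -> R) j :
  kernel_sum k h [tuple z i | i < n] (fun v => psi (z v)) (z j).2 = kernel_mean n z psi j.
Proof.
rewrite /kernel_sum /kernel_mean invfM -mulrA mulr_sumr; congr (_ * _).
apply: eq_bigr => v _; rewrite mulrA /pair_kernel /scaled_kernel/=.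
by rewrite tnth_mktuple.
Qed.

(** The estimated variance is an average of squares around the estimated mean,
    hence the second moment minus the square of that mean. *)
Lemma residualE n (z : nat -> V) th (j : 'I_n) :
  let F := kernel_mean n z (fun=> 1) j in
  let A := kernel_mean n z (fun v => Tr th v.1) j in
  let B := kernel_mean n z (fun v => Tr th v.1 ^+ 2) j in
  F != 0 ->
  residual k h Tr [tuple z i | i < n] th j =
  (Tr th (z j).1 - F^-1 * A) / Num.sqrt (F^-1 * B - (F^-1 * A) ^+ 2).
Proof.
move=> F A B F0; rewrite /residual tnth_mktuple.
have fE : f_hat k h [tuple z i | i < n] (z j).2 = F.
  exact: (kernel_sumE n z (fun=> 1)).
have mE : m_hat k h Tr [tuple z i | i < n] th (z j).2 = F^-1 * A.
  rewrite /m_hat fE; congr (_ * _); rewrite /A -kernel_sumE; congr (kernel_sum _ _ _ _ _).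
  by apply/funext => v; rewrite tnth_mktuple.
congr (_ / _); first by rewrite mE.
congr Num.sqrt; rewrite /s2_hat fE mE.
pose phi (y : V) := (Tr th y.1 - F^-1 * A) ^+ 2.
rewrite (_ : (fun v => _) = (fun v : 'I_n => phi (z v))); last first.
  by apply/funext => v; rewrite tnth_mktuple.
rewrite kernel_sumE /phi.
rewrite (_ : kernel_mean n z _ j = B - (F^-1 * A) *+ 2 * A + (F^-1 * A) ^+ 2 * F); last first.
  rewrite /B /A /F /kernel_mean; move: (_^-1 * (_ * _)) => c.
  rewrite mulrCA -mulrBr mulrCA -mulrDr; congr (_ * _).
  rewrite !mulr_sumr -sumrB -big_split/=; apply: eq_bigr => v _.
  by rewrite sqrrB -mulr_natl -mulr_natl; ring.
by field.
Qed.

Lemma kernel_meanB_le n (z : nat -> V) (psi phi Q : V -> R) j :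
  (forall v, (v < n)%N -> `|psi (z v) - phi (z v)| <= Q (z v)) ->
  `|kernel_mean n z psi j - kernel_mean n z phi j| <=
    n%:R^-1 * \sum_(v < n) `|pair_kernel k h n (z j, z v) * Q (z v)|.
Proof.
move=> psiQ; rewrite /kernel_mean -mulrBr normrM ger0_norm ?invr_ge0//.
rewrite ler_wpM2l ?invr_ge0// -sumrB (le_trans (ler_norm_sum _ _ _))// ler_sum// => v _.
by rewrite -mulrBr !normrM ler_wpM2l// (le_trans (psiQ _ _) (ler_norm _)).
Qed.

End residual_averages.

Section expectation_bounds.
Context d (T : measurableType d) (R : realType) (P : probability T R).

Lemma integralD_le (f g : T -> R) (a b : R) :
  measurable_fun setT f -> measurable_fun setT g -> (forall w, 0 <= f w) -> (forall w, 0 <= g w) ->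
  (\int[P]_w (f w)%:E <= a%:E)%E -> (\int[P]_w (g w)%:E <= b%:E)%E ->
  (\int[P]_w (f w + g w)%:E <= (a + b)%:E)%E.
Proof.
move=> mf mg f0 g0 fa gb.
rewrite (eq_integral (fun w => (f w)%:E + (g w)%:E)%E) => [|w _]; last by rewrite EFinD.
rewrite ge0_integralD//; try by move=> w _; rewrite lee_fin.
- by rewrite EFinD; exact: leeD.
- exact/measurable_EFinP.
- exact/measurable_EFinP.
Qed.

Lemma integral_mean_le (n : nat) (f : nat -> T -> R) (a : R) :
  (forall j, measurable_fun setT (f j)) -> (forall j w, 0 <= f j w) -> 0 <= a ->
  (forall j, (j < n)%N -> (\int[P]_w (f j w)%:E <= a%:E)%E) ->
  (\int[P]_w (n%:R^-1 * \sum_(j < n) f j w)%:E <= a%:E)%E.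
Proof.
move=> mf f0 a0 fa; have n0 : 0 <= n%:R^-1 :> R by rewrite invr_ge0.
have mS : measurable_fun setT (fun w => \sum_(j < n) f j w) by exact: measurable_sum.
rewrite (eq_integral (fun w => n%:R^-1%:E * (\sum_(j < n) f j w)%:E)%E) => [|w _]; last by rewrite EFinM.
rewrite ge0_integralZl_EFin//; last 2 first.
- by move=> w _; rewrite lee_fin sumr_ge0.
- exact/measurable_EFinP.
rewrite (eq_integral (fun w => \sum_(j < n) (f j w)%:E)%E) => [|w _]; last by rewrite sumEFin.
rewrite ge0_integral_sum//; last 2 first.
- by move=> j; exact/measurable_EFinP.
- by move=> j w _; rewrite lee_fin.
apply: (@le_trans _ _ (n%:R^-1%:E * \sum_(j < n) a%:E)%E).
  by apply: lee_wpmul2l; [rewrite lee_fin|apply: lee_sum => j _; exact: fa].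
have -> : (\sum_(j < n) a%:E = (n%:R * a)%:E)%E.
  by rewrite sumEFin; congr EFin; rewrite sumr_const card_ord mulr_natl.
rewrite -EFinM lee_fin mulrA.
have [->|n1] := eqVneq (n%:R : R) 0; first by rewrite mulr0 mul0r.
by rewrite mulVf// mul1r.
Qed.

Lemma markov_bound (f : T -> \bar R) (a b : R) :
  measurable_fun setT f -> (forall w, 0 <= f w)%E -> 0 < a ->
  (\int[P]_w f w <= (a * b)%:E)%E ->
  measurable [set w | (a%:E < f w)%E] /\ (P [set w | (a%:E < f w)%E] <= b%:E)%E.
Proof.
move=> mf f0 a0 fab.
have mA : measurable [set w | (a%:E < f w)%E].
  rewrite -[X in measurable X]setTI.
  by apply: emeasurable_fun_o_infty.
split=> //.
have : (a%:E * P [set w | (a%:E < f w)%E] <= a%:E * b%:E)%E.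
  apply: (le_trans _ fab).
  rewrite -integral_cst// integral_mkcond; apply: ge0_le_integral => //.
  - by move=> w _; rewrite patchE; case: ifP => // _; rewrite lee_fin ltW.
  - exact/(measurable_restrictT _ mA)/measurable_cst.
  move=> w _; rewrite patchE; case: ifPn => // /set_mem.
  by move=> /ltW.
by rewrite lee_pmul2l// lte_fin.
Qed.

End expectation_bounds.

Section good_points.
Context (R : realType) (p : nat).
Notation V := (R * 'rV[R]_p)%type.
Context (mu : probability V R) (f m s : 'rV[R]_p -> R) (t : R -> R).
Hypothesis mf : measurable_fun setT f.
Hypothesis mm : measurable_fun setT m.
Hypothesis ms : measurable_fun setT s.
Hypothesis mt : measurable_fun setT t.
Hypothesis f_gt0 : mu [set v | f v.2 <= 0] = 0%E.
Hypothesis s_gt0 : mu [set v | s v.2 <= 0] = 0%E.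

(** The observations at which [studentized_modulus] applies with the constant [M]. *)
Definition good_points (M : R) : set V :=
  [set v | [&& M^-1 <= f v.2 <= M, `|m v.2| <= M, M^-1 <= s v.2 <= M & `|t v.1| <= M]].

Lemma measurable_good_points M : measurable (good_points M).
Proof.
have m2 (g : 'rV[R]_p -> R) : measurable_fun setT g -> measurable_fun setT (fun v : V => g v.2).
  by move=> mg; exact: (measurableT_comp mg measurable_snd).
have m1 : measurable_fun setT (fun v : V => t v.1) by exact: (measurableT_comp mt measurable_fst).
rewrite -[X in measurable X]setTI.
have mb : measurable_fun setT (fun v : V =>
    [&& M^-1 <= f v.2 <= M, `|m v.2| <= M, M^-1 <= s v.2 <= M & `|t v.1| <= M]).
  repeat apply: measurable_and; apply: measurable_fun_ler => //;
   by [exact: m2|apply: measurableT_comp => //; exact: m2].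
exact: (mb measurableT [set true]).
Qed.

(** As [M] grows the good points exhaust the points of positive density and
    positive conditional variance, which have full measure. *)
Lemma good_points_large (e : R) : 0 < e -> exists2 M : R, 1 <= M & (mu (~` good_points M) <= e%:E)%E.
Proof.
move=> e0; pose F n := ~` good_points n.+1%:R.
have mF n : measurable (F n) by apply: measurableC; exact: measurable_good_points.
have mneg (g : 'rV[R]_p -> R) : measurable_fun setT g -> measurable [set v : V | g v.2 <= 0].
  move=> mg; have mb : measurable_fun setT (fun v : V => g v.2 <= 0).
    by apply: measurable_fun_ler => //; exact: (measurableT_comp mg measurable_snd).
  exact: (measurable_true mb).
have F0 : mu (\bigcap_n F n) = 0%E.
  apply: (@subset_measure0 _ _ _ _ _ ([set v | f v.2 <= 0] `|` [set v | s v.2 <= 0])).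
  - exact: bigcapT_measurable.
  - by apply: measurableU; exact: mneg.
  - move=> v Fv; apply: contrapT => /not_orP[/negP]; rewrite -ltNge => fv /negP.
    rewrite -ltNge => sv.
    pose S := (f v.2)^-1 + f v.2 + `|m v.2| + (s v.2)^-1 + s v.2 + `|t v.1|.
    pose n := Num.trunc S.
    have Sn : S < n.+1%:R by rewrite /n truncnS_gt.
    apply: (Fv n) => //; rewrite /good_points/=.
    have if0 : 0 < (f v.2)^-1 by rewrite invr_gt0.
    have is0 : 0 < (s v.2)^-1 by rewrite invr_gt0.
    have := normr_ge0 (m v.2); have := normr_ge0 (t v.1).
    have n0 : 0 < n.+1%:R :> R by [].
    move: Sn; rewrite /S => ? ? ?.
    have h1 : n.+1%:R^-1 <= f v.2 by rewrite invf_ple ?posrE//; lra.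
    have h2 : n.+1%:R^-1 <= s v.2 by rewrite invf_ple ?posrE//; lra.
    by rewrite h1 h2/=; apply/and4P; split; lra.
  - apply/eqP; rewrite eq_le measure_ge0 andbT.
    apply: (le_trans (measureU2 mu (mneg _ mf) (mneg _ ms))).
    rewrite -[leRHS]adde0; apply: leeD; apply: le_of_eq;
      [exact: f_gt0|exact: s_gt0].
have /fine_cvgP[_ /cvgrPdist_le/(_ e e0)[N _ /(_ N (leqnn N))]] : mu (F n) @[n --> \oo] --> 0%:E.
  rewrite (_ : 0%:E = mu (\bigcap_n F n)) //; apply: (@nonincreasing_cvg_mu _ _ _ mu F _ mF).
  - by rewrite (le_lt_trans (probability_le1 _ _))// ltry.
  - exact: bigcapT_measurable.
  - move=> a b ab; apply/subsetPset/subsetC => v.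
    have ab' : a.+1%:R <= b.+1%:R :> R by rewrite ler_nat.
    have iab : b.+1%:R^-1 <= a.+1%:R^-1 :> R by rewrite lef_pV2 ?posrE.
    rewrite /good_points/= => /and4P[/andP[h1 h2] h3 /andP[h4 h5] h6].
    by rewrite (le_trans iab h1) (le_trans h2 ab') (le_trans h3 ab') (le_trans iab h4)
      (le_trans h5 ab') (le_trans h6 ab').
rewrite /= sub0r normrN => FN; exists N.+1%:R; first by rewrite ler1n.
rewrite -(@fineK _ (mu (F N))) ?fin_num_measure// lee_fin.
exact: (le_trans (ler_norm _) FN).
Qed.

End good_points.

Section residual_consistency.
Context d (T : measurableType d) (R : realType) (P : probability T R) (p q : nat).
Notation V := (R * 'rV[R]_p)%type.
Context (Y : T -> R) (X : T -> 'rV[R]_p).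
Hypothesis mY : measurable_fun setT Y.
Hypothesis mX : measurable_fun setT X.
Context (mu : probability V R) (Z : nat -> T -> V).
Hypothesis mZ : forall j, measurable_fun setT (Z j).
Hypothesis law0 : forall B, measurable B -> P ((fun w => (Y w, X w)) @^-1` B) = mu B.
Hypothesis Zmu : forall j B, measurable B -> P (Z j @^-1` B) = mu B.
Hypothesis Zindep : forall n (B : nat -> set V), (forall j, measurable (B j)) ->
  P [set w | forall j, (j < n)%N -> B j (Z j w)] = (\prod_(j < n) P (Z j @^-1` B j))%E.
Context (k : R -> R) (b : R).
Hypothesis kc : {within `[-1, 1], continuous k}.
Hypothesis k0 : forall u, 1 < `|u| -> k u = 0.
Hypothesis kb : forall u, `|k u| <= b.
Hypothesis k1 : (\int[@lebesgue_measure R]_(u in `[(-1)%R, 1%R]) (k u)%:E = 1)%E.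
Context (h : nat -> R).
Hypothesis h_gt0 : forall n, 0 < h n.
Hypothesis hcvg : h n @[n --> \oo] --> 0.
Hypothesis nhcvg : (n%:R * h n ^+ p)^-1 @[n --> \oo] --> 0.
Context (f : 'rV[R]_p -> R) (C M : R).
Hypothesis fX : is_density P X f.
Hypothesis C_gt0 : 0 < C.
Hypothesis fC : forall x, f x <= C.
Hypothesis M_gt0 : 0 < M.
Hypothesis fM : forall x, f x != 0 -> forall i, `|x ord0 i| <= M.
Context (Theta : set 'rV[R]_q) (Tr : 'rV[R]_q -> R -> R).
Context (m : 'rV[R]_q -> 'rV[R]_p -> R) (s : 'rV[R]_p -> R) (th0 : 'rV[R]_q).
Hypothesis th0_in : Theta th0.
Hypothesis diff : differentiability_assumption P Y X Theta Tr m th0.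
Hypothesis m_reg : is_regression P X (fun w => Tr th0 (Y w)) (m th0).
Hypothesis s_reg : is_regression P X (fun w => (Tr th0 (Y w) - m th0 (X w)) ^+ 2) s.
Hypothesis s_gt0 : {ae P, forall w, 0 < s (X w)}.
Hypothesis m_L2 : (\int[P]_w (m th0 (X w) ^+ 2)%:E < +oo)%E.

Let mYX : measurable_fun setT (fun w => (Y w, X w)).
Proof. exact/measurable_fun_pairP. Qed.

Let mf : measurable_fun setT f. Proof. by case: fX. Qed.
Let mm : measurable_fun setT (m th0). Proof. by case: m_reg. Qed.
Let ms : measurable_fun setT s. Proof. by case: s_reg. Qed.
Let mT0 : measurable_fun setT (Tr th0). Proof. exact: (measurable_transformation diff). Qed.
Let b_ge0 : 0 <= b. Proof. exact: le_trans (kb 0). Qed.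

Let mZ1 j : measurable_fun setT (fun w => (Z j w).1).
Proof. exact: (measurableT_comp measurable_fst (mZ j)). Qed.
Let mZ2 j : measurable_fun setT (fun w => (Z j w).2).
Proof. exact: (measurableT_comp measurable_snd (mZ j)). Qed.

Lemma measurable_kernel_mean n (psi : V -> R) j : measurable_fun setT psi ->
  measurable_fun setT (fun w => kernel_mean k h n (Z^~ w) psi j).
Proof.
move=> mpsi; apply: measurable_funM => //; apply: measurable_sum => v; apply: measurable_funM.
  apply: (measurableT_comp (measurable_pair_kernel kc k0 h n)).
  by apply/measurable_fun_pairP; split; exact: mZ.
exact: (measurableT_comp mpsi (mZ v)).
Qed.

Let regression_one : is_regression P X (fun=> 1) (fun=> 1).
Proof.
have i1 : P.-integrable setT (EFin \o (fun=> 1)).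
  exact: (finite_measure_integrable_cst P 1 measurableT).
by split=> //; exact: measurable_cst.
Qed.

Let regression_second_moment :
  is_regression P X (fun w => Tr th0 (Y w) ^+ 2) (fun x => s x + m th0 x ^+ 2).
Proof.
have int2 (g : T -> R) : measurable_fun setT g -> (\int[P]_w (g w ^+ 2)%:E < +oo)%E ->
    P.-integrable setT (fun w => (g w ^+ 2)%:E).
  move=> mg g2; apply/integrableP; split; first exact/measurable_EFinP/measurable_funX.
  by under eq_integral do rewrite gee0_abs ?lee_fin ?sqr_ge0//.
have [mTY TY2] := transformation_L2 mY diff th0_in.
apply: (regression_sqr mX m_reg s_reg); first exact: int2.
by apply: int2 => //; exact: (measurableT_comp mm mX).
Qed.

(** As one variable [D n j] dominates the deviations for all parameters close to
    [th0], its mean also controls them at the random, estimated parameter.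
    Replacing the estimated parameter by [th0] costs the kernel average of the
    envelope, off the null set [N] where the envelope may fail. *)
Lemma residual_deviation (e : R) : 0 < e ->
  exists (delta : R) (N : set R) (D : nat -> nat -> T -> R),
  [/\ 0 < delta, measurable N /\ P (Y @^-1` N) = 0%E,
    forall n j, measurable_fun setT (D n j) /\ forall w, 0 <= D n j w,
    \forall n \near \oo, forall j, (j < n)%N -> (\int[P]_w (D n j w)%:E <= e%:E)%E &
    forall n w th, Theta th -> enorm (th - th0) <= delta ->
      (forall v, (v < n)%N -> ~ N (Z v w).1) -> forall j, (j < n)%N ->
      [/\ `|kernel_mean k h n (Z^~ w) (fun=> 1) j - f (Z j w).2| <= D n j w,
        `|kernel_mean k h n (Z^~ w) (fun v => Tr th v.1) j - m th0 (Z j w).2 * f (Z j w).2| <= D n j w,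
        `|kernel_mean k h n (Z^~ w) (fun v => Tr th v.1 ^+ 2) j
          - (s (Z j w).2 + m th0 (Z j w).2 ^+ 2) * f (Z j w).2| <= D n j w &
        `|Tr th (Z j w).1 - Tr th0 (Z j w).1| <= D n j w]].
Proof.
move=> e0; pose C' := C * (b ^+ p * 2 ^+ p).
have C'0 : 0 <= C' by rewrite mulr_ge0 ?mulr_ge0 ?exprn_ge0// ltW.
have C1 : 0 < 1 + C' by rewrite ltr_wpDr.
have e5 : 0 < e / 5 by rewrite divr_gt0.
(* The envelope is averaged by the kernel with a factor at most [1 + C'] in mean. *)
have eta0 : 0 < e / 5 / (1 + C') by rewrite divr_gt0.
have [delta [G [N [d0 [mG G0] [mN PN] GN GE]]]] := transformation_envelope mY th0_in diff eta0.
pose Q (y : R) : R := G y + (G y ^+ 2 + 2 * `|Tr th0 y| * G y).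
have mQ : measurable_fun setT Q.
  apply: measurable_funD => //; apply: measurable_funD; first exact: measurable_funX.
  by apply: measurable_funM => //; apply: measurable_funM => //; exact: measurableT_comp.
have Q0 y : 0 <= Q y by rewrite /Q !addr_ge0 ?sqr_ge0// !mulr_ge0.
have mQ1 : measurable_fun setT (fun v : V => Q v.1) by exact: (measurableT_comp mQ measurable_fst).
have QE : (\int[mu]_v `|(Q v.1)%:E| <= (e / 5 / (1 + C'))%:E)%E.
  rewrite -(integral_law mYX law0 (phi := fun v => `|(Q v.1)%:E|%E)).
    by under eq_integral do rewrite gee0_abs ?lee_fin ?Q0//.
  by apply: measurableT_comp => //; exact/measurable_EFinP.
pose a1 n j w : R := `|kernel_mean k h n (Z^~ w) (fun=> 1) j - f (Z j w).2|.
pose a2 n j w : R := `|kernel_mean k h n (Z^~ w) (fun v => Tr th0 v.1) j - m th0 (Z j w).2 * f (Z j w).2|.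
pose a3 n j w : R := `|kernel_mean k h n (Z^~ w) (fun v => Tr th0 v.1 ^+ 2) j
          - (s (Z j w).2 + m th0 (Z j w).2 ^+ 2) * f (Z j w).2|.
pose a4 n j w : R := n%:R^-1 * \sum_(v < n) `|pair_kernel k h n (Z j w, Z v w) * Q (Z v w).1|.
pose a5 (j : nat) w : R := Q (Z j w).1.
have mT1 : measurable_fun setT (fun v : V => Tr th0 v.1).
  exact: (measurableT_comp mT0 measurable_fst).
have mT2 : measurable_fun setT (fun v : V => Tr th0 v.1 ^+ 2) by exact: measurable_funX.
have mfZ j : measurable_fun setT (fun w => f (Z j w).2) by exact: (measurableT_comp mf (mZ2 j)).
have mmZ j : measurable_fun setT (fun w => m th0 (Z j w).2) by exact: (measurableT_comp mm (mZ2 j)).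
have msZ j : measurable_fun setT (fun w => s (Z j w).2) by exact: (measurableT_comp ms (mZ2 j)).
have ma1 n j : measurable_fun setT (a1 n j).
  by apply: measurableT_comp => //; apply: measurable_funB => //; exact: measurable_kernel_mean.
have ma2 n j : measurable_fun setT (a2 n j).
  apply: measurableT_comp => //; apply: measurable_funB; first exact: measurable_kernel_mean.
  exact: measurable_funM.
have ma3 n j : measurable_fun setT (a3 n j).
  apply: measurableT_comp => //; apply: measurable_funB; first exact: measurable_kernel_mean.
  by apply: measurable_funM => //; apply: measurable_funD => //; exact: measurable_funX.
have ma4 n j : measurable_fun setT (a4 n j).
  apply: measurable_funM => //; apply: measurable_sum => v; apply: measurableT_comp => //.
  apply: measurable_funM; last exact: (measurableT_comp mQ1 (mZ v)).
  apply: (measurableT_comp (measurable_pair_kernel kc k0 h n)).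
  by apply/measurable_fun_pairP; split; exact: mZ.
have ma5 j : measurable_fun setT (a5 j) by exact: (measurableT_comp mQ (mZ1 j)).
have a10 n j w : 0 <= a1 n j w by exact: normr_ge0.
have a20 n j w : 0 <= a2 n j w by exact: normr_ge0.
have a30 n j w : 0 <= a3 n j w by exact: normr_ge0.
have a40 n j w : 0 <= a4 n j w by rewrite mulr_ge0 ?invr_ge0// sumr_ge0.
have a50 j w : 0 <= a5 j w by exact: Q0.
pose D n j w : R := a1 n j w + (a2 n j w + (a3 n j w + (a4 n j w + a5 j w))).
exists delta, N, D; split=> //.
- move=> n j; split.
    by do 4 (apply: measurable_funD => //).
  move=> w; rewrite /D; have := a10 n j w; have := a20 n j w; have := a30 n j w.
  by have := a40 n j w; have := a50 j w; lra.
- have m1c : measurable_fun setT (fun _ : V => 1 : R) by exact: measurable_cst.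
  have V1 := kernel_regression_cvg mY mX mZ law0 Zmu Zindep kc k0 kb k1 h_gt0 hcvg nhcvg
    fX C_gt0 fC M_gt0 fM m1c regression_one e5.
  have V2 := kernel_regression_cvg mY mX mZ law0 Zmu Zindep kc k0 kb k1 h_gt0 hcvg nhcvg
    fX C_gt0 fC M_gt0 fM mT1 m_reg e5.
  have V3 := kernel_regression_cvg mY mX mZ law0 Zmu Zindep kc k0 kb k1 h_gt0 hcvg nhcvg
    fX C_gt0 fC M_gt0 fM mT2 regression_second_moment e5.
  have V4 : \forall n \near \oo, b ^+ p * h n ^- p / n%:R <= 1.
    have /cvgrPdist_le/(_ 1 ltr01) : b ^+ p * (n%:R * h n ^+ p)^-1 @[n --> \oo] --> 0.
      by rewrite -(mulr0 (b ^+ p)); apply: cvgM => //; exact: cvg_cst.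
    apply: filterS => n; rewrite sub0r normrN => bn; apply: le_trans bn.
    by rewrite (le_trans _ (ler_norm _))// invfM mulrA mulrAC.
  near=> n => j jn.
  have B1 : (\int[P]_w (a1 n j w)%:E <= (e / 5)%:E)%E.
    have V1n : forall j, (j < n)%N -> _ := near V1 n _.
    under eq_integral do rewrite /a1 -[f _]mul1r.
    exact: V1n.
  have B2 : (\int[P]_w (a2 n j w)%:E <= (e / 5)%:E)%E.
    by have V2n : forall j, (j < n)%N -> _ := near V2 n _; exact: V2n.
  have B3 : (\int[P]_w (a3 n j w)%:E <= (e / 5)%:E)%E.
    by have V3n : forall j, (j < n)%N -> _ := near V3 n _; exact: V3n.
  have B4 : (\int[P]_w (a4 n j w)%:E <= (e / 5)%:E)%E.
    have /= := expect_kernel_average mZ Zmu Zindep (measurable_pair_kernel kc k0 h n)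
      (pair_kernel_le k0 kb h_gt0 n) C'0
      (integral_pair_kernel mY mX law0 kc k0 kb h_gt0 fX C_gt0 fC n) jn mQ1.
    move=> /le_trans; apply.
    apply: (@le_trans _ _ ((1 + C')%:E * (e / 5 / (1 + C'))%:E)%E).
      apply: lee_pmul => //; last by rewrite lee_fin lerD2r; exact: (near V4 n).
      - rewrite lee_fin addr_ge0// mulr_ge0// mulr_ge0 ?exprn_ge0// invr_ge0 exprn_ge0//.
        exact: ltW.
      - exact: integral_ge0.
    by rewrite -EFinM lee_fin mulrC divfK// gt_eqF.
  have B5 : (\int[P]_w (a5 j w)%:E <= (e / 5)%:E)%E.
    rewrite (integral_law (mZ j) (Zmu j) (phi := fun v => (Q v.1)%:E)); last exact/measurable_EFinP.
    apply: (@le_trans _ _ (e / 5 / (1 + C'))%:E).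
      apply: le_trans QE; apply: le_of_eq.
      by apply: eq_integral => v _; rewrite gee0_abs// lee_fin.
    by rewrite lee_fin ler_pdivrMr// ler_peMr ?(ltW e5)// lerDl.
  have -> : e = e / 5 + (e / 5 + (e / 5 + (e / 5 + e / 5))) by lra.
  apply: integralD_le => //; first by do 3 (apply: measurable_funD => //).
    by move=> w; do !apply: addr_ge0 => //.
  apply: integralD_le => //; first by do 2 (apply: measurable_funD => //).
    by move=> w; do !apply: addr_ge0 => //.
  apply: integralD_le => //; first by apply: measurable_funD.
    by move=> w; do !apply: addr_ge0 => //.
  by apply: integralD_le.
move=> n w th Tth thd Nw j jn.
have p1 := a10 n j w; have p2 := a20 n j w; have p3 := a30 n j w.
have p4 := a40 n j w; have p5 := a50 j w.
have GQ y : G y <= Q y.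
  by rewrite /Q lerDl addr_ge0 ?sqr_ge0// !mulr_ge0.
have d1 v : (v < n)%N -> `|Tr th (Z v w).1 - Tr th0 (Z v w).1| <= Q (Z v w).1.
  by move=> vn; apply: (le_trans (GN _ (Nw v vn) th Tth thd)).
have d2 v : (v < n)%N -> `|Tr th (Z v w).1 ^+ 2 - Tr th0 (Z v w).1 ^+ 2| <= Q (Z v w).1.
  move=> vn; have := GN _ (Nw v vn) th Tth thd; have := G0 (Z v w).1.
  rewrite /Q; move: (G _) (Tr th _) (Tr th0 _) => o t t' o0 tt'.
  rewrite (_ : t ^+ 2 - t' ^+ 2 = (t - t') ^+ 2 + 2 * t' * (t - t')); last by ring.
  rewrite (le_trans (ler_normD _ _))// ler_wpDl// !normrM normr_nat lerD//.
    by rewrite expr2 ler_pM.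
  by rewrite ler_wpM2l// mulr_ge0.
have k1' := kernel_meanB_le k h (z := Z^~ w) (psi := fun v => Tr th v.1) (phi := fun v => Tr th0 v.1)
  (Q := fun v => Q v.1) j d1.
have k2' := kernel_meanB_le k h (z := Z^~ w) (psi := fun v => Tr th v.1 ^+ 2)
  (phi := fun v => Tr th0 v.1 ^+ 2) (Q := fun v => Q v.1) j d2.
split.
- by rewrite -/(a1 n j w) /D; lra.
- rewrite -(subrKA (kernel_mean k h n (Z^~ w) (fun v => Tr th0 v.1) j)).
  rewrite (le_trans (ler_normD _ _))// -/(a2 n j w) /D.
  by move: k1'; rewrite -/(a4 n j w); lra.
- rewrite -(subrKA (kernel_mean k h n (Z^~ w) (fun v => Tr th0 v.1 ^+ 2) j)).
  rewrite (le_trans (ler_normD _ _))// -/(a3 n j w) /D.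
  by move: k2'; rewrite -/(a4 n j w); lra.
- by have := d1 j jn; rewrite -/(a5 j w) /D; lra.
Unshelve. all: by end_near. Qed.

Definition std_error (v : V) : R := (Tr th0 v.1 - m th0 v.2) / Num.sqrt (s v.2).

Context (U : nat -> T -> 'rV[R]_q).
Hypothesis mU : forall n, measurable_fun setT (U n).
Hypothesis U_in : forall n w, Theta (U n w).
Hypothesis U_cvg : cvg_in_probability P U th0.

(** The deviations are truncated at [1] because the observations that are not good
    points, and those with a large deviation, are controlled by their frequency
    only.  The other residuals are close to the errors by [studentized_modulus]. *)
Lemma residual_cvg (e : R) : 0 < e -> \forall n \near \oo,
  exists2 A : set T, measurable A /\ ((1 - e)%:E <= P A)%E & forall w, A w ->
  n%:R^-1 * (\sum_(j < n) Num.min 1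
    `|residual k h Tr [tuple Z i w | i < n] (U n w) j - std_error (Z j w)|) <= e.
Proof.
move=> e0; have e2 : 0 < e / 2 by rewrite divr_gt0.
have e4 : 0 < e / 4 by rewrite divr_gt0.
have ee0 : 0 < e ^+ 2 / 16 by rewrite divr_gt0// exprn_gt0.
have mu_f : mu [set v | f v.2 <= 0] = 0%E.
  rewrite -law0; first exact: (density_gt0 fX).
  have mb : measurable_fun setT (fun v : V => f v.2 <= 0).
    by apply: measurable_fun_ler => //; exact: (measurableT_comp mf measurable_snd).
  exact: (measurable_true mb).
have mu_s : mu [set v | s v.2 <= 0] = 0%E.
  have mb : measurable [set v : V | s v.2 <= 0].
    have mb : measurable_fun setT (fun v : V => s v.2 <= 0).
      by apply: measurable_fun_ler => //; exact: (measurableT_comp ms measurable_snd).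
    exact: (measurable_true mb).
  rewrite -law0//; apply/negligibleP.
    by apply: measurable_preimage => //; exact: mYX.
  by apply: negligibleS s_gt0 => w /=; rewrite leNgt => /negP.
have [M1 M11 good] := good_points_large mf mm ms mT0 mu_f mu_s ee0.
have [tau tau0 modulus] := studentized_modulus M11 e2.
have dev0 : 0 < tau * (e ^+ 2 / 16) by rewrite mulr_gt0.
have [delta [N [D [d0 [mN PN] mD ED devD]]]] := residual_deviation dev0.
pose G := good_points f (m th0) s (Tr th0) M1.
have mG : measurable G by exact: measurable_good_points.
pose r n j w : R := \1_(~` G) (Z j w) + tau^-1 * D n j w.
have mind j : measurable_fun setT (fun w => \1_(~` G) (Z j w) : R).
  by apply: (measurableT_comp _ (mZ j)); apply: measurable_indic; exact: measurableC.
have mr n j : measurable_fun setT (r n j).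
  by apply: measurable_funD => //; apply: measurable_funM => //; case: (mD n j).
have D0 n j w : 0 <= D n j w by case: (mD n j).
have itau : 0 < tau^-1 by rewrite invr_gt0.
have r0 n j w : 0 <= r n j w by rewrite addr_ge0// mulr_ge0// ltW.
pose S n w : R := n%:R^-1 * \sum_(j < n) r n j w.
have mS n : measurable_fun setT (S n).
  by apply: measurable_funM => //; exact: measurable_sum.
have S0 n w : 0 <= S n w by rewrite mulr_ge0 ?invr_ge0// sumr_ge0.
have /(_ delta d0) /fine_cvgP[_ /cvgrPdist_le/(_ _ e4) far] := U_cvg.
near=> n.
have Sn : (\int[P]_w (S n w)%:E <= (e / 2 * (e / 4))%:E)%E.
  rewrite (_ : e / 2 * (e / 4) = e ^+ 2 / 16 + e ^+ 2 / 16); last first.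
    by rewrite expr2; field.
  apply: integral_mean_le => //; first by rewrite addr_ge0// ltW.
  move=> j jn; apply: integralD_le => //.
  - by apply: measurable_funM => //; case: (mD n j).
  - by move=> w; rewrite mulr_ge0// ltW.
  - rewrite (integral_law (mZ j) (Zmu j) (phi := fun v => (\1_(~` G) v)%:E)).
      by rewrite integral_indic ?setIT//; exact: measurableC.
    by apply/measurable_EFinP/measurable_indic/measurableC.
  rewrite (eq_integral (fun w => tau^-1%:E * (D n j w)%:E)%E) => [|w _]; last by rewrite EFinM.
  rewrite ge0_integralZl_EFin//; last 3 first.
  - by move=> w _; rewrite lee_fin.
  - by apply/measurable_EFinP; case: (mD n j).
  - exact: ltW.
  have EDn : forall j, (j < n)%N -> _ := near ED n _.
  rewrite -[leRHS](_ : tau^-1%:E * (tau * (e ^+ 2 / 16))%:E = _)%E; last first.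
    by rewrite -EFinM mulKf// gt_eqF.
  by apply: lee_wpmul2l; [rewrite lee_fin ltW|exact: EDn].
have mSn : measurable_fun setT (EFin \o S n) by exact/measurable_EFinP.
have S0n w : (0 <= (EFin \o S n) w)%E by rewrite lee_fin.
have [mB1 PB1] := markov_bound mSn S0n e2 Sn.
pose B2 := [set w | delta < enorm (U n w - th0)].
have mUth : measurable_fun setT (fun w => delta < enorm (U n w - th0)).
  apply: measurable_fun_ltr => //; apply: measurable_enorm.
  apply/measurable_fun_rvP => i.
  rewrite (_ : _ \o _ = fun w => U n w ord0 i - th0 ord0 i); last first.
    by apply/funext => w; rewrite /= /rv_coord !mxE.
  by apply: measurable_funB => //; exact: measurable_fun_coord1.
have mB2 : measurable B2.
  exact: (measurable_true mUth).
have PB2 : (P B2 <= (e / 4)%:E)%E.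
  rewrite -(@fineK _ (P B2)) ?fin_num_measure// lee_fin.
  apply: (le_trans (ler_norm _)); rewrite -normrN -sub0r.
  exact: (near far n).
pose B3 := \bigcup_v ((fun w => (Z v w).1) @^-1` N).
have mB3v v : measurable ((fun w => (Z v w).1) @^-1` N).
  by apply: measurable_preimage => //; exact: mZ1.
have mB3 : measurable B3 by exact: bigcupT_measurable.
have B3_0 : P.-negligible B3.
  apply: negligible_bigcup => v; apply/negligibleP => //.
  have mN1 : measurable [set u : V | N u.1].
    by apply: measurable_preimage => //; exact: measurable_fst.
  exact: (etrans (Zmu v mN1) (etrans (esym (law0 mN1)) PN)).
have PB3 : P B3 = 0%E by exact/negligibleP.
pose B1 := [set w | e / 2 < S n w].
exists (~` (B1 `|` B2 `|` B3)).
  have mB : measurable (B1 `|` B2 `|` B3) by do 2 (apply: measurableU => //).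
  split; first exact: measurableC.
  have PB : (P (B1 `|` B2 `|` B3) <= (e / 2)%:E)%E.
    apply: (le_trans (measureU2 P (measurableU _ _ mB1 mB2) mB3)).
    rewrite -[leRHS](_ : (e / 4 + e / 4)%:E + 0 = _)%E; last by rewrite adde0; congr EFin; lra.
    apply: leeD; last by apply: le_of_eq.
    by apply: (le_trans (measureU2 P mB1 mB2)); rewrite EFinD; exact: leeD.
  rewrite probability_setC// EFinB; apply: leeB => //.
  by apply: (le_trans PB); rewrite lee_fin; lra.
move=> w; rewrite /= => /not_orP[/not_orP[/negP]]; rewrite -leNgt => Snw /negP.
rewrite -leNgt => Unw B3w.
apply: (@le_trans _ _ (n%:R^-1 * \sum_(j < n) (e / 2 + r n j w))).
  rewrite ler_wpM2l ?invr_ge0// ler_sum// => j _.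
  have Nw v : (v < n)%N -> ~ N (Z v w).1 by move=> _ Nv; apply: B3w; exists v.
  have [a1 a2 a3 a4] := devD n w _ (U_in n w) Unw Nw j (ltn_ord j).
  have := r0 n j w; rewrite /r indicE => r0w.
  have tD0 : 0 <= tau^-1 * D n j w by rewrite mulr_ge0// ltW.
  have [Gj|Gj] := pselect (G (Z j w)); last first.
    rewrite mem_set//= ge_min; apply/orP; left; rewrite mulr1n; lra.
  rewrite memNset ?mulr0n ?add0r; last by move=> /(_ Gj).
  have [Dtau|tauD] := leP (D n j w) tau; last first.
    rewrite ge_min; apply/orP; left.
    have : 1 <= tau^-1 * D n j w by rewrite -(mulVf (lt0r_neq0 tau0)) ler_pM2l// ltW.
    by lra.
  move: Gj => /and4P[g1 g2 g3 g4].
  have [F0] := modulus _ _ _ _ _ _ _ _ g1 g2 g3 g4 (le_trans a1 Dtau) (le_trans a2 Dtau)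
    (le_trans a3 Dtau) (le_trans a4 Dtau).
  have F_neq0 : kernel_mean k h n (Z^~ w) (fun=> 1) j != 0 by rewrite gt_eqF.
  rewrite ge_min (residualE Tr (U n w) F_neq0) => le2; apply/orP; right.
  by rewrite (le_trans le2)// lerDl.
have -> : \sum_(j < n) (e / 2 + r n j w) = n%:R * (e / 2) + \sum_(j < n) r n j w.
  by rewrite big_split/=; congr (_ + _); rewrite sumr_const card_ord mulr_natl.
rewrite mulrDr mulrA.
have : n%:R^-1 * n%:R * (e / 2) <= e / 2.
  have [->|n0] := eqVneq (n%:R : R) 0; first by rewrite mulr0 mul0r ltW.
  by rewrite mulVf// mul1r.
by move: Snw; rewrite /S; lra.
Unshelve. all: by end_near. Qed.

End residual_consistency.

(** * Empirical characteristic functions *)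

Section complex_norm.
Context (R : realType).
Implicit Types (a b : R) (z : R[i]).

Lemma normc_sqr z : Normc.normc z ^+ 2 = complex.Re z ^+ 2 + complex.Im z ^+ 2.
Proof. by case: z => a b; rewrite /= sqr_sqrtr// addr_ge0// sqr_ge0. Qed.

Lemma normc_ge0 z : 0 <= Normc.normc z.
Proof. by case: z => a b; exact: sqrtr_ge0. Qed.

Lemma normc_le z : Normc.normc z <= `|complex.Re z| + `|complex.Im z|.
Proof.
rewrite -ler_sqr ?nnegrE ?normc_ge0 ?addr_ge0// normc_sqr sqrrD.
rewrite !real_normK ?num_real// lerD2r lerDl mulrn_wge0// mulr_ge0//.
Qed.

Lemma normc_cis a : Normc.normc (cis a) = 1.
Proof. by rewrite /cis /= cos2Dsin2 sqrtr1. Qed.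

Lemma lipschitz_of_derive (f df : R -> R) :
  (forall x, is_derive x (1 : R) f (df x)) -> (forall x, `|df x| <= 1) ->
  forall a b, `|f a - f b| <= `|a - b|.
Proof.
move=> fdf df1 a b; wlog ab : a b / b <= a.
  move=> ab; have [/ab//|/ltW/ab] := leP b a.
  by rewrite distrC [leRHS]distrC.
have fc : {within `[b, a], continuous f}.
  apply: continuous_subspaceT => x; apply: differentiable_continuous.
  by apply/derivable1_diffP; case: (fdf x).
have [c _ ->] := MVT_segment ab (fun x _ => fdf x) fc.
by rewrite normrM ler_piMl.
Qed.

Lemma cis_lipschitz a b : Normc.normc (cis a - cis b) <= 2 * `|a - b|.
Proof.
apply: (le_trans (normc_le _)); rewrite mulr2n mulrDl mul1r; apply: lerD => /=.
  apply: (lipschitz_of_derive (@is_derive_cos R)) => x.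
  by rewrite normrN sin_max.
exact: (lipschitz_of_derive (@is_derive_sin R) (@cos_max R)).
Qed.

Lemma normcB_le z1 z2 : Normc.normc (z1 - z2) <= Normc.normc z1 + Normc.normc z2.
Proof. by rewrite -[Normc.normc z2]normcN; exact: le_normcD. Qed.

Lemma normc_mean_le (n : nat) (z : 'I_n -> R[i]) :
  Normc.normc (n%:R^-1 * \sum_j z j) <= n%:R^-1 * \sum_j Normc.normc (z j).
Proof.
rewrite Normc.normcM Normc.normcV normcMn Normc.normc1 ler_wpM2l ?invr_ge0//.
elim/big_ind2: _ => [|x1 x2 y1 y2 h1 h2|//]; first by rewrite Normc.normc0.
by rewrite (le_trans (le_normcD _ _))// lerD.
Qed.

Lemma cis_truncated_lipschitz (u t a b : R) :
  Normc.normc (cis (u + t * a) - cis (u + t * b)) <= 2 * (1 + `|t|) * Num.min 1 `|a - b|.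
Proof.
have t0 := normr_ge0 t.
rewrite minEle; case: ifP => _.
  apply: (le_trans (normcB_le _ _)); rewrite !normc_cis; lra.
apply: (le_trans (cis_lipschitz _ _)).
rewrite (_ : u + t * a - _ = t * (a - b)); last by ring.
rewrite -mulrA ler_pM2l// normrM ler_wpM2r//.
by rewrite lerDr.
Qed.

End complex_norm.

Section independence_gap.
Context (R : realType) (p : nat).

(** How far [J] is from factorizing at [(t1, t2)]. *)
Definition gap (J : R -> 'rV[R]_p -> R[i]) (t1 : R) (t2 : 'rV[R]_p) : R[i] :=
  J t1 t2 - J 0 t2 * J t1 0.

Definition sample_cf (n : nat) (x : 'I_n -> 'rV[R]_p) (r : 'I_n -> R) t1 t2 : R[i] :=
  n%:R^-1 * \sum_(j < n) cis (dotp t2 (x j) + t1 * r j).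

Lemma normc_sample_cf n (x : 'I_n -> 'rV[R]_p) (r : 'I_n -> R) t1 t2 :
  Normc.normc (sample_cf x r t1 t2) <= 1.
Proof.
apply: (le_trans (normc_mean_le _)); under eq_bigr do rewrite normc_cis.
rewrite sumr_const card_ord.
have [->|n0] := eqVneq (n%:R : R) 0; first by rewrite mulr0.
by rewrite mulVf.
Qed.

Lemma sample_cfB n (x : 'I_n -> 'rV[R]_p) (r e : 'I_n -> R) t1 t2 :
  Normc.normc (sample_cf x r t1 t2 - sample_cf x e t1 t2) <=
  2 * (1 + `|t1|) * (n%:R^-1 * \sum_(j < n) Num.min 1 `|r j - e j|).
Proof.
rewrite /sample_cf -mulrBr -sumrB (le_trans (normc_mean_le _))//.
rewrite mulrCA ler_wpM2l ?invr_ge0// mulr_sumr ler_sum// => j _.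
exact: cis_truncated_lipschitz.
Qed.

(** Characters are bounded and Lipschitz, so a truncated mean distance controls
    the change of the empirical characteristic functions; the marginal one of the
    covariates does not change. *)
Lemma gap_sample_cfB n (x : 'I_n -> 'rV[R]_p) (r e : 'I_n -> R) t1 t2 :
  Normc.normc (gap (sample_cf x r) t1 t2 - gap (sample_cf x e) t1 t2) <=
  4 * (1 + `|t1|) * (n%:R^-1 * \sum_(j < n) Num.min 1 `|r j - e j|).
Proof.
have E0 : sample_cf x r 0 t2 = sample_cf x e 0 t2.
  by rewrite /sample_cf; congr (_ * _); apply: eq_bigr => j _; rewrite !mul0r.
rewrite /gap E0 (_ : _ - _ = (sample_cf x r t1 t2 - sample_cf x e t1 t2)
  - sample_cf x e 0 t2 * (sample_cf x r t1 0 - sample_cf x e t1 0)); last by ring.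
apply: (le_trans (normcB_le _ _)); rewrite Normc.normcM.
have b1 := sample_cfB x r e t1 t2; have b2 := sample_cfB x r e t1 0.
have b3 : Normc.normc (sample_cf x e 0 t2) * Normc.normc (sample_cf x r t1 0 - sample_cf x e t1 0)
    <= Normc.normc (sample_cf x r t1 0 - sample_cf x e t1 0).
  by rewrite ler_piMl ?normc_ge0// normc_sample_cf.
lra.
Qed.

(** The constant [6] is [1 + 1 + 2 ^+ 2], by the Cauchy-Schwarz inequality; the
    bound [2] is the one of [normc_pop_cf]. *)
Lemma normc_gapB_sqr (J0 J : R -> 'rV[R]_p -> R[i]) t1 t2 :
  Normc.normc (J0 0 t2) <= 1 -> Normc.normc (J t1 0) <= 2 ->
  Normc.normc (gap J0 t1 t2 - gap J t1 t2) ^+ 2 <=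
  6 * (Normc.normc (J0 t1 t2 - J t1 t2) ^+ 2 + Normc.normc (J0 t1 0 - J t1 0) ^+ 2
     + Normc.normc (J0 0 t2 - J 0 t2) ^+ 2).
Proof.
move=> J01 J2; rewrite /gap (_ : _ - _ = (J0 t1 t2 - J t1 t2)
   - (J0 0 t2 * (J0 t1 0 - J t1 0) + (J0 0 t2 - J 0 t2) * J t1 0)); last by ring.
have le1 := le_trans (normcB_le (J0 t1 t2 - J t1 t2)
    (J0 0 t2 * (J0 t1 0 - J t1 0) + (J0 0 t2 - J 0 t2) * J t1 0))
  (lerD (lexx _) (le_normcD _ _)).
rewrite !Normc.normcM in le1.
have le2 := ler_wpM2r (normc_ge0 (J0 t1 0 - J t1 0)) J01.
have le3 := ler_wpM2l (normc_ge0 (J0 0 t2 - J 0 t2)) J2.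
move: le1 le2 le3; set u := Normc.normc (_ - (_ + _)).
have : 0 <= u by exact: normc_ge0.
have := normc_ge0 (J0 t1 t2 - J t1 t2); have := normc_ge0 (J0 t1 0 - J t1 0).
have := normc_ge0 (J0 0 t2 - J 0 t2).
move: (Normc.normc (J0 t1 t2 - J t1 t2)) (Normc.normc (J0 t1 0 - J t1 0))
  (Normc.normc (J0 0 t2 - J 0 t2)) (_ * _) (_ * _) => a b c d d' a0 b0 c0 u0 le1 le2 le3.
have uabc : u <= a + b + 2 * c by lra.
have : u ^+ 2 <= (a + b + 2 * c) ^+ 2 by rewrite lerXn2r// nnegrE; lra.
move=> /le_trans; apply.
have := sqr_ge0 (a - b); have := sqr_ge0 (2 * a - c); have := sqr_ge0 (2 * b - c).
by rewrite !expr2; lra.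
Qed.

Lemma normc_sqr_le3 (z1 z2 z3 : R[i]) :
  Normc.normc z1 ^+ 2 <= 3 * Normc.normc z2 ^+ 2
    + 3 * Normc.normc (z2 - z3) ^+ 2 + 3 * Normc.normc (z3 - z1) ^+ 2.
Proof.
have : Normc.normc z1 <= Normc.normc z2 + Normc.normc (z2 - z3) + Normc.normc (z3 - z1).
  rewrite {1}(_ : z1 = z2 - (z2 - z3) - (z3 - z1)); last by ring.
  by rewrite (le_trans (normcB_le _ _))// lerD2r normcB_le.
have := normc_ge0 z1; have := normc_ge0 z2; have := normc_ge0 (z2 - z3).
have := normc_ge0 (z3 - z1).
move: (Normc.normc z1) (Normc.normc z2) (Normc.normc (z2 - z3)) (Normc.normc (z3 - z1)).
move=> u a b c c0 b0 a0 u0 uabc.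
have : u ^+ 2 <= (a + b + c) ^+ 2 by rewrite lerXn2r// nnegrE; lra.
move=> /le_trans; apply.
have := sqr_ge0 (a - b); have := sqr_ge0 (a - c); have := sqr_ge0 (b - c).
by rewrite !expr2; lra.
Qed.

End independence_gap.

Section complex_measurable.
Context d (T : measurableType d) (R : realType).
Implicit Types f g : T -> R[i].

Definition cmeasurable f : Prop :=
  measurable_fun setT (fun w => complex.Re (f w)) /\
  measurable_fun setT (fun w => complex.Im (f w)).

Lemma cmeasurable_cst (c : R[i]) : cmeasurable (fun=> c).
Proof. by split; exact: measurable_cst. Qed.

Lemma cmeasurable_cis (a : T -> R) : measurable_fun setT a -> cmeasurable (fun w => cis (a w)).
Proof.
move=> ma; split; apply: measurableT_comp => //.
- by apply: continuous_measurable_fun; exact: continuous_cos.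
- by apply: continuous_measurable_fun; exact: continuous_sin.
Qed.

Lemma cmeasurableD f g : cmeasurable f -> cmeasurable g -> cmeasurable (fun w => f w + g w).
Proof.
move=> [f1 f2] [g1 g2]; split.
- rewrite (_ : (fun w => _) = (fun w => complex.Re (f w) + complex.Re (g w))); last first.
    by apply/funext => w; case: (f w) (g w) => [? ?] [].
  exact: measurable_funD.
- rewrite (_ : (fun w => _) = (fun w => complex.Im (f w) + complex.Im (g w))); last first.
    by apply/funext => w; case: (f w) (g w) => [? ?] [].
  exact: measurable_funD.
Qed.

Lemma cmeasurableM f g : cmeasurable f -> cmeasurable g -> cmeasurable (fun w => f w * g w).
Proof.
move=> [f1 f2] [g1 g2]; split.
- rewrite (_ : (fun w => _) = (fun w => complex.Re (f w) * complex.Re (g w)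
      - complex.Im (f w) * complex.Im (g w))); last first.
    by apply/funext => w; case: (f w) (g w) => [? ?] [].
  by apply: measurable_funB; exact: measurable_funM.
- rewrite (_ : (fun w => _) = (fun w => complex.Re (f w) * complex.Im (g w)
      + complex.Im (f w) * complex.Re (g w))); last first.
    by apply/funext => w; case: (f w) (g w) => [? ?] [].
  by apply: measurable_funD; exact: measurable_funM.
Qed.

Lemma cmeasurableB f g : cmeasurable f -> cmeasurable g -> cmeasurable (fun w => f w - g w).
Proof.
move=> mf mg; under eq_fun do rewrite -mulN1r.
by apply: cmeasurableD => //; apply: cmeasurableM => //; exact: cmeasurable_cst.
Qed.

Lemma cmeasurable_sum (I : Type) (s : seq I) (f : I -> T -> R[i]) :
  (forall i, cmeasurable (f i)) -> cmeasurable (fun w => \sum_(i <- s) f i w).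
Proof.
move=> mf; elim: s => [|i s IHs].
  by under eq_fun do rewrite big_nil; exact: cmeasurable_cst.
by under eq_fun do rewrite big_cons; exact: cmeasurableD.
Qed.

Lemma measurable_normc_sqr f : cmeasurable f ->
  measurable_fun setT (fun w => Normc.normc (f w) ^+ 2).
Proof.
move=> [f1 f2]; under eq_fun do rewrite normc_sqr.
by apply: measurable_funD; exact: measurable_funX.
Qed.

End complex_measurable.

Section gap_measurable.
Context d (T : measurableType d) (R : realType) (p : nat).

Lemma measurable_dotp (u v : T -> 'rV[R]_p) :
  measurable_fun setT u -> measurable_fun setT v -> measurable_fun setT (fun w => dotp (u w) (v w)).
Proof.
move=> mu mv; apply: measurable_sum => i.
by apply: measurable_funM; exact: measurable_fun_coord1.
Qed.

Lemma cmeasurable_gap (J : T -> R -> 'rV[R]_p -> R[i]) (t1 : T -> R) (t2 : T -> 'rV[R]_p) :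
  (forall (u1 : T -> R) (u2 : T -> 'rV[R]_p), measurable_fun setT u1 -> measurable_fun setT u2 ->
    cmeasurable (fun w => J w (u1 w) (u2 w))) ->
  measurable_fun setT t1 -> measurable_fun setT t2 ->
  cmeasurable (fun w => gap (J w) (t1 w) (t2 w)).
Proof.
move=> mJ m1 m2; apply: cmeasurableB; first exact: mJ.
by apply: cmeasurableM; apply: mJ => //; exact: measurable_cst.
Qed.

Lemma cmeasurable_sample_cf n (x : 'I_n -> T -> 'rV[R]_p) (r : 'I_n -> T -> R)
    (t1 : T -> R) (t2 : T -> 'rV[R]_p) :
  (forall j, measurable_fun setT (x j)) -> (forall j, measurable_fun setT (r j)) ->
  measurable_fun setT t1 -> measurable_fun setT t2 ->
  cmeasurable (fun w => sample_cf (x^~ w) (r^~ w) (t1 w) (t2 w)).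
Proof.
move=> mx mr m1 m2; apply: cmeasurableM; first exact: cmeasurable_cst.
apply: cmeasurable_sum => j; apply: cmeasurable_cis; apply: measurable_funD.
  exact: measurable_dotp.
exact: measurable_funM.
Qed.

End gap_measurable.

Section empirical_cf.
Context d (T : measurableType d) (R : realType) (P : probability T R) (p : nat).
Notation V := (R * 'rV[R]_p)%type.
Context (mu : probability V R) (Z : nat -> T -> V).
Hypothesis mZ : forall j, measurable_fun setT (Z j).
Hypothesis Zmu : forall j B, measurable B -> P (Z j @^-1` B) = mu B.
Hypothesis Zindep : forall n (B : nat -> set V), (forall j, measurable (B j)) ->
  P [set w | forall j, (j < n)%N -> B j (Z j w)] = (\prod_(j < n) P (Z j @^-1` B j))%E.
Context (eps : V -> R).
Hypothesis meps : measurable_fun setT eps.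

Definition phase (t1 : R) (t2 : 'rV[R]_p) (v : V) : R := dotp t2 v.2 + t1 * eps v.

Lemma measurable_phase t1 t2 : measurable_fun setT (phase t1 t2).
Proof.
apply: measurable_funD; last exact: measurable_funM.
by apply: measurable_dotp; [exact: measurable_cst|exact: measurable_snd].
Qed.

Definition pop_cf (t1 : R) (t2 : 'rV[R]_p) : R[i] :=
  (fine (\int[mu]_v (cos (phase t1 t2 v))%:E) +i* fine (\int[mu]_v (sin (phase t1 t2 v))%:E))%C.

Lemma mean_le1 (g : V -> R) : measurable_fun setT g -> (forall v, `|g v| <= 1) ->
  `|fine (\int[mu]_v (g v)%:E)| <= 1.
Proof.
move=> mg g1; have ig := bounded_integrable mu mg g1.
have fin : (\int[mu]_v (g v)%:E)%E \is a fin_num by exact: integrable_fin_num.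
rewrite -lee_fin -abse_EFin fineK//.
apply: (le_trans (le_abse_integral _ _ _)) => //; first exact/measurable_EFinP.
apply: (@le_trans _ _ (\int[mu]_v 1%:E)%E); last by rewrite integral_cst_prob.
apply: ge0_le_integral => //.
- by apply: measurableT_comp => //; exact/measurable_EFinP.
- by move=> v _; rewrite lee_fin.
Qed.

Let mcos : measurable_fun setT (@cos R).
Proof. by apply: continuous_measurable_fun; exact: continuous_cos. Qed.
Let msin : measurable_fun setT (@sin R).
Proof. by apply: continuous_measurable_fun; exact: continuous_sin. Qed.

Let mcosphase t1 t2 : measurable_fun setT (fun v => cos (phase t1 t2 v)).
Proof. exact: (measurableT_comp mcos (measurable_phase t1 t2)). Qed.
Let msinphase t1 t2 : measurable_fun setT (fun v => sin (phase t1 t2 v)).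
Proof. exact: (measurableT_comp msin (measurable_phase t1 t2)). Qed.

Lemma normc_pop_cf t1 t2 : Normc.normc (pop_cf t1 t2) <= 2.
Proof.
rewrite (le_trans (normc_le _))//= (_ : 2 = 1 + 1)//; apply: lerD; apply: mean_le1 => // v.
- exact: cos_max.
- exact: sin_max.
Qed.

Lemma cmeasurable_pop_cf d' (S : measurableType d') (u1 : S -> R) (u2 : S -> 'rV[R]_p) :
  measurable_fun setT u1 -> measurable_fun setT u2 ->
  cmeasurable (fun s => pop_cf (u1 s) (u2 s)).
Proof.
move=> m1 m2.
have mph : measurable_fun setT (fun x : S * V => phase (u1 x.1) (u2 x.1) x.2).
  apply: measurable_funD.
    apply: measurable_dotp; first exact: (measurableT_comp m2 measurable_fst).
    exact: (measurableT_comp measurable_snd measurable_snd).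
  apply: measurable_funM; first exact: (measurableT_comp m1 measurable_fst).
  exact: (measurableT_comp meps measurable_snd).
split; apply: measurableT_comp => //.
- apply: (measurable_fun_integral_pair mu (F := fun x => (cos (phase (u1 x.1) (u2 x.1) x.2))%:E)).
  by apply/measurable_EFinP; exact: (measurableT_comp mcos mph).
- apply: (measurable_fun_integral_pair mu (F := fun x => (sin (phase (u1 x.1) (u2 x.1) x.2))%:E)).
  by apply/measurable_EFinP; exact: (measurableT_comp msin mph).
Qed.

Lemma iid_mean_sqr n (g : V -> R) : (0 < n)%N -> measurable_fun setT g ->
  (forall v, `|g v| <= 1) ->
  (\int[P]_w ((n%:R^-1 * (\sum_(j < n) g (Z j w)) - fine (\int[mu]_v (g v)%:E)) ^+ 2)%:E
   <= (4 / n%:R)%:E)%E.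
Proof.
move=> n0 mg g1; set c := fine _.
have c1 : `|c| <= 1 by exact: mean_le1.
have ig := bounded_integrable mu mg g1.
have fin : (\int[mu]_v (g v)%:E)%E \is a fin_num by exact: integrable_fin_num.
pose xi (x : V * V) := g x.2 - c.
have mxi : measurable_fun setT xi.
  by apply: measurable_funB => //; exact: (measurableT_comp mg measurable_snd).
have xi2 x : `|xi x| <= 2 by rewrite (le_trans (ler_normB _ _))//; have := g1 x.2; lra.
have xi0 a : (\int[mu]_b (xi (a, b))%:E = 0)%E.
  under eq_integral do rewrite /xi/= EFinB.
  rewrite integralB//; last exact: finite_measure_integrable_cst.
  by rewrite integral_cst_prob -[X in (X - _)%E](fineK fin) subee.
have var := iid_variance mZ Zmu Zindep (iota_uniq 0 n) (j := n) _ mxi xi2 xi0.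
rewrite mem_iota add0n ltnn andbF size_iota in var.
have nn0 : n%:R != 0 :> R by rewrite pnatr_eq0 -lt0n.
rewrite (eq_integral (fun w => (n%:R^-1 ^+ 2)%:E *
    ((\sum_(v <- iota 0 n) xi (Z n w, Z v w)) ^+ 2)%:E)%E); last first.
  move=> w _; rewrite -EFinM -exprMn; congr (_ ^+ 2)%:E.
  have -> : \sum_(v <- iota 0 n) xi (Z n w, Z v w) = \sum_(0 <= v < n) xi (Z n w, Z v w).
    by rewrite /index_iota subn0.
  rewrite big_mkord /xi/= sumrB mulrBr; congr (_ - _).
  by rewrite sumr_const card_ord -[c *+ n]mulr_natl mulKf.
rewrite ge0_integralZl_EFin//; last 2 first.
- by move=> w _; rewrite lee_fin sqr_ge0.
- apply/measurable_EFinP/measurable_funX/measurable_sum => v.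
  by apply: (measurableT_comp mxi); apply/measurable_fun_pairP; split; exact: mZ.
rewrite var//.
apply: (@le_trans _ _ ((n%:R^-1 ^+ 2)%:E * (n%:R%:E * 4%:E))%E); last first.
  by rewrite -!EFinM lee_fin; apply: le_of_eq; field.
apply: lee_wpmul2l; first by rewrite lee_fin sqr_ge0.
apply: lee_wpmul2l; first by rewrite lee_fin.
apply: (@le_trans _ _ (\int[mu]_a 4%:E)%E); last by rewrite integral_cst_prob.
have mxi2 : measurable_fun setT (fun x => (xi x ^+ 2)%:E) by exact/measurable_EFinP/measurable_funX.
apply: ge0_le_integral => //.
- by move=> a _; apply: integral_ge0 => b _; rewrite lee_fin sqr_ge0.
- exact: (measurable_fun_integral_pair mu mxi2).
move=> a _; apply: (@le_trans _ _ (\int[mu]_b 4%:E)%E); last by rewrite integral_cst_prob.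
apply: ge0_le_integral => //.
- by move=> b _; rewrite lee_fin sqr_ge0.
- exact: (measurableT_comp mxi2 (measurable_pair1 a)).
move=> b _; rewrite lee_fin -real_normK ?num_real// (_ : 4 = 2 ^+ 2); last by rewrite -natrX.
by rewrite lerXn2r ?nnegrE.
Qed.

Definition exact_cf n w := sample_cf (fun j : 'I_n => (Z j w).2) (fun j => eps (Z j w)).

Lemma exact_cfE n w t1 t2 : exact_cf n w t1 t2 =
  (n%:R^-1 * (\sum_(j < n) cos (phase t1 t2 (Z j w))) +i*
   (n%:R^-1 * (\sum_(j < n) sin (phase t1 t2 (Z j w)))))%C.
Proof.
have -> : exact_cf n w t1 t2 = n%:R^-1 *
    ((\sum_(j < n) cos (phase t1 t2 (Z j w))) +i* (\sum_(j < n) sin (phase t1 t2 (Z j w))))%C.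
  rewrite /exact_cf /sample_cf; congr (_ * _).
  elim: (index_enum _) => [|j s IHs]; first by rewrite !big_nil.
  by rewrite !big_cons IHs.
rewrite -(rmorph_nat (real_complex R)) -fmorphV /=.
by congr Complex; rewrite /= !mul0r ?subr0 ?addr0.
Qed.

Lemma exact_cf_mean_sqr n t1 t2 : (0 < n)%N ->
  (\int[P]_w (Normc.normc (exact_cf n w t1 t2 - pop_cf t1 t2) ^+ 2)%:E
    <= (4 / n%:R + 4 / n%:R)%:E)%E.
Proof.
move=> n0; under eq_integral do rewrite exact_cfE normc_sqr/=.
apply: integralD_le.
- apply: measurable_funX; apply: measurable_funB => //; apply: measurable_funM => //.
  by apply: measurable_sum => j; exact: (measurableT_comp (mcosphase t1 t2) (mZ j)).
- apply: measurable_funX; apply: measurable_funB => //; apply: measurable_funM => //.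
  by apply: measurable_sum => j; exact: (measurableT_comp (msinphase t1 t2) (mZ j)).
- by move=> w; exact: sqr_ge0.
- by move=> w; exact: sqr_ge0.
- by apply: iid_mean_sqr => // v; exact: cos_max.
- by apply: iid_mean_sqr => // v; exact: sin_max.
Qed.

Lemma cmeasurable_exact_cf d' (S : measurableType d') n (u : S -> T)
    (u1 : S -> R) (u2 : S -> 'rV[R]_p) :
  measurable_fun setT u -> measurable_fun setT u1 -> measurable_fun setT u2 ->
  cmeasurable (fun s => exact_cf n (u s) (u1 s) (u2 s)).
Proof.
move=> mu0 m1 m2.
apply: (cmeasurable_sample_cf (x := fun (j : 'I_n) s => (Z j (u s)).2)
  (r := fun (j : 'I_n) s => eps (Z j (u s)))) => // j.
- exact: (measurableT_comp measurable_snd (measurableT_comp (mZ j) mu0)).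
- exact: (measurableT_comp meps (measurableT_comp (mZ j) mu0)).
Qed.

Lemma measurable_gap_error n : measurable_fun setT (fun x : T * (R * 'rV[R]_p) =>
  Normc.normc (gap (exact_cf n x.1) x.2.1 x.2.2 - gap pop_cf x.2.1 x.2.2) ^+ 2).
Proof.
have m21 : measurable_fun setT (fun x : T * (R * 'rV[R]_p) => x.2.1).
  exact: (measurableT_comp measurable_fst measurable_snd).
have m22 : measurable_fun setT (fun x : T * (R * 'rV[R]_p) => x.2.2).
  exact: (measurableT_comp measurable_snd measurable_snd).
apply: measurable_normc_sqr; apply: cmeasurableB.
  apply: (cmeasurable_gap (J := fun x : T * (R * 'rV[R]_p) => exact_cf n x.1)) => //.
  by move=> u1 u2 m1 m2; apply: cmeasurable_exact_cf => //; exact: measurable_fst.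
by apply: (cmeasurable_gap (J := fun=> pop_cf)) => // u1 u2; exact: cmeasurable_pop_cf.
Qed.

(** Law of large numbers in mean square at each fixed argument: each of the three
    empirical characteristic functions contributes [8 / n]. *)
Lemma gap_mean_sqr n t1 t2 : (0 < n)%N ->
  (\int[P]_w (Normc.normc (gap (exact_cf n w) t1 t2 - gap pop_cf t1 t2) ^+ 2)%:E
    <= (144 / n%:R)%:E)%E.
Proof.
move=> n0.
pose E u1 u2 w := Normc.normc (exact_cf n w u1 u2 - pop_cf u1 u2) ^+ 2.
have E0 u1 u2 w : 0 <= E u1 u2 w by exact: sqr_ge0.
have mE u1 u2 : measurable_fun setT (E u1 u2).
  apply: measurable_normc_sqr; apply: cmeasurableB; last exact: cmeasurable_cst.
  have mid : measurable_fun setT (fun w : T => w) by exact: measurable_id.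
  by apply: (cmeasurable_exact_cf n mid); exact: measurable_cst.
have EE u1 u2 : (\int[P]_w (E u1 u2 w)%:E <= (4 / n%:R + 4 / n%:R)%:E)%E.
  exact: exact_cf_mean_sqr.
pose c : R := 4 / n%:R + 4 / n%:R.
have n1 : 0 < n%:R :> R by rewrite ltr0n.
apply: (@le_trans _ _ (6%:E * (c + c + c)%:E)%E); last first.
  rewrite -EFinM lee_fin /c; apply: le_of_eq; field.
  by rewrite gt_eqF.
apply: (@le_trans _ _ (\int[P]_w (6%:E * (E t1 t2 w + E t1 0 w + E 0 t2 w)%:E))%E).
  apply: ge0_le_integral => //.
  - by move=> w _; rewrite lee_fin sqr_ge0.
  - apply/measurable_EFinP.
    have m3 : measurable_fun setT (fun w => (w, (t1, t2)) : T * (R * 'rV[R]_p)).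
      exact: measurable_pair2.
    exact: (measurableT_comp (measurable_gap_error n) m3).
  - apply: measurable_funeM; apply/measurable_EFinP.
    by apply: measurable_funD => //; apply: measurable_funD.
  move=> w _; rewrite -EFinM lee_fin; apply: normc_gapB_sqr.
    exact: normc_sample_cf.
  exact: normc_pop_cf.
rewrite ge0_integralZl_EFin//; last 2 first.
- by move=> w _; rewrite lee_fin !addr_ge0.
- by apply/measurable_EFinP; apply: measurable_funD => //; apply: measurable_funD.
apply: lee_wpmul2l => //; apply: integralD_le => //; first exact: measurable_funD.
  by move=> w; rewrite addr_ge0.
exact: integralD_le.
Qed.

End empirical_cf.

(** * Energies *)

Section energy.
Context d (T : measurableType d) (R : realType) (P : probability T R).
Context d' (S : measurableType d') (lam : {sigma_finite_measure set S -> \bar R}).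

(** The weight may have infinite mass; a part of it of finite mass, on which [a]
    is bounded, already detects that [g] does not vanish. *)
Lemma integral_restrict_gt0 (g W a : S -> R) :
  measurable_fun setT g -> measurable_fun setT W -> measurable_fun setT a ->
  (forall t, 0 <= g t) -> (forall t, 0 <= W t) ->
  (0 < \int[lam]_t (g t * W t)%:E)%E ->
  exists (W' : S -> R) (K : R), [/\ measurable_fun setT W',
    forall t, 0 <= W' t /\ W' t <= W t, (\int[lam]_t (W' t)%:E < +oo)%E,
    forall t, W' t != 0 -> a t <= K & (0 < \int[lam]_t (g t * W' t)%:E)%E].
Proof.
move=> mg mW ma g0 W0 int0.
have mgW : measurable_fun setT (fun t => (g t * W t)%:E).
  by apply/measurable_EFinP/measurable_funM.
have /sigma_finiteP[F [FT Fnd Foo]] := sigma_finiteT lam.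
pose B n := F n `&` [set t | a t <= n%:R] `&` [set t | W t <= n%:R].
have mB n : measurable (B n).
  have mle (u : S -> R) : measurable_fun setT u -> measurable [set t | u t <= n%:R].
    move=> mu; have mb : measurable_fun setT (fun t => u t <= n%:R) by exact: measurable_fun_ler.
    exact: (measurable_true mb).
  by apply: measurableI; [apply: measurableI; [exact: (Foo n).1|exact: mle]|exact: mle].
have [[n Bn]|/forallNP B0] := pselect (exists n, (0 < \int[lam]_(t in B n) (g t * W t)%:E)%E).
  exists (fun t => W t * \1_(B n) t), n%:R.
  have mW' : measurable_fun setT (fun t => W t * \1_(B n) t).
    by apply: measurable_funM => //; exact: measurable_indic.
  have Boo : (lam (B n) < +oo)%E.
    apply: (@le_lt_trans _ _ (lam (F n))); last exact: (Foo n).2.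
    by apply: le_measure; rewrite ?inE//; [exact: (Foo n).1|move=> t [[]]].
  split=> //.
  - move=> t; rewrite indicE; case: (_ \in _); rewrite ?mulr1 ?mulr0//.
  - apply: (@le_lt_trans _ _ (\int[lam]_t (n%:R%:E * (\1_(B n) t)%:E))%E).
      apply: ge0_le_integral => //.
      + by move=> t _; rewrite lee_fin mulr_ge0.
      + exact/measurable_EFinP.
      + by apply: measurable_funeM; apply/measurable_EFinP/measurable_indic.
      move=> t _; rewrite -EFinM lee_fin indicE; case: (boolP (_ \in _)); last by rewrite !mulr0.
      by rewrite inE !mulr1 => -[].
    rewrite ge0_integralZl_EFin//; last exact/measurable_EFinP/measurable_indic.
    by rewrite integral_indic// setIT lte_mul_pinfty.
  - move=> t; rewrite indicE; case: (boolP (_ \in _)); last by rewrite mulr0 eqxx.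
    by rewrite inE => -[[]].
  move: Bn; rewrite integral_mkcond; congr (_ < _)%E; apply: eq_integral => t _.
  by rewrite patchE indicE; case: ifP => _; rewrite ?mulr1 ?mulr0.
exfalso; move: int0; apply/negP; rewrite -leNgt.
pose N := [set t | g t * W t != 0].
have mN : measurable N.
  have mb : measurable_fun setT (fun t => g t * W t != 0).
    apply: measurable_neg; apply: measurable_fun_eqr => //; exact: measurable_funM.
  exact: (measurable_true mb).
have N0 n : lam.-negligible (B n `&` N).
  have /negP := B0 n; rewrite -leNgt => Bn0.
  have Bn : (\int[lam]_(t in B n) `|(g t * W t)%:E| = 0)%E.
    apply/eqP; rewrite eq_le integral_ge0// andbT; apply: le_trans Bn0.
    apply: le_of_eq; apply: eq_integral => t _.
    by rewrite gee0_abs// lee_fin mulr_ge0.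
  have /(ae_eq_integral_abs lam (mB n) (measurable_funTS mgW)).1[A [mA A0 BA]] := Bn.
  exists A; split=> // t [Bt Nt]; apply: BA => /=; apply/not_implyP; split=> // -[] h.
  by move: Nt; rewrite /N/= h eqxx.
have NN : lam.-negligible N.
  apply: (negligibleS _ (negligible_bigcup N0)) => t Nt.
  have [i _ Fi] : (\bigcup_k F k) t by rewrite -FT.
  pose n := maxn i (maxn (Num.trunc (a t)).+1 (Num.trunc (W t)).+1).
  exists n => //; split=> //; split; first split.
  - by move: Fi; apply/subsetPset/Fnd/leq_maxl.
  - rewrite /= (le_trans (ltW (truncnS_gt _)))// ler_nat.
    by rewrite (leq_trans (leq_maxl _ (Num.trunc (W t)).+1))// leq_maxr.
  - rewrite /= (le_trans (ltW (truncnS_gt _)))// ler_nat.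
    by rewrite (leq_trans (leq_maxr (Num.trunc (a t)).+1 _))// leq_maxr.
have -> : (\int[lam]_t (g t * W t)%:E = \int[lam]_t 0)%E.
  apply: ae_eq_integral => //; case: NN => A [mA A0 NA]; exists A; split=> // t /=.
  move=> /not_implyP[_ h]; apply: NA; apply/eqP => h'; apply: h.
  by rewrite h'.
by rewrite integral0.
Qed.

(** A deterministic signal [g] of positive energy is seen through the random
    integrands [F n w] up to two errors: one that is small on events of large
    probability, uniformly where [a] is bounded, and one whose mean decays at each [t].
    The energy of [F n w] then stays away from [0], so that it diverges when it
    is multiplied by [n]. *)
Lemma energy_diverges (g W a : S -> R) (F E : nat -> T -> S -> R) (rho : nat -> T -> R) (K : R) :
  measurable_fun setT g -> measurable_fun setT W -> measurable_fun setT a ->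
  (forall t, 0 <= g t) -> (forall t, 0 <= W t) -> (forall t, 0 <= a t) -> 0 <= K ->
  (0 < \int[lam]_t (g t * W t)%:E)%E ->
  (forall n w, measurable_fun setT (F n w)) -> (forall n w t, 0 <= F n w t) ->
  (forall n, measurable_fun setT (fun x : T * S => E n x.1 x.2)) ->
  (forall n w t, 0 <= E n w t) ->
  (forall n t, (0 < n)%N -> (\int[P]_w (E n w t)%:E <= (K / n%:R)%:E)%E) ->
  (forall n w, 0 <= rho n w) ->
  (forall e, 0 < e -> \forall n \near \oo,
    exists2 A, measurable A /\ ((1 - e)%:E <= P A)%E & forall w, A w -> rho n w <= e) ->
  (forall n w t, g t <= 3 * F n w t + 3 * (a t * rho n w) ^+ 2 + 3 * E n w t) ->
  forall L e : R, 0 < e -> \forall n \near \oo,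
    exists2 A, measurable A /\ ((1 - e)%:E <= P A)%E &
      forall w, A w -> (L%:E < n%:R%:E * \int[lam]_t (F n w t * W t)%:E)%E.
Proof.
move=> mg mW ma g0 W0 a0 K0 int0 mF F0 mE E0 EK rho0 rho_cvg gFE L e e0.
have [W' [k [mW' W'W W'oo W'a int1]]] := integral_restrict_gt0 mg mW ma g0 W0 int0.
have W'0 t : 0 <= W' t by case: (W'W t).
have [c c0 cint] : exists2 c : R, 0 < c & (c%:E <= \int[lam]_t (g t * W' t)%:E)%E.
  move: int1; case: (\int[lam]_t _)%E => [r| |]//; first by rewrite lte_fin => r0; exists r.
  by move=> _; exists 1 => //; rewrite leey.
have mW'E : measurable_fun setT (fun t => (W' t)%:E) by exact/measurable_EFinP.
pose l := fine (\int[lam]_t (W' t)%:E).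
have lE : (\int[lam]_t (W' t)%:E = l%:E)%E.
  by rewrite fineK// ge0_fin_numE// integral_ge0// => t _; rewrite lee_fin.
have l0 : 0 <= l by apply/fine_ge0/integral_ge0 => t _; rewrite lee_fin.
pose q := 3 * k ^+ 2 * l.
have k20 : 0 <= 3 * k ^+ 2 by rewrite mulr_ge0 ?sqr_ge0.
have q0 : 0 <= q by exact: mulr_ge0.
(* On the events below, [q * e1 ^+ 2 <= c / 4] and [V n w <= c / 12] leave half of the energy [c]. *)
pose e1 := Num.min (e / 2) (Num.min 1 (c / 4 / (q + 1))).
have q10 : 0 < q + 1 by rewrite ltr_wpDl.
have e10 : 0 < e1 by rewrite !lt_min ltr01 !divr_gt0.
have e1e : e1 <= e / 2 by rewrite ge_min lexx.
have e11 : e1 <= 1 by rewrite !ge_min lexx orbT.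
have e1q : q * e1 ^+ 2 <= c / 4.
  apply: (@le_trans _ _ (q * e1)); first by rewrite ler_wpM2l// expr2 ler_piMr// ltW.
  apply: (@le_trans _ _ (q * (c / 4 / (q + 1)))).
    by rewrite ler_wpM2l// !ge_min lexx !orbT.
  rewrite mulrA ler_pdivrMr// mulrC ler_wpM2l//; last by rewrite lerDl.
  by rewrite ltW// divr_gt0.
pose V n w := (\int[lam]_t (E n w t * W' t)%:E)%E.
have mEW n : measurable_fun setT (fun x : T * S => (E n x.1 x.2 * W' x.2)%:E).
  by apply/measurable_EFinP/measurable_funM => //; exact: (measurableT_comp mW' measurable_snd).
have mV n : measurable_fun setT (V n).
  exact: (measurable_fun_integral_pair lam (mEW n)).
have V0 n w : (0 <= V n w)%E by apply: integral_ge0 => t _; rewrite lee_fin mulr_ge0.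
have EV n : (0 < n)%N -> (\int[P]_w V n w <= (K / n%:R * l)%:E)%E.
  move=> n0; rewrite /V (@fubini_tonelli _ _ _ _ _ P lam (fun x => (E n x.1 x.2 * W' x.2)%:E))//=.
  - rewrite EFinM -lE -ge0_integralZl_EFin//; last 2 first.
    + by move=> t _; rewrite lee_fin.
    + by rewrite mulr_ge0// invr_ge0.
    apply: ge0_le_integral => //.
    + by move=> t _; apply: integral_ge0 => w _; rewrite lee_fin mulr_ge0.
    + have mEW2 : measurable_fun setT (fun x : S * T => (E n x.2 x.1 * W' x.1)%:E).
        have msw : measurable_fun setT (fun x : S * T => (x.2, x.1)) by exact: measurable_swap.
        exact: (measurableT_comp (mEW n) msw).
      exact: (measurable_fun_integral_pair P mEW2).
    + exact: measurable_funeM.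
    move=> t _; rewrite (eq_integral (fun w => (W' t)%:E * (E n w t)%:E)%E); last first.
      by move=> w _; rewrite -EFinM mulrC.
    rewrite ge0_integralZl_EFin//; last 2 first.
    + by move=> w _; rewrite lee_fin.
    + apply/measurable_EFinP; exact: (measurableT_comp (mE n) (measurable_pair2 t)).
    by rewrite muleC; apply: lee_wpmul2r; [rewrite lee_fin|exact: EK].
  - by move=> x; rewrite lee_fin mulr_ge0.
near=> n.
have n0 : (0 < n)%N by near: n; exists 1%N.
have n1 : 0 < n%:R :> R by rewrite ltr0n.
have [A [mA PA] rhoA] : exists2 A, measurable A /\ ((1 - e1)%:E <= P A)%E &
    forall w, A w -> rho n w <= e1.
  by near: n; exact: rho_cvg.
have c12 : 0 < c / 12 by rewrite divr_gt0.
have EVn : (\int[P]_w V n w <= (c / 12 * (e / 2))%:E)%E.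
  apply: (le_trans (EV n n0)); rewrite lee_fin mulrAC ler_pdivrMr//.
  rewrite -ler_pdivrMl ?mulr_gt0 ?divr_gt0//.
  by near: n; exact: nbhs_infty_ger.
have [mB PB] := markov_bound (mV n) (V0 n) c12 EVn.
set B := [set w | _] in mB PB.
exists (A `\` B).
  split; first exact: measurableD.
  have PAB : (P A <= P (A `\` B) + (e / 2)%:E)%E.
    apply: (@le_trans _ _ (P ((A `\` B) `|` B))).
      apply: le_measure; rewrite ?inE//; first by apply: measurableU => //; exact: measurableD.
      by move=> w Aw; have [Bw|nBw] := pselect (B w); [right|left].
    apply: (le_trans (measureU2 P (measurableD mA mB) mB)); exact: leeD.
  have := le_trans PA PAB.
  rewrite -(@fineK _ (P (A `\` B))) ?fin_num_measure//; last exact: measurableD.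
  by rewrite -EFinD !lee_fin; lra.
move=> w [Aw] /negP; rewrite -leNgt => Vw.
pose I := (\int[lam]_t (F n w t * W t)%:E)%E.
have mFW : measurable_fun setT (fun t => (F n w t * W' t)%:E).
  by apply/measurable_EFinP/measurable_funM.
have mEWw : measurable_fun setT (fun t => (E n w t * W' t)%:E).
  exact: (measurableT_comp (mEW n) (measurable_pair1 w)).
have FW0 t : 0 <= F n w t * W' t by rewrite mulr_ge0.
have EW0 t : 0 <= E n w t * W' t by rewrite mulr_ge0.
have cI : (c%:E <= 3%:E * I + (c / 4)%:E + 3%:E * (c / 12)%:E)%E.
  apply: (le_trans cint).
  apply: (@le_trans _ _ (\int[lam]_t (3%:E * (F n w t * W' t)%:E
      + (3 * k ^+ 2 * e1 ^+ 2)%:E * (W' t)%:E + 3%:E * (E n w t * W' t)%:E))%E).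
    apply: ge0_le_integral => //.
    - by move=> t _; rewrite lee_fin mulr_ge0.
    - by apply/measurable_EFinP/measurable_funM.
    - by apply: emeasurable_funD; [apply: emeasurable_funD|]; exact: measurable_funeM.
    move=> t _; rewrite -!EFinM -!EFinD lee_fin.
    have [->|W't] := eqVneq (W' t) 0; first by rewrite !mulr0 !addr0.
    have ar : (a t * rho n w) ^+ 2 <= k ^+ 2 * e1 ^+ 2.
      rewrite -exprMn lerXn2r ?nnegrE ?mulr_ge0//; last by rewrite ler_pM// ?W'a// rhoA.
        exact: le_trans (a0 t) (W'a _ W't).
      exact: ltW.
    apply: (le_trans (ler_wpM2r (W'0 t) (gFE n w t))).
    have := ler_wpM2r (W'0 t) ar; rewrite !mulrDl; lra.
  have kk0 : 0 <= 3 * k ^+ 2 * e1 ^+ 2 by rewrite mulr_ge0 ?sqr_ge0.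
  rewrite ge0_integralD//; last 4 first.
  - by move=> t _; rewrite -!EFinM -EFinD lee_fin addr_ge0// mulr_ge0.
  - by apply: emeasurable_funD; exact: measurable_funeM.
  - by move=> t _; rewrite -EFinM lee_fin mulr_ge0.
  - exact: measurable_funeM.
  rewrite ge0_integralD//; last 4 first.
  - by move=> t _; rewrite -EFinM lee_fin mulr_ge0.
  - exact: measurable_funeM.
  - by move=> t _; rewrite -EFinM lee_fin mulr_ge0.
  - exact: measurable_funeM.
  have FW0E t : setT t -> (0 <= (F n w t * W' t)%:E)%E by rewrite lee_fin.
  have EW0E t : setT t -> (0 <= (E n w t * W' t)%:E)%E by rewrite lee_fin.
  have W'0E t : setT t -> (0 <= (W' t)%:E)%E by rewrite lee_fin.
  rewrite !ge0_integralZl_EFin//.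
  apply: leeD; first apply: leeD.
  - apply: lee_wpmul2l => //; apply: ge0_le_integral => //.
    + by apply/measurable_EFinP/measurable_funM.
    + by move=> t _; rewrite lee_fin ler_wpM2l//; case: (W'W t).
  - by rewrite lE -EFinM lee_fin (_ : _ * l = q * e1 ^+ 2)// /q; ring.
  - by apply: lee_wpmul2l.
have Ln : L < n%:R * (c / 6).
  rewrite -ltr_pdivrMr ?divr_gt0//.
  by near: n; exact: nbhs_infty_gtr.
apply: (@lt_le_trans _ _ (n%:R%:E * (c / 6)%:E)%E); first by rewrite -EFinM lte_fin.
apply: lee_wpmul2l; first by rewrite lee_fin.
rewrite -/I; move: cI; case: I => [r| |]; last 2 first.
- by move=> _; rewrite leey.
- by rewrite mulr_infty gtr0_sg// mul1e.
by rewrite -!EFinM -!EFinD !lee_fin; lra.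
Unshelve. all: by end_near. Qed.

End energy.

Section selection.
Context d (T : measurableType d) (R : realType) (P : probability T R).

Lemma exists_near_sup (B : set T) (e : R) : 0 < e ->
  exists A, [/\ measurable A, A `<=` B &
    forall A', measurable A' -> A' `<=` B -> (P A' <= P A + e%:E)%E].
Proof.
move=> e0; pose s := ereal_sup [set P A | A in [set A | measurable A /\ A `<=` B]].
have s1 : (s <= 1)%E by apply: ge_ereal_sup => _ [A [mA _] <-]; exact: probability_le1.
have s0 : (0 <= s)%E.
  by apply: ereal_sup_ubound; exists set0; [split|rewrite measure0].
have sfin : s \is a fin_num by rewrite ge0_fin_numE// (le_lt_trans s1)// ltry.
have [_ [A [mA AB] <-] sA] :
    exists2 x, [set P A | A in [set A | measurable A /\ A `<=` B]] x & (s - e%:E < x)%E.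
  by apply/ereal_sup_gt; rewrite -/s lteBlDr// lteDl.
exists A; split=> // A' mA' A'B.
apply: (@le_trans _ _ s); first by apply: ereal_sup_ubound; exists A'.
by rewrite -leeBlDr// ltW.
Qed.

(** The sets [B n] may fail to be measurable.  The measurable subsets of them that
    witness the different levels [e] are merged into a single sequence by taking
    near maximizers of the probability, which work for all levels at once. *)
Lemma inner_probability_cvg1 (B : nat -> set T) :
  (forall e : R, 0 < e -> \forall n \near \oo,
    exists2 A, measurable A /\ ((1 - e)%:E <= P A)%E & A `<=` B n) ->
  exists2 A : nat -> set T, forall n, measurable (A n) /\ A n `<=` B n &
    P (A n) @[n --> \oo] --> 1%E.
Proof.
move=> BP.
have inv0 n : 0 < n.+1%:R^-1 :> R by rewrite invr_gt0.
have /choice[A HA] : forall n, exists A, [/\ measurable A, A `<=` B n &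
    forall A', measurable A' -> A' `<=` B n -> (P A' <= P A + n.+1%:R^-1%:E)%E].
  by move=> n; exact: exists_near_sup.
exists A => [n|]; first by case: (HA n).
have mA n : measurable (A n) by case: (HA n).
apply/fine_cvgP; split; first by near=> n; exact: fin_num_measure.
apply/cvgrPdist_le => e'; have [e <-] : exists e : R, e = e' by exists e'.
move=> e0; have e2 : 0 < e / 2 by rewrite divr_gt0.
near=> n.
have [A' [mA' PA'] A'B] : exists2 A', measurable A' /\ ((1 - e / 2)%:E <= P A')%E & A' `<=` B n.
  by near: n; exact: BP.
have [_ _ /(_ A' mA' A'B) h] := HA n.
have ne : n.+1%:R^-1 <= e / 2.
  rewrite invf_ple ?posrE// (le_trans _ (_ : n%:R <= _))// ?ler_nat//.
  by near: n; exact: nbhs_infty_ger.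
have PA1 : (P (A n) <= 1)%E by exact: probability_le1.
have [r rE] : exists r : R, P (A n) = r%:E.
  by exists (fine (P (A n))); rewrite fineK// fin_num_measure.
move: (le_trans PA' h) PA1; rewrite /= rE -EFinD !lee_fin/= => h1 h2.
have h3 : 1 <= r + e / 2 + e / 2 by rewrite -lerBlDr (le_trans h1)// lerD2l.
by rewrite ger0_norm ?subr_ge0// lerBlDr (le_trans h3)// -addrA -splitr addrC.
Unshelve. all: by end_near. Qed.

End selection.

(** * Kernel and bandwidth conditions *)

Section tuning.
Context (R : realType) (p : nat).

(** Since [(n * h n ^+ p)^-1] and [n * h n `^ (p + delta)] both vanish, so does
    their product [h n `^ delta]. *)
Lemma bandwidth_cvg (h : nat -> R) : bandwidth_assumption p h ->
  h n @[n --> \oo] --> 0 /\ (n%:R * h n ^+ p)^-1 @[n --> \oo] --> 0.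
Proof.
move=> [h0 [delta d0 hcvg]].
have hge0 n : 0 <= h n by exact: ltW.
have a0 n : 0 <= (n%:R * h n ^+ p)^-1 by rewrite invr_ge0 mulr_ge0// exprn_ge0.
have b0 n : 0 <= n%:R * h n `^ (p%:R + delta) by rewrite mulr_ge0// powR_ge0.
have acvg : (n%:R * h n ^+ p)^-1 @[n --> \oo] --> 0.
  apply: (@squeeze_cvgr _ _ _ _ (fun=> 0)
    (fun n => (n%:R * h n ^+ p)^-1 + n%:R * h n `^ (p%:R + delta))) => //.
    by apply: nearW => n; rewrite a0 lerDl b0.
  exact: cvg_cst.
have bcvg : n%:R * h n `^ (p%:R + delta) @[n --> \oo] --> 0.
  apply: (@squeeze_cvgr _ _ _ _ (fun=> 0)
    (fun n => (n%:R * h n ^+ p)^-1 + n%:R * h n `^ (p%:R + delta))) => //.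
    by apply: nearW => n; rewrite b0 lerDr a0.
  exact: cvg_cst.
split=> //.
have /cvgrPdist_lt ccvg : (n%:R * h n ^+ p)^-1 * (n%:R * h n `^ (p%:R + delta)) @[n --> \oo] --> 0.
  by rewrite -(mulr0 0); exact: cvgM.
apply/cvgrPdist_lt => e e0; near=> n.
have n0 : n%:R != 0 :> R by rewrite pnatr_eq0 -lt0n; near: n; exists 1%N.
have : `|0 - (n%:R * h n ^+ p)^-1 * (n%:R * h n `^ (p%:R + delta))| < e `^ delta.
  by near: n; apply: ccvg; rewrite powR_gt0.
have hn0 : h n != 0 by rewrite gt_eqF.
rewrite !sub0r !normrN (ger0_norm (mulr_ge0 (a0 n) (b0 n))) powRD ?hn0 ?implybT//.
rewrite powR_mulrn ?ltW// (_ : _^-1 * (_ * _) = h n `^ delta); last first.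
  by field; rewrite n0 expf_neq0.
rewrite gtr0_norm// => hd; rewrite ltNge; apply/negP => eh.
move: hd; rewrite ltNge => /negP; apply.
by apply: ge0_ler_powR; rewrite ?nnegrE//; exact: ltW.
Unshelve. all: by end_near. Qed.

Lemma kernel_bounded (k : R -> R) : kernel_assumption p k -> exists b, forall u, `|k u| <= b.
Proof.
move=> [kc [_ k0] _ _].
have nkc : {within `[-1, 1], continuous (fun u => - k u)}.
  by move=> x; apply: cvgN; exact: kc.
have m11 : -1 <= 1 :> R by lra.
have [c1 _ kc1] := EVT_max m11 kc; have [c2 _ kc2] := EVT_max m11 nkc.
exists (`|k c1| + `|k c2|) => u.
have [u1|u1] := ltP 1 `|u|; first by rewrite k0// normr0 addr_ge0.
have uI : u \in `[-1, 1] by rewrite in_itv/= -ler_norml.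
have := kc1 u uI; have := kc2 u uI => /= h1 h2.
have := ler_norm (k c1); have := ler_norm (- k c2); rewrite normrN => h3 h4.
have := normr_ge0 (k c1); have := normr_ge0 (k c2) => h5 h6.
by rewrite ler_norml; apply/andP; split; lra.
Qed.

Lemma kernel_integral (k : R -> R) : kernel_assumption p k ->
  (\int[@lebesgue_measure R]_(u in `[(-1)%R, 1%R]) (k u)%:E = 1)%E.
Proof.
move=> [_ _ /(_ 0%N (leq0n p)) + _]; rewrite /Rintegral.
under eq_integral do rewrite expr0 mul1r.
by case: (integral _ _ _) => [r /= ->//| /= |/=] /eqP; rewrite eq_sym oner_eq0.
Qed.

End tuning.

(** * Divergence of the test statistic *)

Lemma expect_cis_pop_cf d (T : measurableType d) (R : realType) (P : probability T R) (p : nat)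
    (mu : probability (R * 'rV[R]_p)%type R) (Y : T -> R) (X : T -> 'rV[R]_p)
    (eps : R * 'rV[R]_p -> R) t1 t2 :
  measurable_fun setT (fun w => (Y w, X w)) -> measurable_fun setT eps ->
  (forall B, measurable B -> P ((fun w => (Y w, X w)) @^-1` B) = mu B) ->
  expect_cis P (fun w => dotp t2 (X w) + t1 * eps (Y w, X w)) = pop_cf mu eps t1 t2.
Proof.
move=> mYX meps law0; rewrite /expect_cis /pop_cf unlock.
have mph := measurable_phase meps t1 t2.
rewrite -(integral_law mYX law0 (phi := fun v => (cos (phase eps t1 t2 v))%:E)); last first.
  apply/measurable_EFinP; apply: (measurableT_comp _ mph).
  by apply: continuous_measurable_fun; exact: continuous_cos.
rewrite -(integral_law mYX law0 (phi := fun v => (sin (phase eps t1 t2 v))%:E))//.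
apply/measurable_EFinP; apply: (measurableT_comp _ mph).
by apply: continuous_measurable_fun; exact: continuous_sin.
Qed.

Section product_sigma_finite.
Context d1 d2 (T1 : measurableType d1) (T2 : measurableType d2) (R : realType).
Context (m1 : {sigma_finite_measure set T1 -> \bar R})
  (m2 : {sigma_finite_measure set T2 -> \bar R}).

Lemma sigma_finite_product : sigma_finite setT (m1 \x m2)%E.
Proof.
have /sigma_finiteP[F [TF ndF Foo]] := sigma_finiteT m1.
have /sigma_finiteP[G [TG ndG Goo]] := sigma_finiteT m2.
exists (fun n => F n `*` G n).
  apply/esym; rewrite -subTset => -[x y] _.
  have [n _ Fn] : (\bigcup_k F k) x by rewrite -TF.
  have [k _ Gk] : (\bigcup_k G k) y by rewrite -TG.
  exists (maxn n k) => //; split.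
    by move: Fn; exact/subsetPset/ndF/leq_maxl.
  by move: Gk; exact/subsetPset/ndG/leq_maxr.
move=> n; have [mF Fn] := Foo n; have [mG Gn] := Goo n.
split; first exact: measurableX.
by rewrite product_measure1E// lte_mul_pinfty// ge0_fin_numE.
Qed.

Definition product_sigma_finite : {sigma_finite_measure set (T1 * T2)%type -> \bar R} :=
  HB.pack (m1 \x m2)%E (Measure_isSigmaFinite.Build _ _ _ (m1 \x m2)%E sigma_finite_product).

Lemma integral_product_sigma_finite (F : T1 * T2 -> \bar R) :
  measurable_fun setT F -> (forall x, 0 <= F x)%E ->
  (\int[product_sigma_finite]_x F x = \int[m1]_x \int[m2]_y F (x, y))%E.
Proof. by move=> mF F0; exact: (fubini_tonelli1 F mF F0). Qed.

End product_sigma_finite.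

Lemma integral_lebesgue_product (R : realType) (p : nat) (u : R -> 'rV[R]_p -> R) :
  measurable_fun setT (fun t : R * 'rV[R]_p => u t.1 t.2) -> (forall t1 t2, 0 <= u t1 t2) ->
  (\int[product_sigma_finite (@lebesgue_measure R) (rv_lebesgue R p)]_t (u t.1 t.2)%:E =
   \int[@lebesgue_measure R]_t1 \int[rv_lebesgue R p]_t2 (u t1 t2)%:E)%E.
Proof.
move=> mu u0; apply: (@integral_product_sigma_finite _ _ _ _ _
  (@lebesgue_measure R) (rv_lebesgue R p) (fun t => (u t.1 t.2)%:E)).
  exact/measurable_EFinP.
by move=> t; rewrite lee_fin.
Qed.

Theorem theorem2 (d : measure_display) (T : measurableType d) (R : realType)
    (P : probability T R) (p q : nat) (p_gt0 : (0 < p)%N) (q_gt0 : (0 < q)%N)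
    (* the generic pair and the observations *)
    (Y : {RV P >-> R}) (X : {RV P >-> 'rV[R]_p})
    (Y_ : nat -> {RV P >-> R}) (X_ : nat -> {RV P >-> 'rV[R]_p})
    (* transformations, with versions of the conditional moments *)
    (Theta : set 'rV[R]_q) (Tr : 'rV[R]_q -> R -> R)
    (m s2 : 'rV[R]_q -> 'rV[R]_p -> R)
    (m_reg : forall th, Theta th ->
       is_regression P X (fun w => Tr th (Y w)) (m th))
    (s2_reg : forall th, Theta th ->
       is_regression P X (fun w => (Tr th (Y w) - m th (X w)) ^+ 2) (s2 th))
    (* kernel, bandwidth, parameter estimator, weight *)
    (k : R -> R) (h : nat -> R)
    (theta_hat : forall n, n.-tuple (R * 'rV[R]_p) -> 'rV[R]_q)
    (theta_hat_meas : forall n, measurable_fun setT (theta_hat n))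
    (theta_hat_in : forall n z, Theta (theta_hat n z))
    (W : R -> 'rV[R]_p -> R)
    (W_meas : measurable_fun setT (fun t : R * 'rV[R]_p => W t.1 t.2))
    (W_ge0 : forall t1 t2, 0 <= W t1 t2)
    (th0 : 'rV[R]_q) (th0_in : Theta th0)
    (sigma0_gt0 : {ae P, forall w, 0 < s2 th0 (X w)}) :
  let sigma := fun th x => Num.sqrt (s2 th x) in
  let eps := fun th w => (Tr th (Y w) - m th (X w)) / sigma th (X w) in
  let sample := fun n w => [tuple (Y_ j w, X_ j w) | j < n] in
  let th_hat := fun n w => theta_hat n (sample n w) in
  let Delta := fun n w =>
    test_statistic k h Tr (sample n w) W (th_hat n w) in
  (* theta_hat is consistent for th0, at which X and eps are W-dependent *)
  cvg_in_probability P th_hat th0 ->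
  (0 < \int[@lebesgue_measure R]_t1 \int[rv_lebesgue R p]_t2
     (Normc.normc (expect_cis P (fun w => dotp t2 (X w) + t1 * eps th0 w)
        - expect_cis P (fun w => dotp t2 (X w))
          * expect_cis P (fun w => t1 * eps th0 w)) ^+ 2 * W t1 t2)%R%:E)%E ->
  (* (A.1)-(A.4) *)
  independent_copies P Y X (fun j => Y_ j) (fun j => X_ j) ->
  compact (pr_support P X) ->
  kernel_assumption p k ->
  bandwidth_assumption p h ->
  density_assumption P X 1 ->
  (* (A.5), (A.6) *)
  (exists s3 : nat, regression_assumption P X (m th0) (sigma th0) 1 s3) ->
  differentiability_assumption P Y X Theta Tr m th0 ->
  (* (A.8), (A.9) *)
  weight_assumption W ->
  lipschitz_assumption P Y Theta Tr th0 ->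
  cvg_in_probability_pinfty P Delta.
Proof.
move=> sigma eps sample th_hat Delta th_cvg dep [copies indep] Xcompact kerA bandA densA
  [s3 [_ _ _ m2 _]] diff _ _ L.
have mY : measurable_fun setT (Y : T -> R) by [].
have mX : measurable_fun setT (X : T -> 'rV[R]_p) by [].
pose Z j w := (Y_ j w, X_ j w).
have mZ j : measurable_fun setT (Z j) by exact/measurable_fun_pairP.
have mYX : measurable_fun setT (fun w => (Y w, X w)) by exact/measurable_fun_pairP.
pose YX : {mfun T >-> (R * 'rV[R]_p)%type} := HB.pack (fun w => (Y w, X w))
  (isMeasurableFun.Build _ _ _ _ (fun w => (Y w, X w)) mYX).
pose mu : probability (R * 'rV[R]_p)%type R := distribution P YX.
have law0 B : measurable B -> P ((fun w => (Y w, X w)) @^-1` B) = mu B by [].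
have Zmu j B : measurable B -> P (Z j @^-1` B) = mu B by move=> mB; exact: copies.
have Zindep n (B : nat -> set (R * 'rV[R]_p)) : (forall j, measurable (B j)) ->
    P [set w | forall j, (j < n)%N -> B j (Z j w)] = (\prod_(j < n) P (Z j @^-1` B j))%E.
  exact: indep.
have [b kb] := kernel_bounded kerA.
have k1 := kernel_integral kerA.
have [kc [_ k0] _ _] := kerA.
have [hcvg nhcvg] := bandwidth_cvg bandA.
have [h_gt0 _] := bandA.
have [_ [f1 [f1X _ f1sup _ _]]] := densA.
have [f [C [M [fX C0 fC M0 fM]]]] := bounded_density mX f1X f1sup Xcompact.
have m2' : (\int[P]_w (m th0 (X w) ^+ 2)%:E < +oo)%E by move: m2; rewrite unlock.
have mth n : measurable_fun setT (th_hat n).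
  apply: (measurableT_comp (theta_hat_meas n)); apply/measurable_fun_tnthP => i.
  rewrite (_ : _ \o _ = Z i); first exact: mZ.
  by apply/funext => w; rewrite /= tnth_mktuple.
have rhoP e := residual_cvg mY mX mZ law0 Zmu Zindep kc k0 kb k1 h_gt0 hcvg nhcvg fX C0 fC M0 fM
  th0_in diff (m_reg _ th0_in) (s2_reg _ th0_in) sigma0_gt0 m2' mth
  (fun n w => theta_hat_in n _) th_cvg (e := e).
pose se := std_error Tr m (s2 th0) th0.
have mse : measurable_fun setT se.
  have [_ mm _ _] := m_reg _ th0_in; have [_ ms _ _] := s2_reg _ th0_in.
  apply: measurable_funM.
    apply: measurable_funB; last exact: (measurableT_comp mm measurable_snd).
    exact: (measurableT_comp (measurable_transformation diff th0_in) measurable_fst).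
  rewrite (_ : (fun v => _) = (fun v => Num.sqrt (s2 th0 v.2) `^ (-1))); last first.
    by apply/funext => v; rewrite powR_inv1.
  apply: (measurableT_comp (measurable_powR (-1))).
  apply: (measurableT_comp (@measurable_sqrtr R)).
  exact: (measurableT_comp ms measurable_snd).
pose J := pop_cf mu se.
pose lam := product_sigma_finite (@lebesgue_measure R) (rv_lebesgue R p).
pose g (t : measurableTypeR R * 'rV[R]_p) : R := Normc.normc (gap J t.1 t.2) ^+ 2.
pose Wt (t : measurableTypeR R * 'rV[R]_p) : R := W t.1 t.2.
pose a (t : measurableTypeR R * 'rV[R]_p) : R := 4 * (1 + `|t.1|).
pose res n w := residual k h Tr (sample n w) (th_hat n w).
pose F n w (t : measurableTypeR R * 'rV[R]_p) : R :=
  Normc.normc (gap (sample_cf (fun j : 'I_n => (Z j w).2) (res n w)) t.1 t.2) ^+ 2.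
pose E n w (t : measurableTypeR R * 'rV[R]_p) : R :=
  Normc.normc (gap (exact_cf Z se n w) t.1 t.2 - gap J t.1 t.2) ^+ 2.
pose rho n w : R := n%:R^-1 * (\sum_(j < n) Num.min 1 `|res n w j - se (Z j w)|).
have mt1 : measurable_fun setT (fun t : R * 'rV[R]_p => t.1) by exact: measurable_fst.
have mt2 : measurable_fun setT (fun t : R * 'rV[R]_p => t.2) by exact: measurable_snd.
have mF n w : measurable_fun setT (fun t : R * 'rV[R]_p => F n w t).
  apply: measurable_normc_sqr.
  apply: (cmeasurable_gap (J := fun=> sample_cf (fun j : 'I_n => (Z j w).2) (res n w))) => //.
  move=> u1 u2 mu1 mu2.
  by apply: (cmeasurable_sample_cf (x := fun (j : 'I_n) _ => (Z j w).2) (r := fun j _ => res n w j)).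
have mg : measurable_fun setT (fun t : R * 'rV[R]_p => g t).
  apply: measurable_normc_sqr; apply: (cmeasurable_gap (J := fun=> J)) => //.
  by move=> u1 u2; exact: cmeasurable_pop_cf.
have DeltaE n w : Delta n w = (n%:R%:E * \int[lam]_t (F n w t * Wt t)%:E)%E.
  rewrite /Delta /test_statistic; congr (_ * _)%E.
  pose u t1 t2 : R := F n w (t1, t2) * W t1 t2.
  have mu' : measurable_fun setT (fun t : R * 'rV[R]_p => u t.1 t.2).
    by apply: measurable_funM => //; under eq_fun do rewrite -surjective_pairing; exact: mF.
  have u0 t1 t2 : 0 <= u t1 t2 by rewrite mulr_ge0// sqr_ge0.
  transitivity (\int[lam]_t (u t.1 t.2)%:E)%E; last first.
    by apply: eq_integral => t _; rewrite /u -surjective_pairing.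
  rewrite (integral_lebesgue_product mu' u0).
  apply: eq_integral => t1 _; apply: eq_integral => t2 _; congr (Normc.normc _ ^+ 2 * _)%:E.
  have ecfE u1 u2 : ecf k h Tr (sample n w) (th_hat n w) u1 u2 =
      sample_cf (fun j : 'I_n => (Z j w).2) (res n w) u1 u2.
    by congr (_ * _); apply: eq_bigr => j _; rewrite tnth_mktuple.
  by rewrite /gap !ecfE.
have int0 : (0 < \int[lam]_t (g t * Wt t)%:E)%E.
  pose u t1 t2 : R := g (t1, t2) * W t1 t2.
  have mu' : measurable_fun setT (fun t : R * 'rV[R]_p => u t.1 t.2).
    by apply: measurable_funM => //; under eq_fun do rewrite -surjective_pairing; exact: mg.
  have u0 t1 t2 : 0 <= u t1 t2 by rewrite mulr_ge0// sqr_ge0.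
  have -> : (\int[lam]_t (g t * Wt t)%:E = \int[lam]_t (u t.1 t.2)%:E)%E.
    by apply: eq_integral => t _; rewrite /u -surjective_pairing.
  rewrite (integral_lebesgue_product mu' u0).
  apply: (lt_le_trans dep); apply: le_of_eq.
  apply: eq_integral => t1 _; apply: eq_integral => t2 _.
  have cfE u1 u2 : expect_cis P (fun w => dotp u2 (X w) + u1 * eps th0 w) = J u1 u2.
    exact: (expect_cis_pop_cf u1 u2 mYX mse law0).
  congr (Normc.normc (_ - _ * _) ^+ 2 * _)%:E; first exact: cfE.
    rewrite -[RHS]cfE; congr (expect_cis P _); apply/funext => w.
    by rewrite mul0r addr0.
  rewrite -[RHS]cfE; congr (expect_cis P _); apply/funext => w.
  by rewrite /dotp big1 ?add0r// => i _; rewrite mxE mul0r.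
apply: inner_probability_cvg1 => e e0.
have mE n : measurable_fun setT (fun x : T * (measurableTypeR R * 'rV[R]_p) => E n x.1 x.2).
  have := measurable_gap_error mu mZ mse n; exact.
have a0 t : 0 <= a t by rewrite mulr_ge0// addr_ge0.
have ma : measurable_fun setT (fun t : R * 'rV[R]_p => a t).
  by apply: measurable_funM => //; apply: measurable_funD => //; exact: measurableT_comp.
have F0 n w t : 0 <= F n w t by exact: sqr_ge0.
have E0 n w t : 0 <= E n w t by exact: sqr_ge0.
have g0 t : 0 <= g t by exact: sqr_ge0.
have EK n t : (0 < n)%N -> (\int[P]_w (E n w t)%:E <= (144 / n%:R)%:E)%E.
  exact: (gap_mean_sqr mZ Zmu Zindep mse).
have rho0 n w : 0 <= rho n w.
  by rewrite mulr_ge0 ?invr_ge0// sumr_ge0// => j _; rewrite le_min ler01 normr_ge0.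
have gFE n w t : g t <= 3 * F n w t + 3 * (a t * rho n w) ^+ 2 + 3 * E n w t.
  have := normc_sqr_le3 (gap J t.1 t.2)
    (gap (sample_cf (fun j : 'I_n => (Z j w).2) (res n w)) t.1 t.2)
    (gap (exact_cf Z se n w) t.1 t.2).
  move=> /le_trans; apply; rewrite lerD2r lerD2l ler_pM2l//.
  have ar0 : 0 <= a t * rho n w by exact: (mulr_ge0 (a0 t) (rho0 n w)).
  rewrite lerXn2r ?nnegrE ?normc_ge0//.
  exact: gap_sample_cfB.
have W0 (t : measurableTypeR R * 'rV[R]_p) : 0 <= Wt t by exact: W_ge0.
have K0 : 0 <= 144 :> R by [].
have mWt : measurable_fun setT Wt by exact: W_meas.
have := @energy_diverges _ T R P _ _ lam g Wt a F E rho 144 mg mWt ma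
  g0 W0 a0 K0 int0 mF F0 mE E0 EK rho0 rhoP gFE L e e0.
apply: filterS => n [A mA AL]; exists A => // w Aw /=.
by rewrite DeltaE; exact: AL.
Qed.
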